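(* Assume that $E\in L^\infty(D\times\Gamma)$ satisfies $0<E_{\min}\le E(\boldsymbol{x},\boldsymbol{y})\le E_{\max}<\infty$ a.e. in $D\times\Gamma$, and that the approximation pair $\boldsymbol{V}_h$, $W_h$ is inf–sup stable, i.e. $$\sup_{\boldsymbol{0}\ne\boldsymbol{v}\in\boldsymbol{V}_h}\frac{\int_D q\,\nabla\cdot\boldsymbol{v}\,d\boldsymbol{x}}{\|\nabla\boldsymbol{v}\|_{\boldsymbol{L}^2(D)}}\ge\gamma\,\|q\|_{L^2(D)}\qquad\forall q\in W_h ,$$ with $\gamma>0$ uniformly bounded away from zero (that is, independently of the mesh parameter $h$). Then the discrete problem: find $(\boldsymbol{u}_{h,\Lambda},p_{h,\Lambda},\tilde p_{h,\Lambda})\in\boldsymbol{V}_{h,\Lambda}\times W_{h,\Lambda}\times W_{h,\Lambda}$ such that $$a(\boldsymbol{u}_{h,\Lambda},\boldsymbol{v})+b(\boldsymbol{v},p_{h,\Lambda})=f(\boldsymbol{v})\quad\forall\boldsymbol{v}\in\boldsymbol{V}_{h,\Lambda},$$ $$b(\boldsymbol{u}_{h,\Lambda},q)-c(\tilde p_{h,\Lambda},q)=0\quad\forall q\in W_{h,\Lambda},$$ $$-c(p_{h,\Lambda},\tilde q)+d(\tilde p_{h,\Lambda},\tilde q)=0\quad\forall\tilde q\in W_{h,\Lambda},$$ admits a unique solution $(\boldsymbol{u}_{h,\Lambda},p_{h,\Lambda},\tilde p_{h,\Lambda})\in\boldsymbol{V}_{h,\Lambda}\times W_{h,\Lambda}\times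 W_{h,\Lambda}$, satisfying $$|||(\boldsymbol{u}_{h,\Lambda},p_{h,\Lambda},\tilde p_{h,\Lambda})|||\le\frac{C_5}{E_{\min}}\,\alpha^{-1/2}\,\|\boldsymbol{f}\|_{L^2(D)},$$ where $C_5$ depends on $E_{\max}$, $C_K$ and $\gamma$.
   Context: Domain: $D$ is a bounded Lipschitz polygon in $\mathbb{R}^2$ (polyhedral in $\mathbb{R}^3$), $d=2,3$ is the dimension, and $\partial D=\partial D_D\cup\partial D_N$ with $\partial D_D\cap\partial D_N=\emptyset$ and $\partial D_D,\partial D_N\neq\emptyset$. Parameters: $\Gamma=\Gamma_1\times\cdots\times\Gamma_M$ with $\Gamma_k=[-1,1]$, and $\pi=\prod_{k=1}^M\pi_k$ is the product measure with $\pi_k$ the uniform probability measure on $[-1,1]$. The Young's modulus is $E(\boldsymbol{x},\boldsymbol{y})=e_0(\boldsymbol{x})+\sum_{k=1}^M e_k(\boldsymbol{x})y_k$. The Poisson ratio $\nu$ is a fixed constant, and the Lamé coefficients $\mu=\frac{E}{2(1+\nu)}$, $\lambda=\frac{E\nu}{(1+\nu)(1-2\nu)}$ satisfy $0<\mu_1<\mu<\mu_2<\infty$ and $0<\lambda<\infty$ a.e. in $D\times\Gamma$ (so $0<\nu<1/2$). Set $\alpha=\frac{1}{1+\nu}$ and $\beta=\frac{\nu}{1-2\nu}$. Discrete spaces: $V_h\subset H^1_{E_0}(D)=\{v\in H^1(D):v|_{\partial D_D}=0\}$ and $W_h\subset L^2(D)$ are finite-dimensional (finite element) spaces; $\boldsymbol{V}_h$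 is the space of $\mathbb{R}^d$-valued functions with components in $V_h$. For a finite set of multi-indices $\Lambda\subset\mathbb{N}_0^M$, $S_\Lambda=\mathrm{span}\{\psi_{\boldsymbol\alpha}(\boldsymbol{y})=\prod_{i=1}^M\psi_{\alpha_i}(y_i):\boldsymbol\alpha\in\Lambda\}\subset L^2_\pi(\Gamma)$, where $\psi_i$ is the Legendre polynomial of degree $i$ on $[-1,1]$, normalised to be orthonormal with respect to the uniform probability measure ($\psi_0=1$). $\boldsymbol{V}_{h,\Lambda}=\boldsymbol{V}_h\otimes S_\Lambda$, $W_{h,\Lambda}=W_h\otimes S_\Lambda$. Forms: with $\boldsymbol{\varepsilon}(\boldsymbol{v})=\frac12(\nabla\boldsymbol{v}+(\nabla\boldsymbol{v})^\top)$, $a(\boldsymbol{u},\boldsymbol{v})=\alpha\int_\Gamma\int_D E\,\boldsymbol{\varepsilon}(\boldsymbol{u}):\boldsymbol{\varepsilon}(\boldsymbol{v})\,d\boldsymbol{x}\,d\pi$, $b(\boldsymbol{v},p)=-\int_\Gamma\int_D p\,\mathrm{div}\,\boldsymbol{v}\,d\boldsymbol{x}\,d\pi$, $c(p,q)=(\alpha\beta)^{-1}\int_\Gamma\int_D pq\,d\boldsymbol{x}\,d\pi$, $d(p,q)=(\alpha\beta)^{-1}\int_\Gamma\int_D E\,pq\,d\boldsymbol{x}\,d\pi$, $f(\boldsymbol{v})=\int_\Gamma\int_D\boldsymbol{f}(\boldsymbol{x})\cdot\boldsymbol{v}(\boldsymbol{x},\boldsymbol{y})\,d\boldsymbol{x}\,d\pi$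 with $\boldsymbol{f}\in(L^2(D))^d$. Norm: $|||(\boldsymbol{v},q,\tilde q)|||^2=\alpha\|\nabla\boldsymbol{v}\|^2+(\alpha^{-1}+(\alpha\beta)^{-1})\|q\|^2+(\alpha\beta)^{-1}\|\tilde q\|^2$, where $\|\cdot\|$ denotes the norm $\left(\int_\Gamma\int_D|\cdot|^2\,d\boldsymbol{x}\,d\pi\right)^{1/2}$ (Frobenius norm for the gradient). $C_K\in(0,1]$ is the Korn constant, i.e. $\int_D\boldsymbol{\varepsilon}(\boldsymbol{v}):\boldsymbol{\varepsilon}(\boldsymbol{v})\,d\boldsymbol{x}\ge C_K\int_D\nabla\boldsymbol{v}:\nabla\boldsymbol{v}\,d\boldsymbol{x}$ for all $\boldsymbol{v}\in H^1(D;\mathbb{R}^d)$ with $\boldsymbol{v}|_{\partial D_D}=\boldsymbol{0}$. *)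

(* Defs.v *)
From HB Require Import structures.
From mathcomp Require Import all_boot all_order all_algebra.
From mathcomp Require Import all_classical all_reals all_analysis.
From mathcomp Require Import measurable_realfun.

(* Conventions.  Points of R^n are row vectors.  Elements of L^2 and H^1 are
   represented by functions, and equality of such elements is equality almost
   everywhere.  Scalar fields on the physical domain have type 'rV_d -> R,
   vector fields 'rV_d -> 'rV_d; fields depending on the parameter y have
   domain 'rV_d * 'rV_M. *)

Set Implicit Arguments. Unset Strict Implicit. Unset Printing Implicit Defensive.
Import Order.TTheory GRing.Theory Num.Theory.
Import numFieldNormedType.Exports.
Local Open Scope classical_set_scope.
Local Open Scope ring_scope.

Definition rv_display : measure_display.
Proof. exact: default_measure_display. Qed.

Section rv_measurable.
Variables (R : realType) (n : nat).
Let coord (i : 'I_n) (x : 'rV[R]_n) : R := x ord0 i.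
Let rv_set0 : g_sigma_preimage coord set0.
Proof. exact: sigma_algebra0. Qed.
Let rv_setC A : g_sigma_preimage coord A -> g_sigma_preimage coord (~` A).
Proof. exact: sigma_algebraC. Qed.
Let rv_bigcup (F : (set 'rV[R]_n)^nat) :
  (forall i, g_sigma_preimage coord (F i)) ->
  g_sigma_preimage coord (\bigcup_i (F i)).
Proof. exact: sigma_algebra_bigcup. Qed.
HB.instance Definition _ := @isMeasurable.Build rv_display
  'rV[R]_n (g_sigma_preimage coord) rv_set0 rv_setC rv_bigcup.
End rv_measurable.

Lemma measurable_coord (R : realType) n (i : 'I_n) :
  measurable_fun [set: 'rV[R]_n] (fun x : 'rV[R]_n => x ord0 i).
Proof.
move=> _ Y mY; rewrite setTI; apply: sub_sigma_algebra => /=.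
rewrite -bigcup_seq/=; exists i => /=; first by rewrite mem_index_enum.
by exists Y => //; rewrite setTI.
Qed.

Lemma measurable_rowP (R : realType) d (T : measurableType d) n
    (f : T -> 'rV[R]_n) :
  (forall i, measurable_fun [set: T] (fun t => f t ord0 i)) ->
  measurable_fun [set: T] f.
Proof.
move=> mf _ A mA; rewrite setTI.
suff: (g_sigma_preimage (fun i (x : 'rV[R]_n) => x ord0 i)) `<=`
      [set B | measurable (f @^-1` B)] by exact.
apply: smallest_sub => /=.
  split.
  - by rewrite /= preimage_set0.
  - by move=> B /= mB; rewrite setTD preimage_setC; apply: measurableC.
  - by move=> F mF /=; rewrite preimage_bigcup; apply: bigcup_measurable => k _; apply: mF.
rewrite -bigcup_seq => B [i _ [C mC <-]] /=.
by rewrite setTI -[X in measurable X]setTI; exact: mf.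
Qed.

Section image_measure.
Local Open Scope ereal_scope.
Context d d' (T : measurableType d) (T' : measurableType d') (R : realType).
Variables (mu : {measure set T -> \bar R}) (f : {mfun T >-> T'}).

Definition image_measure : set T' -> \bar R := pushforward mu f.

Let im0 : image_measure set0 = 0.
Proof. exact: measure0. Qed.

Let im_ge0 A : 0 <= image_measure A.
Proof. exact: measure_ge0. Qed.

Let im_sigma : semi_sigma_additive image_measure.
Proof. exact: measure_semi_sigma_additive. Qed.

HB.instance Definition _ :=
  isMeasure.Build _ _ _ image_measure im0 im_ge0 im_sigma.

End image_measure.

Section power_measure.
Variables (R : realType).
Local Notation Rm := (measurableTypeR R).

Definition rv_cons n (z : Rm * 'rV[R]_n) : 'rV[R]_n.+1 :=
  \row_i if unlift ord0 i is Some j then z.2 ord0 j else z.1.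

Lemma measurable_rv_cons n :
  measurable_fun [set: Rm * 'rV[R]_n] (@rv_cons n).
Proof.
apply: measurable_rowP => i.
case: (unliftP ord0 i) => [j|] ->.
  rewrite (_ : (fun _ => _) = (fun z : Rm * 'rV[R]_n => z.2 ord0 j)).
    by apply: (measurableT_comp (measurable_coord j)); exact: measurable_snd.
  by apply/funext => z; rewrite mxE liftK.
rewrite (_ : (fun _ => _) = fst); first exact: measurable_fst.
by apply/funext => z; rewrite mxE unlift_none.
Qed.

HB.instance Definition _ n :=
  isMeasurableFun.Build _ _ _ _ (@rv_cons n) (@measurable_rv_cons n).

Section cons_measure.
Variables (n : nat) (m : {sigma_finite_measure set Rm -> \bar R}).
Variable mn : {sigma_finite_measure set 'rV[R]_n -> \bar R}.

Definition cons_measure : set 'rV[R]_n.+1 -> \bar R :=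
  image_measure (m \x mn)%E (@rv_cons n).

HB.instance Definition _ := Measure.on cons_measure.

Let cm_sf : sigma_finite setT cons_measure.
Proof.
have /sigma_finiteP[F [FT ndF F_]] := sigma_finiteT m.
have /sigma_finiteP[G [GT ndG G_]] := sigma_finiteT mn.
pose hd (x : 'rV[R]_n.+1) : Rm := x ord0 ord0.
pose tl (x : 'rV[R]_n.+1) : 'rV[R]_n := \row_j x ord0 (lift ord0 j).
have mhd : measurable_fun setT hd by exact: measurable_coord.
have mtl : measurable_fun setT tl.
  apply: measurable_rowP => i.
  rewrite (_ : (fun t => _) = fun t : 'rV[R]_n.+1 => t ord0 (lift ord0 i)).
    exact: measurable_coord.
  by apply/funext => t; rewrite mxE.
exists (fun k => (hd @^-1` F k) `&` (tl @^-1` G k)).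
  apply/esym; rewrite -subTset => x _.
  have [k _ Fk] : (\bigcup_i F i) (hd x) by rewrite -FT.
  have [l _ Gl] : (\bigcup_i G i) (tl x) by rewrite -GT.
  exists (maxn k l) => //; split => /=.
    by apply: (subsetPset _ _ (ndF _ _ (leq_maxl k l))).
  by apply: (subsetPset _ _ (ndG _ _ (leq_maxr k l))).
move=> k; have [mFk Fk] := F_ k; have [mGk Gk] := G_ k; split.
  apply: measurableI; rewrite -[X in measurable X]setTI.
    exact: mhd.
  exact: mtl.
suff -> : cons_measure (hd @^-1` F k `&` tl @^-1` G k) =
    (m (F k) * mn (G k))%E.
  by rewrite lte_mul_pinfty// ge0_fin_numE.
rewrite -(product_measure1E m mn mFk mGk); congr (product_measure1 m mn).
have tlK (t : Rm) (x : 'rV[R]_n) : tl (rv_cons (t, x)) = x.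
  by apply/rowP => j; rewrite !mxE liftK.
have hdK (t : Rm) (x : 'rV[R]_n) : hd (rv_cons (t, x)) = t.
  by rewrite /hd mxE unlift_none.
by apply/seteqP; split => -[t x] /=; rewrite hdK tlK.
Qed.

HB.instance Definition _ :=
  Measure_isSigmaFinite.Build _ _ _ cons_measure cm_sf.

End cons_measure.

(* the n-fold product m \x ... \x m, carried by row vectors *)
Fixpoint power_measure (m : {sigma_finite_measure set Rm -> \bar R}) n :
    {sigma_finite_measure set 'rV[R]_n -> \bar R} :=
  match n with
  | 0%N => \d_(0 : 'rV[R]_0)
  | n'.+1 => cons_measure m (power_measure m n')
  end.

Definition leb n : {sigma_finite_measure set 'rV[R]_n -> \bar R} :=
  power_measure (@lebesgue_measure R) n.

Lemma ltrN11R : -1 < 1 :> R.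
Proof. by rewrite (lt_trans (ltrN10 R)). Qed.

Definition upi M : {sigma_finite_measure set 'rV[R]_M -> \bar R} :=
  power_measure (uniform_prob ltrN11R) M.

Definition Gamma M : set 'rV[R]_M := [set y | forall k, -1 <= y ord0 k <= 1].

End power_measure.
Arguments leb {R} n.
Arguments upi {R} M.
Arguments Gamma {R} M.

Section function_spaces.
Context {R : realType}.

Definition L2fun {disp} {T : measurableType disp}
    (mu : {measure set T -> \bar R}) (A : set T) (f : T -> R) :=
  measurable_fun A f /\ mu.-integrable A (fun x => (f x ^+ 2)%:E).

Definition Linfun {disp} {T : measurableType disp}
    (mu : set T -> \bar R) (A : set T) (f : T -> R) :=
  measurable_fun A f /\
  exists C : R, {ae mu, forall x, A x -> `|f x| <= C}.

Definition lin_span (T : Type) (U : lmodType R) (A : set (T -> U)) :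
    set (T -> U) :=
  [set f | exists n (c : 'I_n -> R) (g : 'I_n -> T -> U),
    (forall i, A (g i)) /\ f = fun x => \sum_i c i *: g i x].

Definition findim (T : Type) (U : lmodType R) (V : set (T -> U)) :=
  exists A : set (T -> U), finite_set A /\ V = lin_span A.

Definition tensor (T T' : Type) (U : lmodType R)
    (V : set (T -> U)) (S : set (T' -> R^o)) : set (T * T' -> U) :=
  lin_span [set w | exists v s,
    [/\ V v, S s & w = fun z => s z.2 *: v z.1]].

Definition frob m n (A B : 'M[R]_(m, n)) : R :=
  \sum_i \sum_j A i j * B i j.

End function_spaces.

Section polytopes.
Context {R : realType}.
Variable d : nat.
Local Notation X := 'rV[R]_d.

Definition bdry (D : set X) : set X := closure D `\` interior D.

(* Locally D lies strictly above a Lipschitz graph in the unit direction e: a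
   function g invariant under translations along e is a function on the
   orthogonal complement of e. *)
Definition lipschitz_domain (D : set X) :=
  [/\ open D, D !=set0, connected D, bounded_set D &
    forall x, bdry D x -> exists (e : X) (g : X -> R) (k r : R),
      [/\ 0 < r, frob e e = 1, forall y t, g (y + t *: e) = g y,
          k.-lipschitz g & forall y, ball x r y -> (D y <-> g y < frob y e)]].

(* The (d-1)-simplex with vertices p and p + (row j of B), parametrised over
   the reference simplex of R^(d-1). *)
Record facet := Facet { facet_base : X; facet_edges : 'M[R]_(d.-1, d) }.

Definition ref_simplex n : set 'rV[R]_n :=
  [set t | (forall i, 0 <= t ord0 i) /\ \sum_i t ord0 i <= 1].

Lemma measurable_ref_simplex n : measurable (@ref_simplex n).
Proof.
have mc i : measurable_fun setT (fun t : 'rV[R]_n => t ord0 i).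
  exact: measurable_coord.
rewrite (_ : @ref_simplex n = (\bigcap_(i in [set: 'I_n])
   [set t : 'rV[R]_n | 0 <= t ord0 i]) `&`
   [set t : 'rV[R]_n | \sum_i t ord0 i <= 1]); last first.
  by apply/seteqP; split => t [t0 t1]; split => // i *; exact: t0.
apply: measurableI.
  apply: fin_bigcap_measurable => // i _.
  rewrite -[X in measurable X]setTI.
  have := mc i measurableT _ (measurable_itv `[0, +oo[).
  by congr measurable; apply/seteqP; split => t [_] /=; rewrite in_itv/= andbT.
have ms : measurable_fun setT (fun t : 'rV[R]_n => \sum_i t ord0 i).
  exact: measurable_sum.
rewrite -[X in measurable X]setTI.
have := ms measurableT _ (measurable_itv `]-oo, 1]).
by congr measurable; apply/seteqP; split => t [_] /=; rewrite in_itv.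
Qed.

Definition facet_map (f : facet) (t : 'rV[R]_(d.-1)) : X :=
  facet_base f + t *m facet_edges f.

Lemma measurable_facet_map f : measurable_fun setT (facet_map f).
Proof.
apply: measurable_rowP => i.
rewrite (_ : (fun _ => _) = fun t : 'rV[R]_(d.-1) => facet_base f ord0 i +
  \sum_j t ord0 j * facet_edges f j i); last first.
  by apply/funext => t; rewrite !mxE.
apply: measurable_funD => //; apply: measurable_sum => j.
by apply: measurable_funM => //; exact: measurable_coord.
Qed.

HB.instance Definition _ f :=
  isMeasurableFun.Build _ _ _ _ (facet_map f) (measurable_facet_map f).

Definition facet_set (f : facet) : set X :=
  facet_map f @` @ref_simplex d.-1.

Definition facet_measure (f : facet) : {measure set X -> \bar R} :=
  mscale (NngNum (sqrtr_ge0 (\det (facet_edges f *m (facet_edges f)^T))))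
    (image_measure (mrestr (leb d.-1) (@measurable_ref_simplex d.-1))
       (facet_map f)).

(* the (d-1)-dimensional surface measure on the union of the first m facets *)
Definition surface_measure (m : nat) (F : nat -> facet) :
    {measure set X -> \bar R} :=
  msum (fun k => facet_measure (F k)) m.

Definition lipschitz_polytope (D : set X) (m : nat) (F : nat -> facet) :=
  [/\ lipschitz_domain D,
      bdry D = \bigcup_(k in `I_m) facet_set (F k),
      forall k, (k < m)%N -> row_free (facet_edges (F k)) &
      forall j k, (j < m)%N -> (k < m)%N -> j != k ->
        facet_measure (F j) (facet_set (F k)) = 0%E].

Definition boundary_partition (D dD dN : set X) :=
  [/\ bdry D = dD `|` dN, dD `&` dN = set0, dD !=set0 /\ dN !=set0,
      measurable dD & measurable dN].

End polytopes.
Arguments facet R d : clear implicits.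
Arguments Facet {R d}.

Section sobolev.
Context {R : realType}.
Variables (d : nat) (D : set 'rV[R]_d).
Local Notation X := 'rV[R]_d.

Definition partial (i : 'I_d) (f : X -> R) : X -> R :=
  fun x => 'D_(delta_mx ord0 i) f x.

Definition smooth (f : X -> R) := forall s : seq 'I_d,
  continuous (foldr partial f s) /\
  forall i x, derivable (foldr partial f s) x (delta_mx ord0 i).

Definition test_fun (phi : X -> R) := smooth phi /\
  exists K : set X, [/\ compact K, K `<=` D & forall x, ~ K x -> phi x = 0].

Definition has_wpartial (i : 'I_d) (v g : X -> R) :=
  forall phi, test_fun phi ->
    \int[leb d]_(x in D) (v x * partial i phi x) =
    - \int[leb d]_(x in D) (g x * phi x).

Definition H1 (v : X -> R) := L2fun (leb d) D v /\
  forall i, exists g, L2fun (leb d) D g /\ has_wpartial i v g.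

(* the weak partial derivative, unique almost everywhere on D *)
Definition wpartial (i : 'I_d) (v : X -> R) : X -> R :=
  xget (cst 0) [set g | L2fun (leb d) D g /\ has_wpartial i v g].

Definition cvgH1 (phi : nat -> X -> R) (v : X -> R) :=
  (\int[leb d]_(x in D) ((phi n x - v x) ^+ 2)%:E)%E @[n --> \oo] --> 0%E /\
  forall i, (\int[leb d]_(x in D)
    ((partial i (phi n) x - wpartial i v x) ^+ 2)%:E)%E @[n --> \oo] --> 0%E.

Variables (m : nat) (F : nat -> facet R d).
Local Notation sigma := (surface_measure m F).

(* The trace operator is the continuous extension of the restriction to the
   boundary, from functions smooth up to the boundary to H^1. *)
Definition has_trace (v g : X -> R) := L2fun sigma (bdry D) g /\
  exists phi : nat -> X -> R, [/\ forall n, smooth (phi n), cvgH1 phi v &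
    (\int[sigma]_(x in bdry D) ((phi n x - g x) ^+ 2)%:E)%E @[n --> \oo]
      --> 0%E].

(* H^1_{E_0}: vanishing trace on the part dD of the boundary *)
Definition H1E0 (dD : set X) (v : X -> R) := H1 v /\
  exists g, has_trace v g /\ {ae sigma, forall x, dD x -> g x = 0}.

Definition component n (v : X -> 'rV[R]_n) (i : 'I_n) : X -> R :=
  fun x => v x ord0 i.

Definition vec (V : set (X -> R^o)) : set (X -> X) :=
  [set v | forall i, V (component v i)].

Definition grad (v : X -> X) (x : X) : 'M[R]_d :=
  \matrix_(i, j) wpartial j (component v i) x.

Definition strain (v : X -> X) (x : X) : 'M[R]_d :=
  2^-1 *: (grad v x + (grad v x)^T).

Definition wdiv (v : X -> X) (x : X) : R := \tr (grad v x).

Definition normL2 k n (f : X -> 'M[R]_(k, n)) : R :=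
  Num.sqrt (\int[leb d]_(x in D) frob (f x) (f x)).

Definition snormL2 (q : X -> R) : R :=
  Num.sqrt (\int[leb d]_(x in D) (q x ^+ 2)).

Definition korn (dD : set X) (CK : R) :=
  forall v : X -> X, (forall i, H1E0 dD (component v i)) ->
    CK * \int[leb d]_(x in D) frob (grad v x) (grad v x) <=
    \int[leb d]_(x in D) frob (strain v x) (strain v x).

Definition infsup (V W : set (X -> R^o)) (gamma : R) :=
  forall q, W q ->
    ((gamma * snormL2 q)%:E <= ereal_sup
      [set ((\int[leb d]_(x in D) (q x * wdiv v x)) / normL2 (grad v))%:E
        | v in [set v | vec V v /\
                  ~ {ae leb d, forall x, D x -> v x = 0%R}]])%E.

End sobolev.

Section stochastic_galerkin.
Context {R : realType}.
Variables (d M : nat).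
Local Notation X := 'rV[R]_d.
Local Notation Y := 'rV[R]_M.

Definition young (e0 : X -> R) (e : 'I_M -> X -> R) (z : X * Y) : R :=
  e0 z.1 + \sum_k e k z.1 * z.2 ord0 k.

(* Rodrigues' formula, with the factor making the polynomials orthonormal for
   the uniform probability on [-1, 1] *)
Definition legendre (n : nat) : {poly R} :=
  (Num.sqrt n.*2.+1%:R / (2 ^+ n * n`!%:R)) *: (('X^2 - 1) ^+ n)^`(n).

Definition mlegendre (a : 'I_M -> nat) (y : Y) : R^o :=
  \prod_k (legendre (a k)).[y ord0 k].

Definition Sspace (Lam : set ('I_M -> nat)) : set (Y -> R^o) :=
  lin_span (mlegendre @` Lam).

Variable D : set X.

(* The iterated integral does not depend on the representatives chosen, for
   each y, for the weak derivatives in x. *)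
Definition dint (h : X * Y -> R) : R :=
  \int[upi M]_(y in Gamma M) \int[leb d]_(x in D) h (x, y).

Definition slice (U : Type) (u : X * Y -> U) (y : Y) : X -> U :=
  fun x => u (x, y).

Definition xgrad (u : X * Y -> X) (z : X * Y) : 'M[R]_d :=
  grad D (slice u z.2) z.1.
Definition xstrain (u : X * Y -> X) (z : X * Y) : 'M[R]_d :=
  strain D (slice u z.2) z.1.
Definition xdiv (u : X * Y -> X) (z : X * Y) : R :=
  wdiv D (slice u z.2) z.1.

Variables (E : X * Y -> R) (alpha beta : R).

Definition aform (u v : X * Y -> X) : R :=
  alpha * dint (fun z => E z * frob (xstrain u z) (xstrain v z)).
Definition bform (v : X * Y -> X) (p : X * Y -> R) : R :=
  - dint (fun z => p z * xdiv v z).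
Definition cform (p q : X * Y -> R) : R :=
  (alpha * beta)^-1 * dint (fun z => p z * q z).
Definition dform (p q : X * Y -> R) : R :=
  (alpha * beta)^-1 * dint (fun z => E z * p z * q z).
Definition fform (f : X -> X) (v : X * Y -> X) : R :=
  dint (fun z => frob (f z.1) (v z)).

Definition triple_norm (v : X * Y -> X) (q qt : X * Y -> R) : R :=
  Num.sqrt (alpha * dint (fun z => frob (xgrad v z) (xgrad v z))
    + (alpha^-1 + (alpha * beta)^-1) * dint (fun z => q z ^+ 2)
    + (alpha * beta)^-1 * dint (fun z => qt z ^+ 2)).

Definition discrete_solution (f : X -> X)
    (VL : set (X * Y -> X)) (WL : set (X * Y -> R^o))
    (u : X * Y -> X) (p pt : X * Y -> R) :=
  [/\ [/\ VL u, WL p & WL pt],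
      forall v, VL v -> aform u v + bform v p = fform f v,
      forall q, WL q -> bform u q - cform pt q = 0 &
      forall qt, WL qt -> - cform p qt + dform pt qt = 0].

End stochastic_galerkin.

(* Main.v *)
(* In finite dimension the symmetric three-field system is solvable for every
   load vanishing on its kernel, so an a priori estimate gives existence,
   uniqueness and the bound at once.  Testing with the solution gives
   a(u, u) + d(pt, pt) = f(u), and Korn's inequality with E >= Emin bounds grad u
   and pt; the third equation bounds p by pt; the inf-sup condition and the first
   equation bound p by f and grad u.

   - The inf-sup condition on the tensor products is lifted pointwise in y: if v
     represents q |-> (q, div .) in the inner product of gradients on V_h, then
     (q, div v) = |grad v|^2 >= gamma^2 |q|^2, and v is linear in q, hence stays
     in the tensor product.
   - The Poincare constant, needed to bound the load by grad u, is not assumed: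
     Korn's inequality for v(x) (x_b e_a - x_a e_b), whose gradient contains v
     and whose strain does not, bounds |v| by |grad v| on the bounded set D. *)
Require Import Defs.
From mathcomp Require Import all_boot all_order all_algebra.
From mathcomp Require Import all_classical all_reals all_analysis.
From mathcomp Require Import measurable_realfun.
From mathcomp Require Import ring lra.
Set Implicit Arguments. Unset Strict Implicit. Unset Printing Implicit Defensive.
Import Order.TTheory GRing.Theory Num.Theory.
Import numFieldNormedType.Exports.
Local Open Scope classical_set_scope.
Local Open Scope ring_scope.

(** * Finite-dimensional spaces of functions *)

Section FiniteSpan.
Context {R : realType}.
Implicit Types (Z : lmodType R).

(** Fields are represented by functions rather than classes, and [wpartial] selects a weak
    derivative by choice, separately for each parameter y. This shapes the proof in three ways.
    Rules such as linearity of the gradient hold only almost everywhere and rest on uniqueness of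
    weak derivatives, hence on the fundamental lemma of the calculus of variations and its bump
    functions. Gradients chosen slice by slice have no reason to be measurable in (x, y), while the
    bounds on E hold almost everywhere in the product only, so both views have to be reconciled. The
    energies are merely semidefinite and the spanning families may be dependent, so the linear
    system may be singular. The weight alpha^-1 + kappa of the pressure, with kappa = (alpha
    beta)^-1, is treated in two pieces: kappa through the third equation, alpha^-1 through the
    inf-sup condition. Neither resulting constant involves nu, so the estimate does not degenerate
    as nu tends to 1/2. *)

Definition span_of {Z} {I : finType} (Phi : I -> Z) : set Z :=
  [set x | exists c : I -> R, x = \sum_i c i *: Phi i].

Definition subspace {Z} (S : set Z) :=
  S 0 /\ forall a x y, S x -> S y -> S (a *: x + y).

(** Linearity is asked on [S] only: the forms are integrals of products, additive where these are
    integrable, which is known on the discrete spaces and not for arbitrary functions. *)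
Definition linear_on {Z} (S : set Z) (l : Z -> R) :=
  forall a x y, S x -> S y -> l (a *: x + y) = a * l x + l y.

Lemma span_of_subspace Z (I : finType) (Phi : I -> Z) : subspace (span_of Phi).
Proof.
split; first by exists (fun=> 0); rewrite big1// => i _; rewrite scale0r.
move=> a _ _ [c ->] [c' ->]; exists (fun i => a * c i + c' i).
rewrite scaler_sumr -big_split/=; apply: eq_bigr => i _.
by rewrite scalerDl scalerA.
Qed.

Lemma span_of_gen Z (I : finType) (Phi : I -> Z) i : span_of Phi (Phi i).
Proof.
exists (fun j => (j == i)%:R); rewrite (bigD1 i)//= eqxx scale1r big1 ?addr0//.
by move=> j /negPf ->; rewrite scale0r.
Qed.

Lemma subspaceZ Z (S : set Z) a x : subspace S -> S x -> S (a *: x).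
Proof. by move=> [S0 SD] Sx; rewrite -[_ *: _]addr0; exact: SD. Qed.

Lemma subspaceB Z (S : set Z) x y : subspace S -> S x -> S y -> S (x - y).
Proof. by move=> [S0 SD] Sx Sy; rewrite -scaleN1r addrC; exact: SD. Qed.

Lemma subspace_sum Z (S : set Z) (I : finType) (c : I -> R) (x : I -> Z) :
  subspace S -> (forall i, S (x i)) -> S (\sum_i c i *: x i).
Proof.
move=> [S0 SD] Sx; apply: big_ind => //; last by move=> i _; exact: subspaceZ.
by move=> a b Sa Sb; rewrite -[a]scale1r; exact: SD.
Qed.

Lemma linear_on_sum Z (S : set Z) (l : Z -> R) (I : finType) (c : I -> R)
    (x : I -> Z) : subspace S -> linear_on S l -> (forall i, S (x i)) ->
  l (\sum_i c i *: x i) = \sum_i c i * l (x i).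
Proof.
move=> [S0 SD] ll Sx.
have l0 : l 0 = 0.
  by have /eqP := ll 1 0 0 S0 S0; rewrite scale1r addr0 mul1r eq_sym -subr_eq0 addrK => /eqP.
suff : S (\sum_i c i *: x i) /\ l (\sum_i c i *: x i) = \sum_i c i * l (x i).
  by case.
apply: (big_ind2 (fun a b => S a /\ l a = b)) => //.
- move=> a b a' b' [Sa <-] [Sa' <-]; rewrite -[a]scale1r; split; first exact: SD.
  by rewrite ll// scale1r mul1r.
- move=> i _; rewrite -[_ *: _]addr0; split; first exact: SD.
  by rewrite ll// l0 addr0.
Qed.

(** Fredholm alternative: b lies in the row space of A exactly when [cokermx A] annihilates it, and
    by symmetry the transposed columns of [cokermx A] satisfy x A = 0. *)
Lemma symmetric_mx_solve n (A : 'M[R]_n) (b : 'rV[R]_n) : A^T = A ->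
  (forall x : 'rV[R]_n, x *m A = 0 -> x *m b^T = 0) ->
  exists c : 'rV[R]_n, c *m A = b.
Proof.
move=> AT Ab; suff /submxP[c ->] : (b <= A)%MS by exists c.
rewrite submxE -[_ == _]trmx_eq0 trmx_mul; apply/eqP/row_matrixP => i.
rewrite row_mul row0 Ab// -row_mul.
have -> : (cokermx A)^T *m A = (A *m cokermx A)^T by rewrite [RHS]trmx_mul AT.
by rewrite mulmx_coker trmx0 row0.
Qed.

(** The Gram matrix of [Phi] may be singular, since [Phi] may be dependent and [K] degenerate. A
    vector in its kernel gives an element of [S] that is [K]-orthogonal to all of [S], so the
    condition on [l] is the compatibility of the right-hand side. *)
Lemma symmetric_form_solve Z (I : finType) (Phi : I -> Z) (S := span_of Phi)
    (K : Z -> Z -> R) (l : Z -> R) :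
  (forall x y, S x -> S y -> K x y = K y x) ->
  (forall x, S x -> linear_on S (K x)) -> linear_on S l ->
  (forall x, S x -> (forall y, S y -> K x y = 0) -> l x = 0) ->
  exists2 x, S x & forall y, S y -> K x y = l y.
Proof.
move=> Ksym Klin llin Kl.
have sS : subspace S := span_of_subspace Phi.
have SP i : S (Phi i) := span_of_gen Phi i.
pose e := fun i : 'I_#|I| => Phi (enum_val i).
have Se i : S (e i) by exact: SP.
have sumE (c : I -> R) : \sum_i c i *: Phi i = \sum_(k < #|I|) c (enum_val k) *: e k.
  by rewrite [LHS](reindex (@enum_val I I))//=; apply/onW_bij/enum_val_bij.
have SE x : S x -> exists c : 'I_#|I| -> R, x = \sum_k c k *: e k.
  by move=> [c ->]; rewrite sumE; exists (fun k => c (enum_val k)).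
pose A : 'M[R]_#|I| := \matrix_(i, j) K (e i) (e j).
pose b : 'rV[R]_#|I| := \row_j l (e j).
have AT : A^T = A by apply/matrixP => i j; rewrite !mxE Ksym.
have Sc (c : 'rV[R]_#|I|) : S (\sum_k c ord0 k *: e k) by exact: subspace_sum.
have KA (c : 'rV[R]_#|I|) j : K (\sum_k c ord0 k *: e k) (e j) = (c *m A) ord0 j.
  rewrite Ksym// (linear_on_sum _ sS)//; last exact: Klin.
  by rewrite mxE; apply: eq_bigr => k _; rewrite mxE Ksym.
have [|c cA] := @symmetric_mx_solve _ A b AT.
  move=> x xA; apply/rowP => i; rewrite !mxE ord1.
  under eq_bigr do rewrite !mxE.
  rewrite -(linear_on_sum _ sS)//; apply: Kl => // y /SE[c ->].
  rewrite (linear_on_sum _ sS)//; last exact: Klin.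
  by rewrite big1// => k _; rewrite KA xA mxE mulr0.
exists (\sum_k c ord0 k *: e k) => // y /SE[a ->].
rewrite !(linear_on_sum _ sS)//; last exact: Klin.
by apply: eq_bigr => k _; rewrite KA cA mxE.
Qed.

Lemma lin_spanE (T : Type) (U : lmodType R) (A : set (T -> U)) :
  lin_span A = [set f | exists n (c : 'I_n -> R) (g : 'I_n -> T -> U),
    (forall i, A (g i)) /\ f = \sum_i c i *: g i].
Proof.
by apply/seteqP; split => f [n [c [g [Ag ->]]]]; exists n, c, g; split => //;
  rewrite fct_sumE.
Qed.

Lemma lin_span_span_of (T : Type) (U : lmodType R) (A : set (T -> U))
    (I : finType) (Phi : I -> T -> U) :
  (forall i, A (Phi i)) -> A `<=` span_of Phi -> lin_span A = span_of Phi.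
Proof.
move=> AP PA; rewrite lin_spanE; apply/seteqP; split => f.
  move=> [n [c [g [Ag ->]]]]; apply: subspace_sum; first exact: span_of_subspace.
  by move=> i; exact: PA.
move=> [c ->]; exists #|I|, (fun k => c (enum_val k)), (fun k => Phi (enum_val k)).
split=> //; by rewrite [LHS](reindex (@enum_val I I))//=; apply/onW_bij/enum_val_bij.
Qed.

Lemma findim_span_of (T : Type) (U : lmodType R) (V : set (T -> U)) :
  findim V -> exists n (Phi : 'I_n -> T -> U), V = span_of Phi.
Proof.
move=> [A [/finite_seqP[s As] ->]].
exists (size s), (fun i => nth 0 s i).
apply: lin_span_span_of; first by move=> i; rewrite As/= mem_nth.
move=> x; rewrite As/= => xs.
have i_lt : (index x s < size s)%N by rewrite index_mem.
by have := span_of_gen (fun i : 'I_(size s) => nth 0 s i) (Ordinal i_lt); rewrite /= nth_index.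
Qed.

End FiniteSpan.

(** * Spanning families of vector-valued and tensor-product spaces *)

Section TensorSpan.
Context {R : realType} {d : nat}.
Local Notation X := 'rV[R]_d.

Lemma vec_span_of n (Phi : 'I_n -> X -> R^o) :
  vec (span_of Phi) = span_of (fun ik : 'I_d * 'I_n =>
    (fun x => Phi ik.2 x *: delta_mx ord0 ik.1) : X -> X).
Proof.
apply/seteqP; split => v.
  move=> /choice[c cE]; exists (fun ik => c ik.1 ik.2).
  apply/funext => x; apply/rowP => i.
  have := congr1 (fun f => f x) (cE i); rewrite /component/= => ->.
  rewrite !fct_sumE summxE.
  rewrite -(pair_bigA _ (fun (i0 : 'I_d) (k : 'I_n) =>
    (c i0 k *: (Phi k x *: delta_mx ord0 i0 : X)) ord0 i))/=.
  rewrite (bigD1 i)//= [X in _ + X]big1 ?addr0.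
    by apply: eq_bigr => k _; rewrite !mxE !eqxx mulr1.
  move=> j /negPf ji; rewrite big1// => k _.
  by rewrite !mxE eqxx eq_sym ji/= !mulr0.
move=> [c ->] i; exists (fun k => c (i, k)).
apply/funext => x; rewrite /component !fct_sumE summxE.
rewrite (eq_bigr (fun p => (c (p.1, p.2) *:
  (Phi p.2 x *: delta_mx ord0 p.1 : X)) ord0 i)); last by case.
rewrite -(pair_bigA _ (fun (i0 : 'I_d) (k : 'I_n) =>
    (c (i0, k) *: (Phi k x *: delta_mx ord0 i0 : X)) ord0 i))/=.
rewrite (bigD1 i)//= [X in _ + X]big1 ?addr0.
  by apply: eq_bigr => k _; rewrite !mxE !eqxx mulr1.
move=> j /negPf ji; rewrite big1// => k _.
by rewrite !mxE eqxx eq_sym ji/= !mulr0.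
Qed.

Lemma tensor_span_of (T T' : Type) (U : lmodType R) (I J : finType)
    (Phi : I -> T -> U) (Psi : J -> T' -> R^o) :
  tensor (span_of Phi) (span_of Psi) =
  span_of (fun ij : I * J => (fun z => Psi ij.2 z.2 *: Phi ij.1 z.1) : T * T' -> U).
Proof.
apply: lin_span_span_of.
  by move=> [i j]; exists (Phi i), (Psi j); split => //; exact: span_of_gen.
move=> _ [_ [_ [[c ->] [c' ->] ->]]]; exists (fun ij => c ij.1 * c' ij.2).
apply/funext => z; rewrite !fct_sumE.
rewrite -(pair_bigA _ (fun i j => (c i * c' j) *: (Psi j z.2 *: Phi i z.1)))/=.
rewrite scaler_sumr; apply: eq_bigr => i _.
rewrite scaler_suml; apply: eq_bigr => j _.
rewrite !scalerA; congr (_ *: _).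
by rewrite -[(_ *: _) _]/(c' j * Psi j z.2); ring.
Qed.

End TensorSpan.

(** * Boxes and product measures *)

Section Boxes.
Context {R : realType} {d : nat}.
Local Notation X := 'rV[R]_d.
Implicit Types (a b x : X) (D : set X).

Definition obox a b : set X :=
  [set x | forall i, a ord0 i < x ord0 i < b ord0 i].
Definition cbox a b : set X :=
  [set x | forall i, a ord0 i <= x ord0 i <= b ord0 i].

Lemma obox_cbox a b : obox a b `<=` cbox a b.
Proof. by move=> x ab i; have /andP[/ltW -> /ltW ->] := ab i. Qed.

Lemma measurable_coordwise (C : 'I_d -> set R) :
  (forall i, measurable (C i)) -> measurable [set x : X | forall i, C i (x ord0 i)].
Proof.
move=> mC; rewrite (_ : [set x | _] = \bigcap_(i in [set: 'I_d])
    (setT `&` (fun x : X => x ord0 i) @^-1` C i)); last first.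
  by apply/seteqP; split => x Cx i; [split => //; exact: Cx|have [] := Cx i I].
by apply: fin_bigcap_measurable => // i _; exact: measurable_coord.
Qed.

Lemma measurable_obox a b : measurable (obox a b).
Proof.
rewrite (_ : obox a b = [set x | forall i, `]a ord0 i, b ord0 i[%classic (x ord0 i)]).
  exact: (measurable_coordwise (C := fun i => `]a ord0 i, b ord0 i[%classic)).
by apply/seteqP; split => x /= ab i; have := ab i; rewrite in_itv.
Qed.

Lemma measurable_cbox a b : measurable (cbox a b).
Proof.
rewrite (_ : cbox a b = [set x | forall i, `[a ord0 i, b ord0 i]%classic (x ord0 i)]).
  exact: (measurable_coordwise (C := fun i => `[a ord0 i, b ord0 i]%classic)).
by apply/seteqP; split => x /= ab i; have := ab i; rewrite in_itv.
Qed.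

Lemma compact_cbox a b : compact (cbox a b).
Proof.
rewrite (_ : cbox a b = [set x | forall i, `[a ord0 i, b ord0 i]%classic (x ord0 i)]).
  by apply: (@rV_compact _ _ (fun i => `[a ord0 i, b ord0 i]%classic)) => i; exact: segment_compact.
by apply/seteqP; split => x /= ab i; have := ab i; rewrite in_itv.
Qed.

(** Lower and upper corners of the boxes with rational centre and half-width 1/(k+1). The family is
    countable, so unions of such boxes stay measurable and their exceptional sets stay null. *)
Definition rlo (qk : 'rV[rat]_d * nat) : X := \row_i (ratr (qk.1 ord0 i) - qk.2.+1%:R^-1).
Definition rhi (qk : 'rV[rat]_d * nat) : X := \row_i (ratr (qk.1 ord0 i) + qk.2.+1%:R^-1).

Lemma open_rational_box D x : open D -> D x ->
  exists qk, obox (rlo qk) (rhi qk) x /\ cbox (rlo qk) (rhi qk) `<=` D.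
Proof.
move=> oD Dx; have /nbhs_ballP[e /= e0 eD] : nbhs x D by exact: open_nbhs_nbhs.
(* The centre will be within 1/(k+1) of x and the closed box reaches 1/(k+1) further, so 2/(k+1) < e
   keeps the box inside the ball. *)
have [k ke] : exists k : nat, k.+1%:R^-1 < e / 2 :> R.
  have e2 : 0 < (e / 2)^-1 by rewrite invr_gt0 divr_gt0.
  exists (Num.truncn (e / 2)^-1); rewrite invf_plt ?posrE ?divr_gt0//.
  by rewrite truncnS_gt.
have k0 : 0 < k.+1%:R^-1 :> R by rewrite invr_gt0.
have /choice[q qE] i : exists q : rat,
    x ord0 i - k.+1%:R^-1 < ratr q < x ord0 i + k.+1%:R^-1.
  have /rat_in_itvoo[q] : x ord0 i - k.+1%:R^-1 < x ord0 i + k.+1%:R^-1.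
    by rewrite ltrBlDr -addrA ltrDl addr_gt0.
  by rewrite in_itv/=; exists q.
exists (\row_i q i, k); split.
  move=> i; rewrite !mxE/=; have := qE i; move: k0 {ke qE}.
  by set c := _^-1; move=> ? /andP[? ?]; apply/andP; split; lra.
move=> y yq; apply: eD; split => // i0 i; rewrite ord1 /ball/=.
have := yq i; have := qE i; rewrite !mxE/=; move: ke {k0 qE yq}.
set c := _^-1; move=> ? /andP[? ?] /andP[? ?].
by rewrite ltr_norml; apply/andP; split; lra.
Qed.

Lemma open_bigcup_obox D : open D ->
  D = \bigcup_(qk in [set qk | cbox (rlo qk) (rhi qk) `<=` D]) obox (rlo qk) (rhi qk).
Proof.
move=> oD; apply/seteqP; split => x.
  by move=> /(open_rational_box oD)[qk [xq qD]]; exists qk.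
by move=> [qk /= qD /obox_cbox]; exact: qD.
Qed.

(** The sigma-algebra on rows is generated by the coordinates and not by the topology; countable
    unions of boxes link the two. *)
Lemma measurable_open D : open D -> measurable D.
Proof.
move=> /open_bigcup_obox ->; rewrite bigcup_mkcond.
apply: countable_bigcupT_measurable => [|qk]; first exact: countableP.
by case: ifP => // _; exact: measurable_obox.
Qed.

Lemma measurable_closed D : closed D -> measurable D.
Proof.
move=> cD; rewrite -[D]setCK; apply: measurableC; apply: measurable_open.
exact: closed_openC.
Qed.

Lemma measurable_bdry D : measurable (bdry D).
Proof.
apply: measurableD; first by apply: measurable_closed; exact: closed_closure.
by apply: measurable_open; exact: open_interior.
Qed.

Lemma measurable_continuous_fun D (f : X -> R) : measurable D ->
  continuous f -> measurable_fun D f.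
Proof.
move=> mD cf; apply: (@measurable_funS _ _ _ _ setT) => //.
apply: (measurability _ (RGenOpens.measurableE R)) => _ [_ [a [b ->] <-]].
rewrite setTI; apply: measurable_open.
by move/continuousP : cf => /(_ `]a, b[%classic (interval_open _ _)); apply.
Qed.

Lemma measurable_orthants :
  @measurable _ X = <<s [set A | exists b, A = [set x : X | forall i, x ord0 i < b ord0 i]] >>.
Proof.
set G := [set A | _].
apply/seteqP; split; last first.
  apply: smallest_sub; first exact: (@sigma_algebra_measurable _ X).
  move=> _ [b ->].
  rewrite (_ : [set x : X | _] = [set x : X | forall i, `]-oo, b ord0 i[%classic (x ord0 i)]).
    exact: (measurable_coordwise (C := fun i => `]-oo, b ord0 i[%classic)).
  by apply/seteqP; split => x /= ab i; have := ab i; rewrite in_itv.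
apply: smallest_sub; first exact: smallest_sigma_algebra.
rewrite -bigcup_seq => B [i _ [C mC <-]] /=; rewrite setTI.
pose G' := [set C : set R | <<s G >> ((fun x : X => x ord0 i) @^-1` C)].
suff : @measurable _ (measurableTypeR R) `<=` G' by apply.
have -> : @measurable _ (measurableTypeR R) = <<s @RGenInftyO.G R >>.
  exact: RGenInftyO.measurableE.
apply: smallest_sub.
  have sG := smallest_sigma_algebra [set: X] G; split.
  - by rewrite /G'/= preimage_set0; exact: sigma_algebra0.
  - by move=> A; rewrite /G'/= setTD preimage_setC; exact: sigma_algebraC.
  - by move=> F FG; rewrite /G'/= preimage_bigcup; exact: sigma_algebra_bigcup.
move=> _ [y ->]; rewrite /G'/=.
(* A half-space in the coordinate i is a countable union of orthants whose other coordinates are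
   bounded by k. *)
rewrite (_ : _ @^-1` _ = \bigcup_k [set x : X | forall j, x ord0 j <
    ((\row_j (if j == i then y else k%:R)) : X) ord0 j]).
  by apply: sigma_algebra_bigcup => k; apply: sub_sigma_algebra; eexists.
apply/seteqP; split => x /=; rewrite in_itv/=.
  move=> xy; exists (\max_j (Num.truncn (x ord0 j)).+1)%N => // j.
  rewrite mxE; case: eqP => [->//|_].
  apply: lt_le_trans (truncnS_gt _) _; rewrite ler_nat.
  exact: (leq_bigmax j).
by move=> [k _ /(_ i)]; rewrite mxE eqxx.
Qed.

(* Dynkin's theorem: the lower orthants form a pi-system that generates the
   measurable sets. *)
Lemma obox_integral_eq0 (mu : {measure set X -> \bar R}) a b (g : X -> \bar R) :
  mu.-integrable (obox a b) g ->
  (forall b', (\int[mu]_(x in obox a b `&` obox a b') g x = 0)%E) ->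
  {ae mu, forall x, obox a b x -> g x = 0%E}.
Proof.
move=> ig g0.
have mB := measurable_obox a b.
suff gA A : measurable A -> (\int[mu]_(x in obox a b `&` A) g x = 0)%E.
  apply: (integral_ae_eq mB ig); first exact: measurable_cst.
  move=> A AB mA; rewrite integral0.
  by have := gA _ mA; rewrite setIidr.
have intT : (\int[mu]_(x in obox a b) g x = 0)%E.
  by rewrite -{1}[obox a b]setIid; exact: g0.
move=> mA; pose G := [set A | exists b, A = [set x : X | forall i, x ord0 i < b ord0 i]].
apply: (@dynkin_induction _ X G
  (fun A => (\int[mu]_(x in obox a b `&` A) g x = 0)%E)) => //.
- exact: measurable_orthants.
- move=> _ _ [b1 ->] [b2 ->].
  exists (\row_i Num.min (b1 ord0 i) (b2 ord0 i)); apply/seteqP; split => x /=.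
    by move=> [x1 x2] i; rewrite mxE lt_min x1 x2.
  by move=> xb; split => i; have := xb i; rewrite mxE lt_min => /andP[].
- by rewrite setIT.
- move=> _ [b' ->] /=; rewrite (_ : _ `&` _ = obox a b `&` obox a b')//.
  apply/seteqP; split => x [xab xb]; split => // i.
    by rewrite xb; have /andP[->] := xab i.
  by have /andP[] := xb i.
- move=> S mS S0.
  move: intT; rewrite -{1}[obox a b]setIT -(setUv S) setIUr integral_setU.
  + by rewrite S0 add0e.
  + exact: measurableI.
  + by apply: measurableI => //; exact: measurableC.
  + by rewrite -setIUr setUv setIT; exact: measurable_int ig.
  + by apply/disj_setPS => x [[_ ?] [_]].
- move=> F mF tF F0; rewrite setI_bigcupr integral_bigcup.
  + by rewrite eseries0.
  + exact: trivIset_setIl.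
  + by move=> k; exact: measurableI.
  + apply: integrableS ig => //; first by apply: bigcupT_measurable => k; exact: measurableI.
    by apply: bigcup_sub => k _; exact: subIsetl.
- by rewrite -measurable_orthants.
Qed.

End Boxes.

(** * Finiteness of the product measures on [Gamma] and on boxes *)

Section PowerMeasure.
Context {R : realType}.

Lemma upi_setT M : upi M [set: 'rV[R]_M] = 1%E.
Proof.
elim: M => [|M IH]; first by rewrite /upi/= diracT.
transitivity ((uniform_prob (@ltrN11R R) \x upi M)%E (setT `*` setT)).
  by congr (product_measure1 _ _); apply/seteqP; split.
rewrite product_measure1E// IH mule1.
exact: (@probability_setT _ _ _ (uniform_prob (@ltrN11R R))).
Qed.

Lemma measurable_Gamma M : measurable (@Gamma R M).
Proof.
rewrite (_ : Gamma M = cbox (const_mx (-1)) (const_mx 1)).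
  exact: measurable_cbox.
by apply/seteqP; split => y /= yG i; have := yG i; rewrite !mxE.
Qed.

Lemma upi_Gamma_le1 M : (upi M (@Gamma R M) <= 1)%E.
Proof.
rewrite -(upi_setT M) le_measure// ?inE//; exact: measurable_Gamma.
Qed.

Lemma leb_cbox_lty n (a b : 'rV[R]_n) : (leb n (cbox a b) < +oo)%E.
Proof.
elim: n a b => [a b|n IH a b].
  by rewrite /leb/= (le_lt_trans (probability_le1 _ (measurable_cbox _ _)))// ltry.
pose tl (x : 'rV[R]_n.+1) : 'rV[R]_n := \row_j x ord0 (lift ord0 j).
rewrite (_ : leb n.+1 (cbox a b) = (@lebesgue_measure R \x leb n)%E
    (`[a ord0 ord0, b ord0 ord0]%classic `*` cbox (tl a) (tl b))); last first.
  congr (product_measure1 _ _); apply/seteqP; split => -[t x] /=.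
    move=> ab; split; first by have := ab ord0; rewrite mxE unlift_none/= in_itv.
    by move=> i; have := ab (lift ord0 i); rewrite !mxE liftK.
  rewrite in_itv/= => -[t0 ab] i; rewrite mxE.
  by case: unliftP => [j|] ->//=; have := ab j; rewrite !mxE.
rewrite product_measure1E//; last exact: measurable_cbox.
rewrite lte_mul_pinfty//.
  by rewrite ge0_fin_numE// [ltLHS]lebesgue_measure_itv/=; case: ifP; rewrite -?EFinB ltry.
Qed.

End PowerMeasure.

(** * Smooth functions and bumps *)

Section Smooth.
Context {R : realType} {d : nat}.
Local Notation X := 'rV[R]_d.
Local Notation e_ i := (delta_mx ord0 i : X).
Implicit Types f g : X -> R.

(** A coinduction principle: [smooth] quantifies over all lists of directions, and this reduces it
    to exhibiting a class of functions stable under one partial derivative. *)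
Lemma smooth_coind (C : set (X -> R)) :
  (forall f, C f -> continuous f /\
    forall i, (forall x, derivable f x (e_ i)) /\ C (partial i f)) ->
  C `<=` @smooth R d.
Proof.
move=> HC f Cf s.
have {}Cf : C (foldr (@partial R d) f s).
  by elim: s => //= i s IH; have [_ /(_ i)[]] := HC _ IH.
by have [cf df] := HC _ Cf; split => // i x; have [] := df i.
Qed.

Lemma smooth_partial i f : smooth f -> smooth (partial i f).
Proof. by move=> sf s; rewrite -foldr_rcons; exact: sf. Qed.

Lemma smooth_continuous f : smooth f -> continuous f.
Proof. by move=> /(_ [::])[]. Qed.

Lemma smooth_derivable f x i : smooth f -> derivable f x (e_ i).
Proof. by move=> /(_ [::])[_]; exact. Qed.

(** By the Leibniz rule, sums of products are stable under partial derivatives, whereas single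
    products are not. *)
Inductive smooth_alg : (X -> R) -> Prop :=
| smooth_algM f g of smooth f & smooth g : smooth_alg (f * g)
| smooth_algD f g of smooth_alg f & smooth_alg g : smooth_alg (f + g).

Lemma smooth_alg_smooth : smooth_alg `<=` @smooth R d.
Proof.
apply: smooth_coind => f; elim => {f} [f g sf sg|f g _ [cf df] _ [cg dg]].
  split; first by move=> x; apply: continuousM; exact: smooth_continuous.
  move=> i; split; first by move=> x; apply: derivableM; exact: smooth_derivable.
  rewrite (_ : partial i (f * g) = f * partial i g + g * partial i f).
    by apply: smooth_algD; apply: smooth_algM => //; exact: smooth_partial.
  by apply/funext => x; rewrite /partial deriveM//; exact: smooth_derivable.
split; first by move=> x; apply: continuousD; [exact: cf|exact: cg].
move=> i; have [dfi Cf] := df i; have [dgi Cg] := dg i.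
split; first by move=> x; exact: derivableD.
rewrite (_ : partial i (f + g) = partial i f + partial i g).
  exact: smooth_algD.
by apply/funext => x; rewrite /partial deriveD.
Qed.

Lemma smoothM f g : smooth f -> smooth g -> smooth (f * g).
Proof. by move=> sf sg; apply: smooth_alg_smooth; exact: smooth_algM. Qed.

Lemma partial_cst i (c : R) : partial i (cst c : X -> R) = cst 0.
Proof. by apply/funext => x; rewrite /partial derive_cst. Qed.

Lemma smooth_cst (c : R) : smooth (cst c : X -> R).
Proof.
apply: (@smooth_coind [set f | exists c, f = cst c]); last by exists c.
move=> _ [b ->]; split; first exact: cst_continuous.
move=> i; split; first by move=> x; exact: derivable_cst.
by exists 0; exact: partial_cst.
Qed.

Lemma smooth_prod (I : Type) (r : seq I) (F : I -> X -> R) :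
  (forall i, smooth (F i)) -> smooth (\prod_(i <- r) F i).
Proof.
move=> sF; apply: (big_ind (@smooth R d)) => //; first exact: (smooth_cst 1).
exact: smoothM.
Qed.

(** Both difference quotients are the same function of the increment, so a directional derivative is
    computed by one-variable calculus along the line. *)
Lemma is_derive_line f (x v : X) (l : R) :
  is_derive (0 : R) 1 (fun t : R => f (t *: v + x)) l -> is_derive x v f l.
Proof.
have E : (fun h : R => h^-1 *: (((fun t : R => f (t *: v + x)) \o shift 0) (h *: 1) -
      f (0 *: v + x))) =
    (fun h : R => h^-1 *: ((f \o shift x) (h *: v) - f x)).
  by apply/funext => h; rewrite /= addr0 scale0r add0r [h *: 1]mulr1.
by move=> [df <-]; split; rewrite /derivable /derive -E.
Qed.

Lemma is_derive_coord (h : R -> R) (h' c e : R) (j : 'I_d) i (x : X) :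
  is_derive (c * x ord0 j + e) 1 h h' ->
  is_derive x (e_ i) (fun x => h (c * x ord0 j + e)) ((i == j)%:R * c * h').
Proof.
move=> hh'; apply: is_derive_line => /=.
pose g (t : R) : R := ((i == j)%:R * c) * t + (c * x ord0 j + e).
rewrite (_ : (fun _ => _) = h \o g); last first.
  apply/funext => t /=; congr h; rewrite /g !mxE eqxx [i == j]eq_sym/=; ring.
have dg : is_derive (0 : R) 1 g ((i == j)%:R * c).
  rewrite /g; apply: is_derive_eq.
  by rewrite addr0 [_ *: _]mulr1.
by rewrite mulrC; apply: is_derive1_comp; rewrite /g mulr0 add0r.
Qed.

Lemma partial_coord (j i : 'I_d) : partial i (fun x : X => x ord0 j) = cst (i == j)%:R.
Proof.
apply/funext => x; rewrite /partial.
have := @is_derive_coord id 1 1 0 j i x _.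
rewrite (_ : (fun x : X => _) = (fun x : X => x ord0 j)); last first.
  by apply/funext => y; rewrite mul1r addr0.
by move=> /(_ _)[]; rewrite !mulr1.
Qed.

Lemma derivable_coord (j i : 'I_d) (x : X) : derivable (fun x : X => x ord0 j) x (e_ i).
Proof.
have := @is_derive_coord id 1 1 0 j i x _.
rewrite (_ : (fun x : X => _) = (fun x : X => x ord0 j)); last first.
  by apply/funext => y; rewrite mul1r addr0.
by move=> /(_ _)[].
Qed.

Lemma smooth_coord (j : 'I_d) : smooth (fun x : X => x ord0 j).
Proof.
apply: (@smooth_coind [set f | f = (fun x : X => x ord0 j) \/ exists c, f = cst c]).
  move=> _ [->|[c ->]]; split; [exact: coord_continuous| |exact: cst_continuous|].
    move=> i; split; first by move=> x; exact: derivable_coord.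
    by right; exists (i == j)%:R; exact: partial_coord.
  move=> i; split; first by move=> x; exact: derivable_cst.
  by right; exists 0; exact: partial_cst.
by left.
Qed.

End Smooth.

(** * The flat function exp(-1/t) and its derivatives *)

Section Bump.
Context {R : realType}.
Implicit Types (p : {poly R}) (s t : R).

(** [theta 1] is the classical flat function exp(-1/t) extended by zero; the polynomial in 1/t makes
    the family stable under differentiation. *)
Definition theta p t : R := if 0 < t then p.[t^-1] * expR (- t^-1) else 0.

(** With s = 1/t, the exponential series gives s^(i+2) <= (i+2)! e^s for each monomial of p. The
    power two of t is what makes the difference quotient at the origin vanish. *)
Lemma theta_le_sqr p : exists C, forall t, `|theta p t| <= C * t ^+ 2.
Proof.
exists (\sum_(i < size p) `|p`_i| * (i.+2)`!%:R) => t.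
have C0 : 0 <= \sum_(i < size p) `|p`_i| * (i.+2)`!%:R :> R.
  by apply: sumr_ge0 => i _; rewrite mulr_ge0.
rewrite /theta; case: ifPn => [t0|_]; last by rewrite normr0 mulr_ge0// sqr_ge0.
have s0 : 0 < t^-1 by rewrite invr_gt0.
rewrite -[t in t ^+ 2]invrK; move: (t^-1) s0 => s s0.
rewrite normrM (ger0_norm (expR_ge0 _)) expRN ler_pdivrMr ?expR_gt0//.
rewrite exprVn mulrAC ler_pdivlMr ?exprn_gt0//.
rewrite horner_coef mulr_suml; apply: le_trans (ler_wpM2r _ (ler_norm_sum _ _ _)) _.
  by rewrite sqr_ge0.
rewrite !mulr_suml; apply: ler_sum => i _.
rewrite normrM normrX (gtr0_norm s0) -!mulrA ler_wpM2l// -exprD addn2.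
have := expR_ge1Dxn i.+1 (ltW s0).
rewrite -ler_pdivrMl ?ltr0n ?fact_gt0// mulrC => ?.
by apply: le_trans; [|eassumption]; rewrite lerDr.
Qed.

(** With s = 1/t, the chain rule turns p(s) e^(-s) into s^2 (p(s) - p'(s)) e^(-s). At the origin the
    quadratic bound on [theta p] replaces the chain rule. *)
Lemma is_derive_theta p t : is_derive t 1 (theta p) (theta ('X^2 * (p - p^`())) t).
Proof.
have [t0|t0|t0] := ltgtP t 0.
- rewrite [X in is_derive _ _ _ X](_ : _ = 0); last first.
    by rewrite /theta ltNge (ltW t0).
  apply: (@near_eq_is_derive _ _ _ (cst 0)).
  near=> u; rewrite /theta ltNge (_ : u <= 0)//; apply: ltW.
  by near: u; exact: lt_nbhsl.
- have th : \near t, (fun u => p.[u^-1] * expR (- u^-1)) t = theta p t.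
    near=> u; rewrite /theta (_ : 0 < u)//.
    by near: u; exact: lt_nbhsr.
  have tn0 : t != 0 by rewrite gt_eqF.
  have dV : is_derive t 1 (fun u : R => u^-1) (- t ^- 2).
    by have := is_deriveV tn0 (is_derive_id t 1); rewrite [_ *: _]mulr1.
  have dp : is_derive t 1 (horner p \o (fun u : R => u^-1)) (p^`().[t^-1] * - t ^- 2).
    exact: is_derive1_comp.
  have de : is_derive t 1 (expR \o (fun u : R => - u^-1)) (expR (- t^-1) * - - t ^- 2).
    by apply: is_derive1_comp; exact: is_deriveN.
  apply: near_eq_is_derive th _; apply: is_derive_eq (is_deriveM dp de) _.
  rewrite /theta t0 /= !hornerE/= /GRing.scale/= exprVn opprK; ring.
- rewrite t0 [X in is_derive _ _ _ X](_ : _ = 0); last by rewrite /theta ltxx.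
  have [C HC] := theta_le_sqr p.
  have C0 : 0 <= C by have := HC 1; rewrite expr1n mulr1; apply: le_trans.
  have : (fun h : R => h^-1 *: ((theta p \o shift 0) (h *: 1) - theta p 0)) @ 0^' --> (0 : R).
    apply/cvgr0Pnorm_le => /= e e0; near=> h.
    rewrite /= addr0 [h *: 1]mulr1 [X in _ - X]/theta ltxx subr0 normrZ normfV.
    have h0 : 0 < `|h| by rewrite normr_gt0; near: h; exact: nbhs_dnbhs_neq.
    rewrite ler_pdivrMl// (le_trans (HC _))// -real_normK ?num_real// expr2 mulrCA ler_pM2l//.
    (* C + 1 rather than C in the denominator, as C may be zero. *)
    have : `|h| <= e / (C + 1).
      by near: h; apply: dnbhs0_le; rewrite divr_gt0// ltr_wpDl.
    by rewrite ler_pdivlMr ?ltr_wpDl// mulrDr mulr1 mulrC; apply: le_trans; rewrite lerDl.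
  by move=> H; split; [apply/cvg_ex; exists 0|exact: cvg_lim].
Unshelve. all: by end_near. Qed.

End Bump.

(** * Bump functions converging to the indicator of a box *)

Section TestFunctions.
Context {R : realType} {d : nat}.
Local Notation X := 'rV[R]_d.
Implicit Types (a b x : X) (D : set X).

Lemma thetaZ (c : R) p t : theta (c *: p) t = c * theta p t.
Proof. by rewrite /theta; case: ifP; rewrite ?mulr0// hornerZ mulrA. Qed.

Lemma continuous_theta (p : {poly R}) : continuous (theta p).
Proof.
move=> t; apply: differentiable_continuous; apply/derivable1_diffP.
by have [] := is_derive_theta p t.
Qed.

Lemma smooth_theta_coord p (c e : R) (j : 'I_d) :
  smooth (fun x : X => theta p (c * x ord0 j + e)).
Proof.
apply: (@smooth_coind _ _
  [set f | exists p, f = (fun x : X => theta p (c * x ord0 j + e))]); last by exists p.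
move=> _ [{}p ->]; split.
  move=> x; apply: (@continuous_comp _ _ _ (fun x : X => c * x ord0 j + e) (theta p)).
    apply: continuousD; last exact: cst_continuous.
    by apply: continuousM; [exact: cst_continuous|exact: coord_continuous].
  exact: continuous_theta.
move=> i; split; first by move=> x; have [] := is_derive_coord i (is_derive_theta p (c * x ord0 j + e)).
exists (((i == j)%:R * c) *: ('X^2 * (p - p^`()))); apply/funext => x.
by rewrite thetaZ /partial; have [] := is_derive_coord i (is_derive_theta p (c * x ord0 j + e)).
Qed.

(** Scaling the argument of the flat function by n+1 makes each factor tend to 1 inside the interval
    while it stays 0 outside. The arguments are written in the form c x_i + e under which [theta]
    was shown to be smooth. *)
Definition bump_factor a b (n : nat) (i : 'I_d) x : R :=
  theta 1 (n.+1%:R * x ord0 i + - (n.+1%:R * a ord0 i)) *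
  theta 1 (- n.+1%:R * x ord0 i + n.+1%:R * b ord0 i).

Definition bump a b n : X -> R := \prod_i bump_factor a b n i.

Lemma bumpE a b n x : bump a b n x = \prod_i bump_factor a b n i x.
Proof. by rewrite /bump; elim: (index_enum _) => [|i r IH]; rewrite ?big_nil// !big_cons -IH. Qed.

Lemma theta1_ge0 (t : R) : 0 <= theta 1 t.
Proof. by rewrite /theta; case: ifP => // _; rewrite hornerC mul1r expR_ge0. Qed.

Lemma theta1_le1 (t : R) : theta 1 t <= 1.
Proof.
rewrite /theta; case: ifP => // t0.
by rewrite hornerC mul1r -expR0 ler_expR oppr_le0 invr_ge0 ltW.
Qed.

Lemma bump_factor_ge0 a b n i x : 0 <= bump_factor a b n i x.
Proof. by rewrite mulr_ge0// theta1_ge0. Qed.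

Lemma bump_ge0 a b n x : 0 <= bump a b n x.
Proof. by rewrite bumpE; apply: prodr_ge0 => i _; exact: bump_factor_ge0. Qed.

Lemma bump_le1 a b n x : bump a b n x <= 1.
Proof.
rewrite bumpE; apply: prodr_ile1 => i; rewrite bump_factor_ge0/=.
by rewrite mulr_ile1 ?theta1_ge0 ?theta1_le1.
Qed.

Lemma bump_out a b n x : ~ obox a b x -> bump a b n x = 0.
Proof.
move=> xab; have [i xi] : exists i, ~ (a ord0 i < x ord0 i < b ord0 i).
  by apply: contrapT => H; apply: xab => i; apply: contrapT => ?; apply: H; exists i.
rewrite bumpE (bigD1 i)//= (_ : bump_factor _ _ _ _ _ = 0) ?mul0r//.
have n0 : 0 < n.+1%:R :> R by [].
rewrite /bump_factor mulNr [- _ + _]addrC -!mulrBr /theta !pmulr_rgt0// !subr_gt0.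
by move/negP: xi; rewrite negb_and => /orP[/negPf ->|/negPf ->]; rewrite ?mul0r ?mulr0.
Qed.

Lemma test_fun_bump D a b n : cbox a b `<=` D -> test_fun D (bump a b n).
Proof.
move=> abD; split; last first.
  exists (cbox a b); split => //; first exact: compact_cbox.
  by move=> x xab; apply: bump_out => /obox_cbox.
by apply: smooth_prod => i; apply: smoothM; exact: smooth_theta_coord.
Qed.

Lemma cvg_theta1 (s : R) : 0 < s -> theta 1 (n.+1%:R * s) @[n --> \oo] --> (1 : R).
Proof.
move=> s0; under eq_fun do rewrite /theta pmulr_rgt0// s0 hornerC mul1r.
have c0 : (n.+1%:R * s)^-1 @[n --> \oo] --> 0 * s^-1.
  by under eq_fun do rewrite invfM; exact: (cvgM (@cvg_harmonic R) (cvg_cst _)).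
have ce : {for 0 * s^-1, continuous (fun t : R => expR (- t))}.
  apply: (@continuous_comp _ _ _ -%R expR); first exact: opp_continuous.
  exact: continuous_expR.
have := continuous_cvg _ ce c0; by rewrite mul0r oppr0 expR0; exact.
Qed.

Lemma cvg_bump a b x : bump a b n x @[n --> \oo] --> (\1_(obox a b) x : R).
Proof.
rewrite indicE; case: (boolP (x \in obox a b)) => [/set_mem xab|xab]; last first.
  rewrite notin_setE in xab; under eq_fun do rewrite (bump_out _ xab).
  exact: cvg_cst.
under eq_fun do rewrite bumpE.
elim: (index_enum _) => [|i r IH]; first by under eq_fun do rewrite big_nil; exact: cvg_cst.
under eq_fun do rewrite big_cons.
suff Hi : bump_factor a b n i x @[n --> \oo] --> (1 : R).
  by rewrite -[1%:R]mulr1; exact: cvgM.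
have /andP[ai bi] := xab i.
suff [Ha Hb] : (theta 1 (n.+1%:R * x ord0 i + - (n.+1%:R * a ord0 i)) @[n --> \oo] --> (1 : R)) /\
    (theta 1 (- n.+1%:R * x ord0 i + n.+1%:R * b ord0 i) @[n --> \oo] --> (1 : R)).
  by have := cvgM Ha Hb; rewrite mulr1; exact.
split; first by under eq_fun do rewrite -mulrBr; apply: cvg_theta1; rewrite subr_gt0.
by under eq_fun do rewrite mulNr addrC -mulrBr; apply: cvg_theta1; rewrite subr_gt0.
Qed.

End TestFunctions.

(** * Square-integrable functions *)

Section L2.
Context {R : realType} {disp} {T : measurableType disp}.
Variables (mu : {measure set T -> \bar R}) (A : set T).
Hypothesis mA : measurable A.
Implicit Types f g h : T -> R.
Local Notation L2 := (L2fun mu A).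
Local Notation int f := (mu.-integrable A (EFin \o f)).

Lemma ae_Rintegral f g : measurable_fun A f -> measurable_fun A g ->
  {ae mu, forall x, A x -> f x = g x} ->
  \int[mu]_(x in A) f x = \int[mu]_(x in A) g x.
Proof.
move=> mf mg fg; congr fine; apply: ae_eq_integral => //.
- exact/measurable_EFinP.
- exact/measurable_EFinP.
- by apply: filterS fg => x /[apply] ->.
Qed.

Lemma ae_integrable f g : measurable_fun A g ->
  {ae mu, forall x, A x -> `|g x| <= `|f x|} -> int f -> int g.
Proof.
move=> mg fg /integrableP[mf foo]; apply/integrableP; split; first exact/measurable_EFinP.
apply: le_lt_trans foo; apply: ae_ge0_le_integral => //.
- by apply: measurableT_comp => //; exact/measurable_EFinP.
- by apply: measurableT_comp.
Qed.

Lemma le_intR f g : measurable_fun A g ->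
  (forall x, A x -> `|g x| <= `|f x|) -> int f -> int g.
Proof. by move=> mg fg; apply: ae_integrable => //; exact: aeW. Qed.

Lemma ae_le_Rintegral f g : int f -> int g ->
  {ae mu, forall x, A x -> f x <= g x} ->
  \int[mu]_(x in A) f x <= \int[mu]_(x in A) g x.
Proof.
move=> fi gi fg; rewrite -subr_ge0 -RintegralB//.
have mi : measurable_fun A (fun x => g x - f x).
  by apply: measurable_funB; apply/measurable_EFinP;
    [exact: measurable_int gi|exact: measurable_int fi].
rewrite (_ : Rintegral _ _ _ = \int[mu]_(x in A) `|g x - f x|).
  by apply: Rintegral_ge0.
apply: ae_Rintegral => //; first by apply: measurableT_comp.
by apply: filterS fg => x /[apply] fg; rewrite ger0_norm// subr_ge0.
Qed.

Lemma Rintegral_eq0_ae f : int f -> (forall x, A x -> 0 <= f x) ->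
  \int[mu]_(x in A) f x = 0 -> {ae mu, forall x, A x -> f x = 0}.
Proof.
move=> fi f0 i0.
have : ae_eq mu A (EFin \o f) (cst 0%E).
  apply/(ae_eq_integral_abs mu mA); first exact: measurable_int fi.
  rewrite (eq_integral (EFin \o f)); last first.
    by move=> x /set_mem Ax; rewrite /= ger0_norm// f0.
  by rewrite -[LHS]fineK ?[fine _]i0//; exact: integrable_fin_num.
by apply: filterS => x /[apply] -[].
Qed.

Lemma Rintegral_sum (I : Type) (r : seq I) (F : I -> T -> R) :
  (forall i, int (F i)) ->
  \int[mu]_(x in A) (\sum_(i <- r) F i x) = \sum_(i <- r) \int[mu]_(x in A) F i x.
Proof.
move=> Fi; elim: r => [|i r IH].
  by under eq_Rintegral do rewrite big_nil; rewrite big_nil Rintegral_cst// mul0r.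
under eq_Rintegral do rewrite big_cons.
rewrite big_cons -IH RintegralD//.
rewrite (_ : _ \o _ = fun x => \sum_(i <- r) (EFin \o F i) x)%E.
  exact: integrable_sum.
by apply/funext => x /=; rewrite sumEFin.
Qed.

Lemma integrable_sumR (I : Type) (r : seq I) (F : I -> T -> R) :
  (forall i, int (F i)) -> int (fun x => \sum_(i <- r) F i x).
Proof.
move=> Fi; rewrite (_ : _ \o _ = fun x => \sum_(i <- r) (EFin \o F i) x)%E.
  exact: integrable_sum.
by apply/funext => x /=; rewrite sumEFin.
Qed.

Lemma integrableDR f g : int f -> int g -> int (fun x => f x + g x).
Proof. by move=> fi gi; have := integrableD mA fi gi. Qed.

Lemma integrableZR c f : int f -> int (fun x => c * f x).
Proof. by move=> fi; have := integrableZl mA c fi. Qed.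

Lemma L2fun_intM f g : L2 f -> L2 g -> int (fun x => f x * g x).
Proof.
move=> [mf f2] [mg g2]; apply: (@le_intR (fun x => f x ^+ 2 + g x ^+ 2)).
- exact: measurable_funM.
- move=> x _; rewrite normrM [leRHS]ger0_norm ?addr_ge0 ?sqr_ge0//.
  rewrite -(@real_normK _ (f x)) ?num_real// -(@real_normK _ (g x)) ?num_real//.
  have : 0 <= (`|f x| - `|g x|) ^+ 2 by exact: sqr_ge0.
  have : 0 <= `|f x| * `|g x| by rewrite mulr_ge0.
  nra.
- exact: integrableDR.
Qed.

Lemma L2fun_bounded_mul h f (c : R) : measurable_fun A h ->
  (forall x, A x -> `|h x| <= c) -> L2 f -> L2 (fun x => h x * f x).
Proof.
move=> mh hc [mf f2]; split; first exact: measurable_funM.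
apply: (@le_intR (fun x => c ^+ 2 * f x ^+ 2)); last exact: integrableZR.
  by apply: measurable_funX; exact: measurable_funM.
move=> x Ax; rewrite exprMn !normrM ler_wpM2r//.
by rewrite ler_pM// (le_trans (hc _ Ax))// ler_norm.
Qed.

Lemma L2funZ c f : L2 f -> L2 (fun x => c * f x).
Proof. by apply: (@L2fun_bounded_mul (cst c) _ `|c|) => //; exact: measurable_cst. Qed.

Lemma L2funD f g : L2 f -> L2 g -> L2 (fun x => f x + g x).
Proof.
move=> [mf f2] [mg g2]; split; first exact: measurable_funD.
apply: (@le_intR (fun x => 2 * f x ^+ 2 + 2 * g x ^+ 2)).
- by apply: measurable_funX; exact: measurable_funD.
- move=> x _; rewrite ger0_norm ?sqr_ge0// [leRHS]ger0_norm.
    have := sqr_ge0 (f x - g x); nra.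
  by rewrite addr_ge0// mulr_ge0// sqr_ge0.
- by apply: integrableDR; exact: integrableZR.
Qed.

Lemma L2fun0 : L2 (fun=> 0).
Proof.
split; first exact: measurable_cst.
by rewrite (_ : (fun _ => _) = cst 0%E) ?expr0n//; exact: integrable0.
Qed.

Lemma L2fun_sum (I : Type) (r : seq I) (F : I -> T -> R) :
  (forall i, L2 (F i)) -> L2 (fun x => \sum_(i <- r) F i x).
Proof.
move=> F2; elim: r => [|i r IH].
  by under eq_fun do rewrite big_nil; exact: L2fun0.
by under eq_fun do rewrite big_cons; exact: L2funD.
Qed.

Lemma L2funB f g : L2 f -> L2 g -> L2 (fun x => f x - g x).
Proof.
move=> f2 g2; have := L2funD f2 (L2funZ (-1) g2).
by under eq_fun do rewrite mulN1r.
Qed.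

End L2.

Lemma le_coord_norm {R : realType} {n} (x : 'rV[R]_n) i : `|x ord0 i| <= `|x|.
Proof.
rewrite (_ : `|x| = mx_norm x)// mx_normrE.
by apply/bigmax_geP; right => /=; exists (ord0, i).
Qed.

(** * The fundamental lemma of the calculus of variations *)

Section FundamentalLemma.
Context {R : realType} {d : nat}.
Variable D : set 'rV[R]_d.
Hypothesis oD : open D.
Local Notation X := 'rV[R]_d.
Local Notation mu := (leb d).
Local Notation L2 := (L2fun mu D).
Let mD : measurable D := measurable_open oD.

(** A box has finite measure and |g| <= 1 + g^2. *)
Lemma L2fun_integrable_cbox (a b : X) g : cbox a b `<=` D -> L2 g ->
  mu.-integrable (cbox a b) (EFin \o g).
Proof.
move=> abD [mg g2]; have mC := measurable_cbox a b.
apply: (@le_intR _ _ _ _ _ mC (fun x => 1 + g x ^+ 2)).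
- exact: measurable_funS mg.
- move=> x _; rewrite [leRHS]ger0_norm ?addr_ge0 ?sqr_ge0//.
  rewrite -(@real_normK _ (g x)) ?num_real//.
  have := sqr_ge0 (`|g x| - 1); have := normr_ge0 (g x); nra.
- apply: integrableDR => //; last exact: integrableS g2.
  apply: measurable_bounded_integrable => //; first exact: leb_cbox_lty.
  by exists 1; split => // M M1 x _; rewrite normr1 ltW.
Qed.

Lemma L2fun_test phi : test_fun D phi -> L2 phi.
Proof.
move=> [sphi [K [cK KD phi0]]].
have mphi := measurable_continuous_fun mD (smooth_continuous sphi).
have [M M0 HM] : exists2 M : R, 0 <= M & forall x, K x -> `|phi x| <= M.
  have : compact (phi @` K).
    by apply: continuous_compact => //; apply: continuous_subspaceT; exact: smooth_continuous.
  move=> /compact_bounded[M [_ HM]]; exists (`|M| + 1); first by rewrite addr_ge0.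
  by move=> x Kx; apply: (HM (`|M| + 1)); [rewrite ltr_pwDr// ler_norm|exists x].
have [r HK] : exists r : R, K `<=` cbox (const_mx (- r)) (const_mx r).
  have [r [_ Hr]] := compact_bounded cK; exists (`|r| + 1) => x Kx i.
  rewrite !mxE -ler_norml; apply: le_trans (Hr (`|r| + 1) _ _ Kx).
    exact: le_coord_norm.
  by rewrite ltr_pwDr// ler_norm.
set C := cbox _ _ in HK; have mC : measurable C by exact: measurable_cbox.
split => //; apply: (@le_intR _ _ _ _ _ mD (cst (M ^+ 2) \_ C)).
- exact: measurable_funX.
- move=> x Dx; rewrite /patch; case: ifPn => [_|]; last first.
    by rewrite notin_setE => xC; rewrite phi0 ?expr0n ?normr0// => /HK.
  have [Kx|/phi0 ->] := pselect (K x); last by rewrite expr0n normr0.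
  by rewrite !normrX /= (ger0_norm M0) ler_pXn2r ?nnegrE//; exact: HM.
- rewrite -restrict_EFin; apply/integrable_restrict => //.
  apply: measurable_bounded_integrable => //; first exact: measurableI.
    apply: le_lt_trans (leb_cbox_lty (const_mx (- r) : X) (const_mx r)).
    by rewrite le_measure ?inE//; exact: measurableI.
  by exists (M ^+ 2); split; [exact: num_real|move=> N MN x _ /=]; rewrite ger0_norm ?sqr_ge0// ltW.
Qed.

(** The bumps of the box are test functions that converge to its indicator, and their products with
    g are dominated by |g| on the closed box, so dominated convergence applies. *)
Lemma test_obox_integral_eq0 (a b : X) g : cbox a b `<=` D -> L2 g ->
  (forall phi, test_fun D phi -> \int[mu]_(x in D) (g x * phi x) = 0) ->
  (\int[mu]_(x in obox a b) (g x)%:E = 0)%E.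
Proof.
move=> abD g2 g0; have [mg _] := g2.
have mC := measurable_cbox a b.
have iC := L2fun_integrable_cbox abD g2.
have gb n : mu.-integrable D (EFin \o (fun x => g x * bump a b n x)).
  by apply: L2fun_intM => //; apply: L2fun_test; exact: test_fun_bump.
have [] := @dominated_convergence _ _ _ mu D mD (fun n x => (g x * bump a b n x)%:E)
  (fun x => (g x * \1_(obox a b) x)%:E) ((EFin \o (fun x => `|g x|)) \_ (cbox a b)).
- by move=> n; exact: measurable_int (gb n).
- apply/measurable_EFinP; apply: measurable_funM => //.
  by apply: measurable_indic; exact: measurable_obox.
- apply: aeW => x Dx; apply/cvg_EFin; first by apply: nearW.
  by apply: cvgM; [exact: cvg_cst|exact: cvg_bump].
- apply/integrable_restrict => //; rewrite setIidr//.
  exact: integrable_norm.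
- apply: aeW => x n Dx; rewrite /patch; case: ifPn => [_|].
    by rewrite /= lee_fin normrM (ger0_norm (bump_ge0 _ _ _ _)) ler_piMr// bump_le1.
  rewrite notin_setE => xC; rewrite bump_out ?mulr0 ?abse0//.
  by move=> /obox_cbox.
move=> _ _; rewrite /= => cv.
have E0 n : (\int[mu]_(x in D) (g x * bump a b n x)%:E = 0)%E.
  rewrite -[LHS]fineK; last exact: (integrable_fin_num mD (gb n)).
  by congr EFin; apply: g0; exact: test_fun_bump.
have {}cv : (\int[mu]_(x in D) (g x * \1_(obox a b) x)%:E = 0)%E.
  move: cv; under eq_fun do rewrite E0.
  by move=> /(cvg_lim _) <-//; rewrite lim_cst.
rewrite -cv -[in LHS](setIidr (subset_trans (@obox_cbox _ _ a b) abD)).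
rewrite integral_mkcondr; apply: eq_integral => x _.
by rewrite /patch indicE; case: ifP; rewrite ?mulr1 ?mulr0.
Qed.

(** On each rational box inside D the integrals of g over all smaller boxes vanish, so g vanishes
    there almost everywhere; countably many such boxes cover D. *)
Lemma test_ae_eq0 g : L2 g ->
  (forall phi, test_fun D phi -> \int[mu]_(x in D) (g x * phi x) = 0) ->
  {ae mu, forall x, D x -> g x = 0}.
Proof.
move=> g2 g0.
(* The rational boxes are enumerated by natural numbers through [unpickle], so that [ae_foralln]
   collects their null sets. *)
pose P (n : nat) (x : X) := forall qk, unpickle n = Some qk ->
  cbox (rlo qk) (rhi qk) `<=` D -> obox (rlo qk) (rhi qk) x -> g x = 0.
have : {ae mu, forall x, forall n, P n x}.
  apply: ae_foralln => n; rewrite /P; case: (unpickle n) => [qk|]; last first.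
    by apply: aeW => x qk.
  have [qD|qD] := pselect (cbox (rlo qk) (rhi qk : X) `<=` D); last first.
    by apply: aeW => x _ [<-].
  pose a : X := rlo qk; pose b : X := rhi qk.
  have ig : mu.-integrable (obox a b) (EFin \o g).
    apply: (integrableS (measurable_cbox a b)); [exact: measurable_obox|exact: obox_cbox|].
    exact: L2fun_integrable_cbox.
  have := obox_integral_eq0 ig.
  (* Cutting the box by another one with the same lower corner leaves a box, still inside D. *)
  have H b' : (\int[mu]_(x in obox a b `&` obox a b') (EFin \o g) x = 0)%E.
    pose c : X := \row_i Num.min (b ord0 i) (b' ord0 i).
    rewrite (_ : _ `&` _ = obox a c).
      apply: test_obox_integral_eq0 => //; apply: subset_trans qD => x xc i.
      by have := xc i; rewrite [c _ _]mxE le_min => /andP[-> /andP[->]].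
    apply/seteqP; split => x.
      by move=> [x1 x2] i; rewrite [c _ _]mxE lt_min; have /andP[-> ->] := x1 i; have /andP[_ ->] := x2 i.
    by move=> xc; split => i; have := xc i; rewrite [c _ _]mxE lt_min => /and3P[-> ? ?]; apply/andP.
  by move=> /(_ H); apply: filterS => x xg _ [<-] _ /xg[].
apply: filterS => x Px Dx.
have [qk [xq qD]] := open_rational_box oD Dx.
by apply: (Px (pickle qk) qk) => //; rewrite pickleK.
Qed.

End FundamentalLemma.

(** * Weak derivatives and traces *)

Section WeakDerivatives.
Context {R : realType} {d : nat}.
Variable D : set 'rV[R]_d.
Hypothesis oD : open D.
Local Notation X := 'rV[R]_d.
Local Notation mu := (leb d).
Local Notation L2 := (L2fun mu D).
Let mD : measurable D := measurable_open oD.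
Implicit Types (u v g h phi : X -> R).

Lemma test_fun_partial i phi : test_fun D phi -> test_fun D (partial i phi).
Proof.
move=> [sphi [K [cK KD phi0]]]; split; first exact: smooth_partial.
exists K; split => // x Kx; rewrite /partial.
rewrite (@near_eq_derive _ _ _ phi (cst 0)) ?derive_cst//.
have cKc : open (~` K) by apply: closed_openC; exact: compact_closed.
near=> y; apply: phi0; near: y; exact: open_nbhs_nbhs.
Unshelve. all: by end_near. Qed.

Lemma test_fun_coordM j phi : test_fun D phi -> test_fun D (fun x => x ord0 j * phi x).
Proof.
move=> [sphi [K [cK KD phi0]]]; split.
  by apply: (smoothM _ sphi); exact: smooth_coord.
by exists K; split => // x /phi0 ->; rewrite mulr0.
Qed.

Lemma partial_coordM i j phi x : smooth phi ->
  partial i (fun x => x ord0 j * phi x) x = x ord0 j * partial i phi x + (i == j)%:R * phi x.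
Proof.
move=> sphi; have := deriveM (@derivable_coord R d j i x) (@smooth_derivable R d phi x i sphi).
rewrite /partial => ->; congr (_ + _).
have := congr1 (fun f => f x) (@partial_coord R d j i); rewrite /partial => ->.
by rewrite mulrC.
Qed.

Lemma wpartial_unique i v g h : L2 g -> L2 h ->
  has_wpartial D i v g -> has_wpartial D i v h ->
  {ae mu, forall x, D x -> g x = h x}.
Proof.
move=> g2 h2 vg vh.
have := @test_ae_eq0 R d D oD (fun x => g x - h x) (L2funB mD g2 h2).
have H phi : test_fun D phi -> \int[mu]_(x in D) ((g x - h x) * phi x) = 0.
  move=> tphi; have phi2 := L2fun_test oD tphi.
  under eq_Rintegral do rewrite mulrBl.
  rewrite RintegralB//; [|exact: L2fun_intM|exact: L2fun_intM].
  by apply/eqP; rewrite subr_eq0 -eqr_opp -vg// -vh.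
by move=> /(_ H); apply: filterS => x /[apply] /eqP; rewrite subr_eq0 => /eqP.
Qed.

Lemma H1_wpartial v i : H1 D v ->
  L2 (wpartial D i v) /\ has_wpartial D i v (wpartial D i v).
Proof. move=> [_ /(_ i) Hg]; rewrite /wpartial.
exact: (@xgetPex _ (cst 0) [set g | L2 g /\ has_wpartial D i v g] Hg). Qed.

(** Since [wpartial] is an arbitrary choice, each computation rule for it is obtained by exhibiting
    a weak derivative and appealing to uniqueness. *)
Lemma wpartialE v i g : H1 D v -> L2 g -> has_wpartial D i v g ->
  {ae mu, forall x, D x -> wpartial D i v x = g x}.
Proof. by move=> /(H1_wpartial i)[w2 vw] g2 vg; exact: wpartial_unique vw vg. Qed.

Lemma has_wpartial_sum i (I : Type) (r : seq I) (c : I -> R) (v g : I -> X -> R) :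
  (forall k, L2 (v k)) -> (forall k, L2 (g k)) ->
  (forall k, has_wpartial D i (v k) (g k)) ->
  has_wpartial D i (fun x => \sum_(k <- r) c k * v k x)
    (fun x => \sum_(k <- r) c k * g k x).
Proof.
move=> v2 g2 vg phi tphi.
have phi2 := L2fun_test oD tphi.
have dphi2 := L2fun_test oD (test_fun_partial i tphi).
have iv k : mu.-integrable D (EFin \o (fun x => v k x * partial i phi x)) by exact: L2fun_intM.
have ig k : mu.-integrable D (EFin \o (fun x => g k x * phi x)) by exact: L2fun_intM.
under eq_Rintegral do rewrite mulr_suml.
rewrite Rintegral_sum//; last first.
  by move=> k; under eq_fun do rewrite -mulrA; exact: integrableZR.
under [X in - X]eq_Rintegral do rewrite mulr_suml.
rewrite Rintegral_sum//; last first.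
  by move=> k; under eq_fun do rewrite -mulrA; exact: integrableZR.
rewrite -sumrN; apply: eq_bigr => k _.
under eq_Rintegral do rewrite -mulrA.
under [X in - X]eq_Rintegral do rewrite -mulrA.
by rewrite !RintegralZl// vg// mulrN.
Qed.

Lemma H1_sum (I : Type) (r : seq I) (c : I -> R) (v : I -> X -> R) :
  (forall k, H1 D (v k)) -> H1 D (fun x => \sum_(k <- r) c k * v k x).
Proof.
move=> Hv; split; first by apply: L2fun_sum => // k; apply: L2funZ => //; have [] := Hv k.
move=> i; exists (fun x => \sum_(k <- r) c k * wpartial D i (v k) x); split.
  by apply: L2fun_sum => // k; apply: L2funZ => //; have [] := H1_wpartial i (Hv k).
by apply: has_wpartial_sum => k; [have [] := Hv k|have [] := H1_wpartial i (Hv k)|have [] := H1_wpartial i (Hv k)].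
Qed.

Lemma wpartial_sum i (I : Type) (r : seq I) (c : I -> R) (v : I -> X -> R) :
  (forall k, H1 D (v k)) ->
  {ae mu, forall x, D x -> wpartial D i (fun x => \sum_(k <- r) c k * v k x) x =
    \sum_(k <- r) c k * wpartial D i (v k) x}.
Proof.
move=> Hv; apply: wpartialE; first exact: H1_sum.
  by apply: L2fun_sum => // k; apply: L2funZ => //; have [] := H1_wpartial i (Hv k).
by apply: has_wpartial_sum => k; [have [] := Hv k|have [] := H1_wpartial i (Hv k)|have [] := H1_wpartial i (Hv k)].
Qed.

End WeakDerivatives.

(** * Weak derivatives of products with a coordinate *)

Section CoordinateMultiples.
Context {R : realType} {d : nat}.
Variables (D : set 'rV[R]_d) (r : R).
Hypothesis oD : open D.
Hypothesis Dr : forall x, D x -> forall i, `|x ord0 i| <= r.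
Local Notation X := 'rV[R]_d.
Local Notation mu := (leb d).
Local Notation L2 := (L2fun mu D).
Let mD : measurable D := measurable_open oD.
Variables (c : R) (j : 'I_d).

Lemma L2_coordM v : L2 v -> L2 (fun x => c * x ord0 j * v x).
Proof.
apply: (@L2fun_bounded_mul _ _ _ _ _ mD _ _ (`|c| * r)).
  apply: (@measurable_funS _ _ _ _ setT) => //.
  by apply: measurable_funM => //; exact: measurable_coord.
by move=> x Dx; rewrite normrM ler_wpM2l// Dr.
Qed.

(** The factor x_j is moved onto the test function: x_j phi is again a test function, and its i-th
    derivative is x_j times that of phi plus delta_ij phi. *)
Lemma has_wpartial_coordM i v g : L2 v -> L2 g -> has_wpartial D i v g ->
  has_wpartial D i (fun x => c * x ord0 j * v x)
    (fun x => c * x ord0 j * g x + (c * (i == j)%:R) * v x).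
Proof.
move=> v2 g2 vg phi tphi.
have phi2 := L2fun_test oD tphi.
have dphi2 := L2fun_test oD (test_fun_partial i tphi).
have tjphi := test_fun_coordM j tphi.
have jphi2 := L2fun_test oD tjphi.
have djphi2 := L2fun_test oD (test_fun_partial i tjphi).
have i1 := L2fun_intM mD v2 djphi2.
have i2 := L2fun_intM mD v2 phi2.
have i3 := L2fun_intM mD g2 jphi2.
transitivity (\int[mu]_(x in D) (c * (v x * partial i (fun x => x ord0 j * phi x) x) -
    (c * (i == j)%:R) * (v x * phi x))).
  apply: eq_Rintegral => x _; rewrite partial_coordM; last by case: tphi.
  ring.
rewrite RintegralB//; [|exact: integrableZR|exact: integrableZR].
rewrite !RintegralZl// vg//.
have -> : \int[mu]_(x in D) ((c * x ord0 j * g x + c * (i == j)%:R * v x) * phi x) =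
    \int[mu]_(x in D) (c * (g x * (x ord0 j * phi x)) + (c * (i == j)%:R) * (v x * phi x)).
  by apply: eq_Rintegral => x _; ring.
rewrite RintegralD//; [|exact: integrableZR|exact: integrableZR].
rewrite !RintegralZl//; ring.
Qed.

Lemma H1_coordM v : H1 D v -> H1 D (fun x => c * x ord0 j * v x).
Proof.
move=> Hv; have [v2 _] := Hv; split; first exact: L2_coordM.
move=> i; have [w2 vw] := H1_wpartial i Hv.
exists (fun x : X => c * x ord0 j * wpartial D i v x + (c * (i == j)%:R) * v x); split.
  by apply: L2funD => //; [exact: L2_coordM|exact: L2funZ].
exact: has_wpartial_coordM.
Qed.

Lemma wpartial_coordM i v : H1 D v ->
  {ae mu, forall x, D x -> wpartial D i (fun x => c * x ord0 j * v x) x =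
    c * x ord0 j * wpartial D i v x + (c * (i == j)%:R) * v x}.
Proof.
move=> Hv; have [v2 _] := Hv; have [w2 vw] := H1_wpartial i Hv.
apply: wpartialE => //; first exact: H1_coordM.
  by apply: L2funD => //; [exact: L2_coordM|exact: L2funZ].
exact: has_wpartial_coordM.
Qed.

End CoordinateMultiples.

Section SquareConvergence.
Context {R : realType} {disp} {T : measurableType disp}.
Variables (mu : {measure set T -> \bar R}) (A : set T).
Hypothesis mA : measurable A.

Lemma cvg0_le_sqr (F G H : nat -> T -> R) (K : R) : 0 <= K ->
  (forall n, [/\ measurable_fun A (F n), measurable_fun A (G n) & measurable_fun A (H n)]) ->
  (forall n, {ae mu, forall x, A x -> F n x ^+ 2 <= K * G n x ^+ 2 + K * H n x ^+ 2}) ->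
  (\int[mu]_(x in A) (G n x ^+ 2)%:E)%E @[n --> \oo] --> 0%E ->
  (\int[mu]_(x in A) (H n x ^+ 2)%:E)%E @[n --> \oo] --> 0%E ->
  (\int[mu]_(x in A) (F n x ^+ 2)%:E)%E @[n --> \oo] --> 0%E.
Proof.
move=> K0 mFGH FGH G0 H0.
have m2 (f : T -> R) : measurable_fun A f -> measurable_fun A (fun x => (f x ^+ 2)%:E).
  by move=> mf; apply/measurable_EFinP; exact: measurable_funX.
have KGH : (K%:E * (\int[mu]_(x in A) (G n x ^+ 2)%:E) +
    K%:E * (\int[mu]_(x in A) (H n x ^+ 2)%:E))%E @[n --> \oo] --> 0%E.
  rewrite -[X in _ --> X]adde0 -{1}(mule0 K%:E) -{2}(mule0 K%:E).
  by apply: cvgeD; [rewrite !mule0|apply: cvgeZl|apply: cvgeZl].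
apply: (squeeze_cvge _ (cvg_cst 0%E) KGH).
apply: nearW => n; have [mF mG mH] := mFGH n; apply/andP; split.
  by apply: integral_ge0 => x _; rewrite lee_fin sqr_ge0.
rewrite -!ge0_integralZl//; try by [exact: m2|move=> x _; rewrite lee_fin sqr_ge0].
rewrite -ge0_integralD//.
- apply: ae_ge0_le_integral => //.
  + by move=> x _; rewrite lee_fin sqr_ge0.
  + exact: m2.
  + by move=> x _; rewrite -!EFinM -EFinD lee_fin addr_ge0// mulr_ge0// sqr_ge0.
  + by apply: emeasurable_funD; apply: measurable_funeM; exact: m2.
  + by apply: filterS (FGH n) => x /[apply]; rewrite -!EFinM -EFinD lee_fin.
- by move=> x _; rewrite mule_ge0// lee_fin sqr_ge0.
- by apply: measurable_funeM; exact: m2.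
- by move=> x _; rewrite mule_ge0// lee_fin sqr_ge0.
- by apply: measurable_funeM; exact: m2.
Qed.

End SquareConvergence.

(** * Traces of products with a coordinate *)

Section TraceCoordinateMultiples.
Context {R : realType} {d : nat}.
Variables (D : set 'rV[R]_d) (r : R).
Hypothesis oD : open D.
Hypothesis Dr : forall x, D x -> forall i, `|x ord0 i| <= r.
Local Notation X := 'rV[R]_d.
Local Notation mu := (leb d).
Let mD : measurable D := measurable_open oD.
Variables (m : nat) (F : nat -> facet R d).
Local Notation sigma := (surface_measure m F).

Lemma bdry_bounded x : bdry D x -> forall i, `|x ord0 i| <= r.
Proof.
move=> [cDx _] i.
have : closure D `<=` cbox (const_mx (- r)) (const_mx r).
  have /closure_id -> : closed (cbox (const_mx (- r) : X) (const_mx r)).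
    by apply: compact_closed => //; exact: compact_cbox.
  by apply: closure_subset => y Dy k; rewrite !mxE -ler_norml Dr.
by move=> /(_ _ cDx i); rewrite !mxE -ler_norml.
Qed.

Lemma cvgH1_coordM (c : R) j phi v : (forall n, smooth (phi n)) -> H1 D v ->
  cvgH1 D phi v ->
  cvgH1 D (fun n x => c * x ord0 j * phi n x) (fun x => c * x ord0 j * v x).
Proof.
move=> sphi Hv [cv dcv]; have [v2 _] := Hv; have [mv _] := v2.
have mphi n : measurable_fun D (phi n).
  by apply: measurable_continuous_fun => //; exact: smooth_continuous.
have mpphi n i : measurable_fun D (partial i (phi n)).
  by apply: measurable_continuous_fun => //; apply: smooth_continuous; exact: smooth_partial.
have mcj : measurable_fun D (fun x : X => c * x ord0 j).
  by apply: measurable_funM => //; apply: (@measurable_funS _ _ _ _ setT) => //; exact: measurable_coord.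
have cj2 (x : X) : D x -> (c * x ord0 j) ^+ 2 <= (c * r) ^+ 2.
  move=> Dx; rewrite -[leLHS]real_normK ?num_real// -[leRHS]real_normK ?num_real//.
  by rewrite ler_pXn2r ?nnegrE// !normrM ler_wpM2l// (le_trans (Dr Dx j))// ler_norm.
split.
  apply: (@cvg0_le_sqr _ _ _ mu D mD _ (fun n x => phi n x - v x) (fun n x => phi n x - v x)
    ((c * r) ^+ 2)) => //; first by rewrite sqr_ge0.
  - by move=> n; split; apply: measurable_funB => //; exact: measurable_funM.
  - move=> n; apply: aeW => x Dx; rewrite -mulrBr exprMn.
    apply: ler_wpDr; first by rewrite mulr_ge0 ?sqr_ge0.
    by rewrite ler_wpM2r ?sqr_ge0 ?cj2.
move=> i; have [[mw _] _] := H1_wpartial i Hv.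
have [[mw' _] _] := H1_wpartial i (H1_coordM oD Dr c j Hv).
(* The error in the derivative is c x_j times the old derivative error plus c delta_ij times the
   function error. By (a + b)^2 <= 2 a^2 + 2 b^2 and |x_j| <= r, the sum of the two resulting
   constants serves both terms. *)
apply: (@cvg0_le_sqr _ _ _ mu D mD _ (fun n x => partial i (phi n) x - wpartial D i v x)
  (fun n x => phi n x - v x) (2 * (c * r) ^+ 2 + 2 * c ^+ 2)) => //.
- by rewrite addr_ge0// mulr_ge0// sqr_ge0.
- move=> n; split.
  + apply: measurable_funB => //; apply: measurable_continuous_fun => //.
    apply: smooth_continuous; apply: smooth_partial.
    rewrite (_ : (fun x => _) = cst c * (fun x : X => x ord0 j) * phi n); last first.
      by apply/funext.
    apply: (smoothM _ (sphi n)); apply: (smoothM _ (smooth_coord j)); exact: smooth_cst.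
  + exact: measurable_funB.
  + exact: measurable_funB.
- move=> n; apply: filterS (wpartial_coordM oD Dr c j i Hv) => x /[swap] Dx ->//.
  have -> : partial i (fun x => c * x ord0 j * phi n x) x =
      c * x ord0 j * partial i (phi n) x + c * (i == j)%:R * phi n x.
    rewrite (_ : (fun x => _) = c \*: (fun x : X => x ord0 j * phi n x)); last first.
      by apply/funext => y; rewrite /= /GRing.scale/= mulrA.
    rewrite /partial deriveZ/=; last first.
      by apply: derivableM; [exact: derivable_coord|exact: smooth_derivable].
    have := partial_coordM i j x (sphi n); rewrite /partial => ->.
    by rewrite /GRing.scale/= mulrDr !mulrA.
  set p := partial i (phi n) x; set w := wpartial D i v x; have := cj2 _ Dx.
  set y := c * x ord0 j; set z := c * r; set f := phi n x; set g := v x.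
  have -> : y * p + c * (i == j)%:R * f - (y * w + c * (i == j)%:R * g) =
    y * (p - w) + c * (i == j)%:R * (f - g) by ring.
  move=> yz; set P := p - w; set G := f - g.
  have H1 : y ^+ 2 * P ^+ 2 <= z ^+ 2 * P ^+ 2 by rewrite ler_wpM2r ?sqr_ge0.
  have H2 : 0 <= c ^+ 2 * P ^+ 2 by rewrite mulr_ge0 ?sqr_ge0.
  have H3 : 0 <= c ^+ 2 * G ^+ 2 by rewrite mulr_ge0 ?sqr_ge0.
  have H4 : 0 <= z ^+ 2 * G ^+ 2 by rewrite mulr_ge0 ?sqr_ge0.
  have H5 : 0 <= (y * P - c * G) ^+ 2 by rewrite sqr_ge0.
  by case: (i == j); rewrite ?mulr1 ?mulr0 ?mul0r ?addr0; nra.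
Qed.

(** Multiplying the approximating sequence by c x_j shows that the trace of the product is c x_j g,
    which vanishes where g does. This makes the rotated field admissible in Korn's inequality. *)
Lemma H1E0_coordM (dD : set X) (c : R) j v :
  H1E0 D m F dD v -> H1E0 D m F dD (fun x => c * x ord0 j * v x).
Proof.
move=> [Hv [g [[g2 [phi [sphi cphi tphi]]] g0]]].
have mB := measurable_bdry D; have [mg _] := g2.
split; first exact: (H1_coordM oD Dr).
exists (fun x : X => c * x ord0 j * g x); split; last first.
  by apply: filterS g0 => x /[apply] ->; rewrite mulr0.
have mcj : measurable_fun (bdry D) (fun x : X => c * x ord0 j).
  by apply: measurable_funM => //; apply: (@measurable_funS _ _ _ _ setT) => //; exact: measurable_coord.
split.
  apply: (@L2fun_bounded_mul _ _ _ sigma _ mB _ _ (`|c| * r)) => //.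
  by move=> x Dx; rewrite normrM ler_wpM2l// bdry_bounded.
exists (fun n (x : X) => c * x ord0 j * phi n x); split.
- move=> n; rewrite (_ : (fun x => _) = cst c * (fun x : X => x ord0 j) * phi n); last by apply/funext.
  apply: (smoothM _ (sphi n)); apply: (smoothM _ (smooth_coord j)); exact: smooth_cst.
- exact: cvgH1_coordM.
- have mphi n : measurable_fun (bdry D) (phi n).
    by apply: measurable_continuous_fun => //; exact: smooth_continuous.
  apply: (@cvg0_le_sqr _ _ _ sigma _ mB _ (fun n x => phi n x - g x) (fun n x => phi n x - g x)
    ((c * r) ^+ 2)) => //; first by rewrite sqr_ge0.
  + by move=> n; split; apply: measurable_funB => //; exact: measurable_funM.
  + move=> n; apply: aeW => x Dx; rewrite -mulrBr exprMn.
    apply: ler_wpDr; first by rewrite mulr_ge0 ?sqr_ge0.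
    rewrite ler_wpM2r ?sqr_ge0//.
    rewrite -[leLHS]real_normK ?num_real// -[leRHS]real_normK ?num_real//.
    by rewrite ler_pXn2r ?nnegrE// !normrM ler_wpM2l// (le_trans (bdry_bounded Dx j))// ler_norm.
Qed.

End TraceCoordinateMultiples.

(** * The Poincare inequality *)

Section Poincare.
Context {R : realType} {d : nat}.
Variables (D : set 'rV[R]_d) (r : R) (m : nat) (F : nat -> facet R d).
Variables (dD : set 'rV[R]_d) (CK : R).
Hypothesis oD : open D.
Hypothesis Dr : forall x, D x -> forall i, `|x ord0 i| <= r.
Hypothesis hK : korn D m F dD CK.
Local Notation X := 'rV[R]_d.
Local Notation mu := (leb d).
Local Notation L2 := (L2fun mu D).
Let mD : measurable D := measurable_open oD.

Lemma integrable_frob p q (A B : X -> 'M[R]_(p, q)) :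
  (forall i j, L2 (fun x => A x i j)) -> (forall i j, L2 (fun x => B x i j)) ->
  mu.-integrable D (EFin \o (fun x => frob (A x) (B x))).
Proof.
move=> A2 B2; apply: integrable_sumR => // i; apply: integrable_sumR => // j.
exact: L2fun_intM.
Qed.

Lemma L2_grad (v : X -> X) : (forall i, H1 D (component v i)) ->
  forall i j, L2 (fun x => grad D v x i j).
Proof.
move=> Hv i j; under eq_fun do rewrite mxE.
by have [] := H1_wpartial j (Hv i).
Qed.

Lemma L2_strain (v : X -> X) : (forall i, H1 D (component v i)) ->
  forall i j, L2 (fun x => strain D v x i j).
Proof.
move=> Hv i j; under eq_fun do rewrite !mxE.
apply: L2funZ => //; apply: L2funD => //.
  by have [] := H1_wpartial j (Hv i).
by have [] := H1_wpartial i (Hv j).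
Qed.

(** With V and G the squared norms of v and of its gradient, this is the factor of G obtained by
    solving CK (V/2 - r^2 G) <= d r^2 G for V. *)
Definition poincare_cst : R := 2 * r ^+ 2 * (1 + d%:R / CK).

(* Korn's inequality for the field v * (rotation in the (a, b)-plane): its
   gradient contains v itself, whereas its strain only involves grad v. *)
Lemma poincare (a b : 'I_d) (v : X -> R) : a != b -> 0 < CK -> H1E0 D m F dD v ->
  \int[mu]_(x in D) (v x ^+ 2) <=
  poincare_cst * \int[mu]_(x in D) (\sum_j wpartial D j v x ^+ 2).
Proof.
move=> ab CK0 vE.
have [Hv _] := vE; have [v2 _] := Hv.
(* The field w has components w_a = x_b v and w_b = - x_a v, and all others are zero. *)
pose c (i : 'I_d) : R := if i == a then 1 else if i == b then -1 else 0.
pose k (i : 'I_d) : 'I_d := if i == a then b else a.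
pose w (x : X) : X := \row_i (c i * x ord0 (k i) * v x).
have wE i : component w i = (fun x => c i * x ord0 (k i) * v x).
  by apply/funext => x; rewrite /component mxE.
have HwE i : H1E0 D m F dD (component w i).
  by rewrite wE; exact: (H1E0_coordM oD Dr).
have Hw i : H1 D (component w i) by have [] := HwE i.
have korn_w := hK HwE.
pose eta (x : X) i : R := c i * x ord0 (k i).
pose dv (x : X) i : R := wpartial D i v x.
have gradw : {ae mu, forall x, forall ij : 'I_d * 'I_d, D x ->
    grad D w x ij.1 ij.2 = eta x ij.1 * dv x ij.2 + c ij.1 * (ij.2 == k ij.1)%:R * v x}.
  apply: filter_forall => -[i j].
  have := wpartial_coordM oD Dr (c i) (k i) j Hv; rewrite -wE.
  by apply: filterS => x /[swap] Dx /(_ Dx); rewrite mxE.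
have dv2 i : L2 (dv ^~ i) by have [] := H1_wpartial i Hv.
have sqr_int (g : X -> R) : L2 g -> mu.-integrable D (EFin \o (fun x => g x ^+ 2)) by move=> [].
pose G := \int[mu]_(x in D) (\sum_j dv x j ^+ 2).
have iG : mu.-integrable D (EFin \o (fun x => \sum_j dv x j ^+ 2)).
  by apply: integrable_sumR => // j; exact: sqr_int.
have G0 : 0 <= G by apply: Rintegral_ge0 => x _; apply: sumr_ge0 => j _; exact: sqr_ge0.
have eta_le x i : D x -> eta x i ^+ 2 <= r ^+ 2.
  move=> Dx; rewrite -real_normK ?num_real// ler_pXn2r ?nnegrE//; last first.
    by apply: le_trans (Dr Dx i).
  rewrite normrM /c; have := Dr Dx (k i).
  case: ifP => _; last case: ifP => _; rewrite ?normrN ?normr1 ?mul1r// normr0 mul0r => _.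
  by apply: le_trans (Dr Dx i).
have upper : \int[mu]_(x in D) frob (strain D w x) (strain D w x) <= d%:R * r ^+ 2 * G.
  rewrite -RintegralZl//; apply: ae_le_Rintegral => //.
  - by apply: integrable_frob; exact: L2_strain.
  - exact: integrableZR.
  apply: filterS gradw => x gw Dx.
  have sE i j : strain D w x i j = 2^-1 * (eta x i * dv x j + eta x j * dv x i).
    rewrite !mxE; have := gw (i, j) Dx; have := gw (j, i) Dx; rewrite !mxE /= => -> ->.
    (* Skew-symmetry of the rotation: the terms containing v itself cancel in the symmetrised
       gradient. *)
    have -> : c j * (i == k j)%:R = - (c i * (j == k i)%:R).
      rewrite /c /k; case: (eqVneq i a) => ia; case: (eqVneq j a) => ja.
      - by rewrite ia ja (negPf ab) !mulr0 oppr0.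
      - by rewrite ia eqxx; case: eqP; rewrite ?mulr1 ?mulr0 ?mul1r ?mul0r ?oppr0.
      - by case: eqP; rewrite ?mulr1 ?mulr0 ?mul1r ?mul0r ?oppr0 ?opprK.
      - by rewrite ?(negPf ia) ?(negPf ja) !mulr0 oppr0.
    by rewrite mulNr addrACA subrr addr0.
  (* Each entry of the strain has square at most r^2 (dv_i^2 + dv_j^2) / 2; summing over the d^2
     pairs (i, j) produces the factor d. *)
  have -> : d%:R * r ^+ 2 * \sum_j dv x j ^+ 2 =
      \sum_(i < d) \sum_(j < d) (2^-1 * (r ^+ 2 * dv x j ^+ 2) + 2^-1 * (r ^+ 2 * dv x i ^+ 2)).
    under [RHS]eq_bigr do rewrite big_split/=.
    rewrite big_split/= [X in _ + X]exchange_big/= sumr_const card_ord.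
    rewrite -!mulr_sumr -[in RHS]mulr_natl.
    by move: (\sum_j _) => S; field.
  apply: ler_sum => i _; apply: ler_sum => j _; rewrite sE.
  have := eta_le x i Dx; have := eta_le x j Dx.
  move: (eta x i) (eta x j) (dv x i) (dv x j) => p q s t qr pr.
  have := sqr_ge0 (p * t - q * s).
  have : q ^+ 2 * s ^+ 2 <= r ^+ 2 * s ^+ 2 by rewrite ler_wpM2r ?sqr_ge0.
  have : p ^+ 2 * t ^+ 2 <= r ^+ 2 * t ^+ 2 by rewrite ler_wpM2r ?sqr_ge0.
  nra.
pose V := \int[mu]_(x in D) (v x ^+ 2).
have lower : 2^-1 * V - r ^+ 2 * G <= \int[mu]_(x in D) frob (grad D w x) (grad D w x).
  rewrite -!RintegralZl//; last exact: sqr_int.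
  rewrite -RintegralB//; [|by apply: integrableZR => //; exact: sqr_int|exact: integrableZR].
  apply: ae_le_Rintegral => //.
  - have := integrableB mD (integrableZR mD 2^-1 (sqr_int _ v2)) (integrableZR mD (r ^+ 2) iG).
    exact.
  - by apply: integrable_frob; exact: L2_grad.
  apply: filterS gradw => x gw Dx.
  (* The (a, b) entry alone suffices: it is x_b times the b-th derivative of v, plus v. *)
  have : (grad D w x a b) ^+ 2 <= frob (grad D w x) (grad D w x).
    rewrite /frob (bigD1 a)//= (bigD1 b)//= -expr2 -addrA lerDl addr_ge0//.
      by apply: sumr_ge0 => j _; rewrite -expr2 sqr_ge0.
    by apply: sumr_ge0 => i _; apply: sumr_ge0 => j _; rewrite -expr2 sqr_ge0.
  apply: le_trans; rewrite (gw (a, b) Dx)/= /c /k !eqxx !mulr1.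
  have : dv x b ^+ 2 <= \sum_j dv x j ^+ 2.
    by rewrite (bigD1 b)//= lerDl; apply: sumr_ge0 => j _; exact: sqr_ge0.
  have := eta_le x a Dx; move: (eta x a) (\sum_j _) (dv x b) (v x) => p S t z pr tS.
  have : p ^+ 2 * t ^+ 2 <= r ^+ 2 * t ^+ 2 by rewrite ler_wpM2r ?sqr_ge0.
  have : r ^+ 2 * t ^+ 2 <= r ^+ 2 * S by rewrite ler_wpM2l ?sqr_ge0.
  (* This square yields (p t + z)^2 >= z^2 / 2 - p^2 t^2. *)
  have := sqr_ge0 (2 * p * t + z); nra.
have : CK * (2^-1 * V - r ^+ 2 * G) <= d%:R * r ^+ 2 * G.
  by apply: le_trans upper; apply: le_trans korn_w; rewrite ler_pM2l.
rewrite -/V -/G /poincare_cst => H.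
rewrite -(ler_pM2l CK0).
have -> : CK * (2 * r ^+ 2 * (1 + d%:R / CK) * G) = 2 * r ^+ 2 * G * CK + 2 * (d%:R * r ^+ 2 * G).
  by field; rewrite gt_eqF.
nra.
Qed.

Lemma poincare_vec (v : X -> X) : (1 < d)%N -> 0 < CK ->
  (forall i, H1E0 D m F dD (component v i)) ->
  \int[mu]_(x in D) frob (v x) (v x) <=
  poincare_cst * \int[mu]_(x in D) frob (grad D v x) (grad D v x).
Proof.
move=> d1 CK0 vE.
have Hv i : H1 D (component v i) by have [] := vE i.
have v2 i : L2 (component v i) by have [] := Hv i.
have d0 : (0 < d)%N by exact: ltnW.
have ab : Ordinal d0 != Ordinal d1 by [].
have -> : \int[mu]_(x in D) frob (v x) (v x) = \sum_i \int[mu]_(x in D) (component v i x ^+ 2).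
  rewrite -Rintegral_sum//; last by move=> i; have [] := v2 i.
  by apply: eq_Rintegral => x _; rewrite /frob big_ord1.
have -> : \int[mu]_(x in D) frob (grad D v x) (grad D v x) =
    \sum_i \int[mu]_(x in D) (\sum_j wpartial D j (component v i) x ^+ 2).
  rewrite -Rintegral_sum//; last first.
    by move=> i; apply: integrable_sumR => // j; have [[]] := H1_wpartial j (Hv i).
  by apply: eq_Rintegral => x _; apply: eq_bigr => i _; apply: eq_bigr => j _; rewrite mxE.
rewrite mulr_sumr; apply: ler_sum => i _; exact: poincare ab CK0 (vE i).
Qed.

End Poincare.

(** * Iterated integrals *)

Section IteratedIntegral.
Context {R : realType} {d1 d2} {T1 : measurableType d1} {T2 : measurableType d2}.
Variables (m1 : {sigma_finite_measure set T1 -> \bar R}).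
Variables (m2 : {sigma_finite_measure set T2 -> \bar R}).
Variables (A : set T1) (B : set T2).
Hypotheses (mA : measurable A) (mB : measurable B).
Local Notation m12 := (m1 \x m2)%E.
Let mAB : measurable (A `*` B) := measurableX mA mB.

Lemma measurable_section (g : T1 * T2 -> R) y : B y ->
  measurable_fun (A `*` B) g -> measurable_fun A (fun x => g (x, y)).
Proof.
move=> By mg _ Y mY.
have mX := mg mAB _ mY.
rewrite (_ : _ `&` _ = ysection ((A `*` B) `&` g @^-1` Y) y).
  exact: measurable_ysection.
apply/seteqP; split => x /=.
  by move=> [Ax Yx]; rewrite /ysection/= inE.
by rewrite /ysection/= inE => -[[]].
Qed.

Lemma patch_section (g : T1 * T2 -> \bar R) y : B y ->
  (\int[m1]_x (g \_ (A `*` B)) (x, y) = \int[m1]_(x in A) g (x, y))%E.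
Proof.
move=> By; rewrite [RHS]integral_mkcond; apply: eq_integral => x _.
rewrite /patch; congr (if _ then _ else _).
by apply/idP/idP => /set_mem; [move=> [Ax _]|move=> Ax]; apply/mem_set.
Qed.

Lemma patch_section_out (g : T1 * T2 -> \bar R) y : ~ B y ->
  (\int[m1]_x (g \_ (A `*` B)) (x, y) = 0)%E.
Proof.
move=> By; apply: integral0_eq => x _; rewrite /patch; case: ifPn => //.
by rewrite inE => -[].
Qed.

(** Fubini's theorem for real-valued integrals: the inner real integral agrees with the extended one
    wherever the latter is finite, that is, for almost every y in B. Extension by zero reduces the
    rectangle to the whole product. *)
Lemma iterated_integrable (g : T1 * T2 -> R) : m12.-integrable (A `*` B) (EFin \o g) ->
  m2.-integrable B (EFin \o (fun y => \int[m1]_(x in A) g (x, y))) /\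
  \int[m2]_(y in B) \int[m1]_(x in A) g (x, y) = \int[m12]_(z in A `*` B) g z.
Proof.
move=> ig.
have igT := (integrable_mkcond _ mAB).1 ig.
pose f : T1 * T2 -> \bar R := (EFin \o g) \_ (A `*` B).
pose G (y : T2) : \bar R := (\int[m1]_x f (x, y))%E.
have iG : m2.-integrable B G.
  have mgT := measurable_int _ igT.
  apply: (integrableS measurableT) => //; apply/integrableP; split.
    exact: measurable_fubini_G igT.
  have foo : (\int[m2]_y \int[m1]_x `|f (x, y)| < +oo)%E by apply/integrable21ltyP.
  apply: le_lt_trans foo; apply: ge0_le_integral => //.
  - by apply: measurableT_comp => //; exact: measurable_fubini_G igT.
  - apply: (measurable_fun_fubini_tonelli_G (abse \o f)) => //=.
    exact: measurableT_comp.
  - by move=> y _; apply: le_abse_integral => //; exact: measurableT_comp.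
have GE y : B y -> G y = (\int[m1]_(x in A) (g (x, y))%:E)%E by exact: patch_section.
have ae_fin : {ae m2, forall y, B y -> (EFin \o (fun y => \int[m1]_(x in A) g (x, y))) y = G y}.
  have := integrable_ae mB iG; apply: filterS => y /[swap] By /(_ By) Gy.
  by rewrite /= GE// -[RHS]fineK// -GE.
have mfin : measurable_fun B (EFin \o (fun y => \int[m1]_(x in A) g (x, y))).
  apply/measurable_EFinP; apply: (@eq_measurable_fun _ _ _ _ _ (fine \o G)).
    by move=> y /set_mem By; rewrite /= GE.
  by apply: measurableT_comp => //; exact: measurable_int iG.
split.
  apply/integrableP; split => //.
  have /integrableP[mG] := iG; apply: le_lt_trans.
  apply: ae_ge0_le_integral => //.
  - by apply: measurableT_comp.
  - by apply: measurableT_comp.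
  - by apply: filterS ae_fin => y /[apply] ->.
rewrite /Rintegral; congr fine.
rewrite [RHS]integral_mkcond -integral21_prod_meas1//.
transitivity (\int[m2]_(y in B) G y)%E.
  by apply: ae_eq_integral => //; exact: measurable_int iG.
rewrite [LHS]integral_mkcond; apply: eq_integral => y _; rewrite [LHS]/patch.
case: ifPn => //; rewrite notin_setE => By.
exact/esym/patch_section_out.
Qed.

End IteratedIntegral.

(** * Fields measurable in each slice, and their joint representatives *)

Section JointFields.
Context {R : realType} {d M : nat}.
Variable D : set 'rV[R]_d.
Hypothesis mD : measurable D.
Local Notation X := 'rV[R]_d.
Local Notation Y := 'rV[R]_M.
Local Notation mu := (leb d).
Local Notation P := (leb d \x upi M)%E.
Local Notation DG := (D `*` Gamma M).
Let mG := @measurable_Gamma R M.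
Let mDG : measurable DG := measurableX mD mG.
Implicit Types h g w : X * Y -> R.

(* Fields built from weak derivatives are chosen separately for each parameter
   y, so only their slices are measurable; each is represented by a jointly
   measurable field with which every slice agrees almost everywhere. *)
Definition sections_eq h g := forall y, Gamma M y ->
  measurable_fun D (fun x => h (x, y)) /\ {ae mu, forall x, D x -> h (x, y) = g (x, y)}.

Definition dintable h := exists2 g,
  P.-integrable DG (EFin \o g) & sections_eq h g.

Definition J2 h := exists2 g, L2fun P DG g & sections_eq h g.

Lemma sections_eq_refl g : measurable_fun DG g -> sections_eq g g.
Proof.
move=> mg y Gy; split; last exact: aeW.
exact: (measurable_section mD mG Gy).
Qed.

Lemma sections_eqD h1 g1 h2 g2 : sections_eq h1 g1 -> sections_eq h2 g2 ->
  sections_eq (fun z => h1 z + h2 z) (fun z => g1 z + g2 z).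
Proof.
move=> s1 s2 y Gy; have [m1 e1] := s1 y Gy; have [m2 e2] := s2 y Gy.
split; first exact: measurable_funD.
by apply: filterS2 e1 e2 => x + + Dx => /(_ Dx) -> /(_ Dx) ->.
Qed.

Lemma sections_eqM h1 g1 h2 g2 : sections_eq h1 g1 -> sections_eq h2 g2 ->
  sections_eq (fun z => h1 z * h2 z) (fun z => g1 z * g2 z).
Proof.
move=> s1 s2 y Gy; have [m1 e1] := s1 y Gy; have [m2 e2] := s2 y Gy.
split; first exact: measurable_funM.
by apply: filterS2 e1 e2 => x + + Dx => /(_ Dx) -> /(_ Dx) ->.
Qed.

Lemma sections_eq_cst c : sections_eq (cst c) (cst c).
Proof. by apply: sections_eq_refl; exact: measurable_cst. Qed.

Lemma sections_eq_sum (I : Type) (r : seq I) (h g : I -> X * Y -> R) :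
  (forall i, sections_eq (h i) (g i)) ->
  sections_eq (fun z => \sum_(i <- r) h i z) (fun z => \sum_(i <- r) g i z).
Proof.
move=> hg; elim: r => [|i r IH].
  have E (f : I -> X * Y -> R) : (fun z => \sum_(i <- [::]) f i z) = cst 0.
    by apply/funext => z; rewrite big_nil.
  by rewrite !E; exact: sections_eq_cst.
have E (f : I -> X * Y -> R) :
    (fun z => \sum_(j <- i :: r) f j z) = (fun z => f i z + \sum_(j <- r) f j z).
  by apply/funext => z; rewrite big_cons.
by rewrite !E; exact: sections_eqD.
Qed.

Lemma dint_rep h g : P.-integrable DG (EFin \o g) -> sections_eq h g ->
  dint D h = \int[P]_(z in DG) g z.
Proof.
move=> ig hg; have [_ <-] := iterated_integrable mD mG ig.
apply: eq_Rintegral => y /set_mem Gy; have [mh hgy] := hg y Gy.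
apply: ae_Rintegral => //; apply: (measurable_section mD mG Gy).
by apply/measurable_EFinP; exact: measurable_int ig.
Qed.

Lemma dintableD h1 h2 : dintable h1 -> dintable h2 -> dintable (fun z => h1 z + h2 z).
Proof.
move=> [g1 i1 s1] [g2 i2 s2]; exists (fun z => g1 z + g2 z); last exact: sections_eqD.
exact: integrableDR.
Qed.

Lemma dintableZ c h : dintable h -> dintable (fun z => c * h z).
Proof.
move=> [g i s]; exists (fun z => c * g z); first exact: integrableZR.
by apply: sections_eqM => //; exact: sections_eq_cst.
Qed.

Lemma dintD h1 h2 : dintable h1 -> dintable h2 ->
  dint D (fun z => h1 z + h2 z) = dint D h1 + dint D h2.
Proof.
move=> [g1 i1 s1] [g2 i2 s2].
rewrite (dint_rep i1 s1) (dint_rep i2 s2) -RintegralD//.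
by apply: dint_rep; [exact: integrableDR|exact: sections_eqD].
Qed.

Lemma dintZ c h : dintable h -> dint D (fun z => c * h z) = c * dint D h.
Proof.
move=> [g i s]; rewrite (dint_rep i s) -RintegralZl//.
apply: dint_rep; first exact: integrableZR.
by apply: sections_eqM => //; exact: sections_eq_cst.
Qed.

Lemma dintable_sum (I : Type) (r : seq I) (h : I -> X * Y -> R) :
  (forall i, dintable (h i)) -> dintable (fun z => \sum_(i <- r) h i z).
Proof.
move=> hi; elim: r => [|i r IH].
  under eq_fun do rewrite big_nil; exists (cst 0); last exact: sections_eq_cst.
  exact: integrable0.
by under eq_fun do rewrite big_cons; exact: dintableD.
Qed.

(** The passage from spatial inequalities, valid for each fixed parameter, to the iterated integral;
    Korn, Poincare and inf-sup estimates are all lifted this way. *)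
Lemma dint_le h1 h2 : dintable h1 -> dintable h2 ->
  (forall y, Gamma M y ->
    \int[mu]_(x in D) h1 (x, y) <= \int[mu]_(x in D) h2 (x, y)) ->
  dint D h1 <= dint D h2.
Proof.
have slice_int h : dintable h ->
    (upi M).-integrable (Gamma M) (EFin \o (fun y => \int[mu]_(x in D) h (x, y))).
  move=> [g ig s]; have [iG _] := iterated_integrable mD mG ig.
  apply: eq_integrable iG => // y /set_mem Gy; have [mh hgy] := s y Gy.
  congr EFin; apply/esym; apply: ae_Rintegral => //.
  apply: (measurable_section mD mG Gy).
  by apply/measurable_EFinP; exact: measurable_int ig.
by move=> i1 i2 h12; apply: le_Rintegral => //; exact: slice_int.
Qed.

Lemma dint_ge0 h : (forall z, 0 <= h z) -> 0 <= dint D h.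
Proof. by move=> h0; do 2 apply: Rintegral_ge0 => ? _. Qed.

Lemma J2D h1 h2 : J2 h1 -> J2 h2 -> J2 (fun z => h1 z + h2 z).
Proof.
move=> [g1 i1 s1] [g2 i2 s2]; exists (fun z => g1 z + g2 z); last exact: sections_eqD.
exact: L2funD.
Qed.

Lemma J2Z c h : J2 h -> J2 (fun z => c * h z).
Proof.
move=> [g i s]; exists (fun z => c * g z); first exact: L2funZ.
by apply: sections_eqM => //; exact: sections_eq_cst.
Qed.

Lemma J2_sum (I : Type) (r : seq I) (h : I -> X * Y -> R) :
  (forall i, J2 (h i)) -> J2 (fun z => \sum_(i <- r) h i z).
Proof.
move=> hi; elim: r => [|i r IH].
  under eq_fun do rewrite big_nil; exists (cst 0); last exact: sections_eq_cst.
  exact: L2fun0.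
by under eq_fun do rewrite big_cons; exact: J2D.
Qed.

(** The factor s is bounded, so it is enough that g, as a function of both variables, is square
    integrable: its inner integral is constant in y and [Gamma] has measure at most 1. *)
Lemma J2_tensor (g : X -> R) (s : Y -> R) (C : R) : L2fun mu D g ->
  measurable_fun (Gamma M) s -> (forall y, Gamma M y -> `|s y| <= C) ->
  L2fun P DG (fun z => s z.2 * g z.1).
Proof.
move=> [mg g2] ms sC.
have mg1 : measurable_fun DG (fun z : X * Y => g z.1).
  move=> _ A mA; rewrite (_ : _ `&` _ = (D `&` g @^-1` A) `*` Gamma M).
    by apply: measurableX => //; exact: mg.
  by apply/seteqP; split => -[x y] /=; [move=> [[]]|move=> [[]]].
have ms2 : measurable_fun DG (fun z : X * Y => s z.2).
  move=> _ A mA; rewrite (_ : _ `&` _ = D `*` (Gamma M `&` s @^-1` A)).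
    by apply: measurableX => //; exact: ms.
  by apply/seteqP; split => -[x y] /=; [move=> [[]]|move=> [? []]].
apply: (@L2fun_bounded_mul _ _ _ P _ mDG _ _ C) => //.
  by move=> z [_]; exact: sC.
split => //.
have mg2 : measurable_fun DG (fun z : X * Y => (g z.1 ^+ 2)%:E).
  by apply/measurable_EFinP; exact: measurable_funX.
apply/(integrable_mkcond _ mDG)/integrable21ltyP.
  by apply/(measurable_restrict _ mDG measurableT); rewrite setTI.
have /integrableP[_ gfin] := g2.
apply: le_lt_trans gfin.
set c := (\int[mu]_(x in D) `|_|)%E.
have c0 : (0 <= c)%E by apply: integral_ge0.
rewrite (_ : (fun y => _) = (cst c) \_ (Gamma M)).
  rewrite -integral_mkcond integral_cst//.
  by rewrite -[leRHS]mule1 lee_wpmul2l// upi_Gamma_le1.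
apply/funext => y; rewrite [RHS]/patch; case: ifPn => [/set_mem Gy|]; last first.
  rewrite notin_setE => Gy; apply: integral0_eq => x _; rewrite /patch; case: ifPn => //.
    by rewrite inE => -[].
  by rewrite abse0.
rewrite /c [RHS]integral_mkcond; apply: eq_integral => x _; rewrite /patch.
have -> : ((x, y) \in DG) = (x \in D).
  by apply/idP/idP => /set_mem; [move=> [Ax _]|move=> Ax]; apply/mem_set.
by case: ifP => // _; rewrite abse0.
Qed.

End JointFields.

(** The source of Cauchy-Schwarz for semidefinite forms. If c > 0, the minimiser t = -b/c gives the
    claim; c = 0 forces b = 0, and c < 0 is excluded by a large t. *)
Lemma discriminant_le {R : realFieldType} (a b c : R) :
  (forall t, 0 <= a + 2 * t * b + t ^+ 2 * c) -> b ^+ 2 <= a * c.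
Proof.
move=> H; have a0 : 0 <= a by have := H 0; rewrite expr0n !mulr0 !mul0r !addr0.
have [c0|c0] := eqVneq c 0.
  rewrite c0 mulr0; have [->|b0] := eqVneq b 0; first by rewrite expr0n.
  have := H (- (a + 1) / (2 * b)); rewrite c0 mulr0 addr0.
  have -> : a + 2 * (- (a + 1) / (2 * b)) * b = - 1 by field.
  by rewrite oppr_ge0 ler10.
have cp : 0 < c.
  rewrite lt_def c0/=; rewrite leNgt; apply/negP => cn.
  have [t t0 tc] : exists2 t : R, 0 < t & a + 2 * t * b + t ^+ 2 * c < 0.
    have nc : 0 < - c by rewrite oppr_gt0.
    (* For this t = 1 + k the quadratic is at most (1 + k) c - k a, which is negative. *)
    exists (1 + (a + 2 * `|b|) / - c).
      by rewrite ltr_pwDl// divr_ge0 ?addr_ge0 ?mulr_ge0// ltW.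
    set k := (a + 2 * `|b|) / - c.
    have k0 : 0 <= k by rewrite divr_ge0 ?addr_ge0 ?mulr_ge0// ltW.
    have kc : k * c = - (a + 2 * `|b|).
      by rewrite /k invrN mulrN mulNr divfK.
    have bb := ler_norm b.
    have -> : a + 2 * (1 + k) * b + (1 + k) ^+ 2 * c = a + 2 * (1 + k) * b + (1 + k) * (c + k * c) by ring.
    rewrite kc; have := normr_ge0 b; nra.
  by have := H t; rewrite leNgt tc.
have := H (- b / c); rewrite -(ler_pM2r cp) mul0r.
have -> : (a + 2 * (- b / c) * b + (- b / c) ^+ 2 * c) * c = a * c - b ^+ 2 by field.
by rewrite subr_ge0.
Qed.

Lemma frobC {R : realType} p q (A B : 'M[R]_(p, q)) : frob A B = frob B A.
Proof. by apply: eq_bigr => i _; apply: eq_bigr => j _; rewrite mulrC. Qed.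

Lemma frobDr {R : realType} p q (A B C : 'M[R]_(p, q)) c :
  frob A (c *: B + C) = c * frob A B + frob A C.
Proof.
rewrite /frob mulr_sumr -big_split/=; apply: eq_bigr => i _.
rewrite mulr_sumr -big_split/=; apply: eq_bigr => j _.
by rewrite !mxE; ring.
Qed.

Lemma frob_ge0 {R : realType} p q (A : 'M[R]_(p, q)) : 0 <= frob A A.
Proof. by apply: sumr_ge0 => i _; apply: sumr_ge0 => j _; rewrite -expr2 sqr_ge0. Qed.

(** * Weighted inner products of matrix fields *)

Section WeightedProducts.
Context {R : realType} {d M : nat}.
Variable D : set 'rV[R]_d.
Hypothesis mD : measurable D.
Local Notation X := 'rV[R]_d.
Local Notation Y := 'rV[R]_M.
Local Notation mu := (leb d).
Local Notation P := (leb d \x upi M)%E.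
Local Notation DG := (D `*` Gamma M).
Let mG := @measurable_Gamma R M.
Let mDG : measurable DG := measurableX mD mG.

Lemma dint_eq (h1 h2 : X * Y -> R) : dintable D h1 -> dintable D h2 ->
  (forall y, Gamma M y -> {ae mu, forall x, D x -> h1 (x, y) = h2 (x, y)}) ->
  dint D h1 = dint D h2.
Proof.
move=> [g1 _ s1] [g2 _ s2] h12; apply: eq_Rintegral => y /set_mem Gy.
have [m1 _] := s1 y Gy; have [m2 _] := s2 y Gy.
by apply: ae_Rintegral => //; exact: h12.
Qed.

Definition JM p q (A : X * Y -> 'M[R]_(p, q)) := forall i j, J2 D (fun z => A z i j).

Lemma JMD p q (A B : X * Y -> 'M[R]_(p, q)) c : JM A -> JM B ->
  JM (fun z => c *: A z + B z).
Proof.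
move=> JA JB i j; under eq_fun do rewrite !mxE.
by apply: J2D => //; exact: J2Z.
Qed.

(** One product for all forms: w = E with strains for the stiffness, w = 1 with gradients for the
    Dirichlet energy, and 1 x 1 matrices for the pressure terms. *)
Definition ip (w : X * Y -> R) p q (A B : X * Y -> 'M[R]_(p, q)) : R :=
  dint D (fun z => w z * frob (A z) (B z)).

Lemma ipC w p q (A B : X * Y -> 'M[R]_(p, q)) : ip w A B = ip w B A.
Proof. by rewrite /ip; under eq_fun do rewrite frobC. Qed.

Section Weight.
Variables (w : X * Y -> R) (wmin wmax : R).
Hypothesis wLinf : Linfun P DG w.
Hypothesis wb : {ae P, forall z, DG z -> wmin <= w z <= wmax}.

Lemma weighted_rep h1 h2 g1 g2 : L2fun P DG g1 -> L2fun P DG g2 ->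
  sections_eq D h1 g1 -> sections_eq D h2 g2 ->
  P.-integrable DG (EFin \o (fun z => w z * (g1 z * g2 z))) /\
  sections_eq D (fun z => w z * (h1 z * h2 z)) (fun z => w z * (g1 z * g2 z)).
Proof.
move=> L1 L2 s1 s2; have [mw [C wC]] := wLinf.
have ig := L2fun_intM mDG L1 L2.
split.
  apply: (@ae_integrable _ _ _ P _ mDG (fun z => C * (g1 z * g2 z))).
  - apply: measurable_funM => //; apply/measurable_EFinP; exact: measurable_int ig.
  - apply: filterS wC => z /[apply] wC; rewrite normrM [leRHS]normrM ler_wpM2r//.
    by rewrite (le_trans wC)// ler_norm.
  - exact: integrableZR.
by apply: sections_eqM; [exact: sections_eq_refl|exact: sections_eqM].
Qed.

Lemma weighted_dintable h1 h2 : J2 D h1 -> J2 D h2 ->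
  dintable D (fun z => w z * (h1 z * h2 z)).
Proof.
move=> [g1 L1 s1] [g2 L2 s2]; have [ig sg] := weighted_rep L1 L2 s1 s2.
by exists (fun z => w z * (g1 z * g2 z)).
Qed.

Lemma ip_dintable p q (A B : X * Y -> 'M[R]_(p, q)) : JM A -> JM B ->
  dintable D (fun z => w z * frob (A z) (B z)).
Proof.
move=> JA JB.
rewrite (_ : (fun z => _) = fun z => \sum_i \sum_j w z * (A z i j * B z i j)); last first.
  by apply/funext => z; rewrite mulr_sumr; apply: eq_bigr => i _; rewrite mulr_sumr.
apply: dintable_sum => // i; apply: dintable_sum => // j.
exact: weighted_dintable.
Qed.

(** The combination [B'] is identified only almost everywhere in each slice, which is all that is
    known of the weak gradient of a sum. *)
Lemma ip_linr p q (A B C B' : X * Y -> 'M[R]_(p, q)) c : JM A -> JM B -> JM C -> JM B' ->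
  (forall y, Gamma M y -> {ae mu, forall x, D x -> B' (x, y) = c *: B (x, y) + C (x, y)}) ->
  ip w A B' = c * ip w A B + ip w A C.
Proof.
move=> JA JB JC JB' BE; have dB := ip_dintable JA JB; have dC := ip_dintable JA JC.
rewrite /ip -(dintZ mD c dB) -(dintD mD (dintableZ mD c dB) dC).
apply: dint_eq; [exact: ip_dintable| |].
  by apply: dintableD => //; exact: dintableZ.
move=> y Gy; apply: filterS (BE y Gy) => x /[apply] ->.
by rewrite frobDr mulrDr mulrCA.
Qed.

(** The bounds on w hold almost everywhere in the product, which says nothing about one given slice.
    The energy is therefore rewritten with a jointly measurable representative and compared under
    the integral over the product. *)
Lemma ip_bounds p q (A : X * Y -> 'M[R]_(p, q)) : JM A ->
  wmin * dint D (fun z => frob (A z) (A z)) <= ip w A A <=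
  wmax * dint D (fun z => frob (A z) (A z)).
Proof.
move=> JA.
have /choice[g gE] (ij : 'I_p * 'I_q) : exists g : X * Y -> R,
    L2fun P DG g /\ sections_eq D (fun z => A z ij.1 ij.2) g.
  by have [g g2 sg] := JA ij.1 ij.2; exists g.
pose G z := \sum_i \sum_j g (i, j) z * g (i, j) z.
have iG : P.-integrable DG (EFin \o G).
  apply: integrable_sumR => // i; apply: integrable_sumR => // j.
  by apply: L2fun_intM => //; have [] := gE (i, j).
have sG : sections_eq D (fun z => frob (A z) (A z)) G.
  apply: sections_eq_sum => // i; apply: sections_eq_sum => // j.
  by apply: sections_eqM; have [] := gE (i, j).
have G0 z : 0 <= G z by apply: sumr_ge0 => i _; apply: sumr_ge0 => j _; rewrite -expr2 sqr_ge0.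
have [mw [C wC]] := wLinf.
have iwG : P.-integrable DG (EFin \o (fun z => w z * G z)).
  apply: (@ae_integrable _ _ _ P _ mDG (fun z => C * G z)).
  - apply: measurable_funM => //; apply/measurable_EFinP; exact: measurable_int iG.
  - apply: filterS wC => z /[apply] wC; rewrite normrM [leRHS]normrM ler_wpM2r//.
    by rewrite (le_trans wC)// ler_norm.
  - exact: integrableZR.
have swG : sections_eq D (fun z => w z * frob (A z) (A z)) (fun z => w z * G z).
  by apply: sections_eqM => //; exact: sections_eq_refl.
rewrite /ip (dint_rep mD iwG swG) (dint_rep mD iG sG) -!RintegralZl//.
apply/andP; split; apply: ae_le_Rintegral => //; try exact: integrableZR.
  by apply: filterS wb => z /[apply] /andP[? _]; rewrite ler_wpM2r.
by apply: filterS wb => z /[apply] /andP[_ ?]; rewrite ler_wpM2r.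
Qed.

Lemma ip_ge0 p q (A : X * Y -> 'M[R]_(p, q)) : 0 <= wmin -> JM A -> 0 <= ip w A A.
Proof.
move=> w0 JA; have /andP[+ _] := ip_bounds JA; apply: le_trans.
by rewrite mulr_ge0// dint_ge0// => z; exact: frob_ge0.
Qed.

Lemma ip_cauchy_schwarz p q (A B : X * Y -> 'M[R]_(p, q)) : 0 <= wmin -> JM A -> JM B ->
  ip w A B ^+ 2 <= ip w A A * ip w B B.
Proof.
move=> w0 JA JB; apply: discriminant_le => t.
have JC : JM (fun z => t *: B z + A z) by exact: JMD.
have : 0 <= ip w (fun z => t *: B z + A z) (fun z => t *: B z + A z) by exact: ip_ge0.
have lin C : JM C -> ip w C (fun z => t *: B z + A z) = t * ip w C B + ip w C A.
  by move=> JC'; apply: ip_linr => // y _; exact: aeW.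
have e1 := lin _ JC; have e2 := lin _ JB; have e3 := lin _ JA.
move: e1 e2 e3; set C := (fun z => _) => e1 e2 e3.
rewrite e1 (ipC w C B) (ipC w C A) e2 e3 (ipC w B A).
move: (ip w A A) (ip w A B) (ip w B B) => a b c.
by have -> : t * (t * c + b) + (t * b + a) = a + 2 * t * b + t ^+ 2 * c by ring.
Qed.

End Weight.

End WeightedProducts.

Lemma frob_eq0 {R : realType} p q (A : 'M[R]_(p, q)) : frob A A = 0 -> A = 0.
Proof.
move=> /eqP; rewrite psumr_eq0; last first.
  by move=> i _; apply: sumr_ge0 => j _; rewrite -expr2 sqr_ge0.
move=> /allP A0; apply/matrixP => i j.
have := A0 i (mem_index_enum _); rewrite /= psumr_eq0; last first.
  by move=> k _; rewrite -expr2 sqr_ge0.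
move=> /allP /(_ j (mem_index_enum _)).
by rewrite /= mulf_eq0 orbb mxE => /eqP.
Qed.

Lemma le_sqrt_mul {R : rcfType} (c a b : R) : 0 <= a -> 0 <= b ->
  c ^+ 2 <= a * b ^+ 2 -> c <= Num.sqrt a * b.
Proof.
move=> a0 b0 cab; apply: le_trans (ler_norm c) _.
rewrite -(@ler_pXn2r _ 2)// ?nnegrE ?mulr_ge0 ?sqrtr_ge0//.
by rewrite real_normK ?num_real// exprMn sqr_sqrtr.
Qed.

Lemma le_mul_sqrt {R : rcfType} (g a b : R) : 0 <= g -> 0 <= a -> 0 <= b ->
  g * Num.sqrt a <= Num.sqrt b -> g ^+ 2 * a <= b.
Proof.
move=> g0 a0 b0; rewrite -(@ler_pXn2r _ 2)// ?nnegrE ?mulr_ge0 ?sqrtr_ge0//.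
by rewrite exprMn !sqr_sqrtr.
Qed.

(** * Bounded functions of the parameter *)

Section ParameterFunctions.
Context {R : realType} {M : nat}.
Local Notation Y := 'rV[R]_M.

Definition bounded_param (s : Y -> R^o) := measurable_fun (Gamma M) (s : Y -> R) /\
  exists C : R, forall y, Gamma M y -> `|s y| <= C.

Let mG := @measurable_Gamma R M.

Lemma bounded_paramZ c s : bounded_param s -> bounded_param (c *: s).
Proof.
move=> [ms [C sC]]; split; first exact: (measurable_funM (measurable_cst c) ms).
by exists (`|c| * C) => y Gy; rewrite normrM ler_wpM2l// sC.
Qed.

Lemma bounded_param_sum (I : Type) (r : seq I) (s : I -> Y -> R^o) :
  (forall i, bounded_param (s i)) -> bounded_param (\sum_(i <- r) s i).
Proof.
move=> bs; elim: r => [|i r [mr [Cr rC]]].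
  rewrite big_nil; split; first exact: (@measurable_cst _ _ _ _ _ (0 : R)).
  by exists 0 => y _; rewrite normr0.
have [ms [C sC]] := bs i; rewrite big_cons; split; first exact: measurable_funD.
by exists (C + Cr) => y Gy; rewrite (le_trans (ler_normD _ _))// lerD ?sC ?rC.
Qed.

Lemma bounded_param_mlegendre (a : 'I_M -> nat) : bounded_param (mlegendre a).
Proof.
rewrite /mlegendre.
have pb (p : {poly R}) k : bounded_param (fun y => p.[y ord0 k]).
  split.
    apply: (@measurable_funS _ _ _ _ setT) => //.
    apply: (@measurableT_comp _ _ _ _ _ _ (horner p)); last exact: measurable_coord.
    by apply: continuous_measurable_fun; exact: continuous_horner.
  exists (\sum_(i < size p) `|p`_i|) => y Gy.
  rewrite horner_coef (le_trans (ler_norm_sum _ _ _))//; apply: ler_sum => i _.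
  by rewrite normrM normrX ler_piMr// exprn_ile1// ler_norml.
elim: (index_enum _) => [|k r [mr [Cr rC]]].
  under eq_fun do rewrite big_nil; split; first exact: measurable_cst.
  by exists 1 => y _; rewrite normr1.
under eq_fun do rewrite big_cons.
have [ms [C sC]] := pb (legendre (a k)) k; split; first exact: measurable_funM.
by exists (C * Cr) => y Gy; rewrite normrM ler_pM ?sC ?rC.
Qed.

Lemma bounded_param_Sspace Lam s : Sspace Lam s -> bounded_param s.
Proof.
rewrite /Sspace lin_spanE => -[n [c [g [Ag ->]]]].
apply: bounded_param_sum => i; apply: bounded_paramZ.
by have [a _ <-] := Ag i; exact: bounded_param_mlegendre.
Qed.

Lemma tensor_rep (T : Type) (U : lmodType R) (V : set (T -> U)) (S : set (Y -> R^o)) w :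
  subspace S -> tensor V S w ->
  exists n (s : 'I_n -> Y -> R^o) (v : 'I_n -> T -> U),
    [/\ forall k, S (s k), forall k, V (v k) &
        w = fun z => \sum_k s k z.2 *: v k z.1].
Proof.
move=> sS; rewrite /tensor => -[n [c [g [gE ->]]]].
have /choice[vs vsE] k : exists vs : (T -> U) * (Y -> R^o),
    [/\ V vs.1, S vs.2 & g k = fun z => vs.2 z.2 *: vs.1 z.1].
  by have [v [s []]] := gE k; exists (v, s).
exists n, (fun k => c k *: (vs k).2), (fun k => (vs k).1); split.
- by move=> k; apply: subspaceZ => //; have [] := vsE k.
- by move=> k; have [] := vsE k.
- apply/funext => z; apply: eq_bigr => k _; have [_ _ ->] := vsE k.
  by rewrite scalerA.
Qed.

End ParameterFunctions.

(** * Inf-sup liftings *)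

Section SpatialProducts.
Context {R : realType} {d : nat}.
Variable D : set 'rV[R]_d.
Hypothesis oD : open D.
Local Notation X := 'rV[R]_d.
Local Notation mu := (leb d).
Local Notation L2 := (L2fun mu D).
Let mD : measurable D := measurable_open oD.

Definition L2mx p q (A : X -> 'M[R]_(p, q)) := forall i j, L2 (fun x => A x i j).

Lemma L2mxD p q (A B : X -> 'M[R]_(p, q)) c : L2mx A -> L2mx B ->
  L2mx (fun x => c *: A x + B x).
Proof.
move=> A2 B2 i j; under eq_fun do rewrite !mxE.
by apply: L2funD => //; exact: L2funZ.
Qed.

Lemma measurable_frob p q (A B : X -> 'M[R]_(p, q)) : L2mx A -> L2mx B ->
  measurable_fun D (fun x => frob (A x) (B x)).
Proof.
move=> A2 B2; apply/measurable_EFinP; apply: measurable_int.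
exact: (integrable_frob oD A2 B2).
Qed.

Lemma int_frob_linr p q (A B C B' : X -> 'M[R]_(p, q)) c :
  L2mx A -> L2mx B -> L2mx C -> L2mx B' ->
  {ae mu, forall x, D x -> B' x = c *: B x + C x} ->
  \int[mu]_(x in D) frob (A x) (B' x) =
  c * (\int[mu]_(x in D) frob (A x) (B x)) + \int[mu]_(x in D) frob (A x) (C x).
Proof.
move=> A2 B2 C2 B'2 BE.
have iB := integrable_frob oD A2 B2; have iC := integrable_frob oD A2 C2.
rewrite -RintegralZl// -RintegralD//; last exact: integrableZR.
apply: ae_Rintegral => //; first exact: measurable_frob.
  apply: measurable_funD; last exact: measurable_frob.
  by apply: measurable_funM => //; exact: measurable_frob.
by apply: filterS BE => x /[apply] ->; rewrite frobDr.
Qed.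

Lemma int_frobC p q (A B : X -> 'M[R]_(p, q)) :
  \int[mu]_(x in D) frob (A x) (B x) = \int[mu]_(x in D) frob (B x) (A x).
Proof. by apply: eq_Rintegral => x _; rewrite frobC. Qed.

Lemma int_frob_cauchy_schwarz p q (A B : X -> 'M[R]_(p, q)) : L2mx A -> L2mx B ->
  (\int[mu]_(x in D) frob (A x) (B x)) ^+ 2 <=
  (\int[mu]_(x in D) frob (A x) (A x)) * (\int[mu]_(x in D) frob (B x) (B x)).
Proof.
move=> A2 B2; apply: discriminant_le => t.
pose C x := t *: B x + A x; have C2 : L2mx C by exact: L2mxD.
have lin G : L2mx G -> \int[mu]_(x in D) frob (G x) (C x) =
    t * (\int[mu]_(x in D) frob (G x) (B x)) + \int[mu]_(x in D) frob (G x) (A x).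
  by move=> G2; apply: int_frob_linr => //; exact: aeW.
have : 0 <= \int[mu]_(x in D) frob (C x) (C x).
  by apply: Rintegral_ge0 => x _; exact: frob_ge0.
rewrite (lin _ C2) (int_frobC C B) (int_frobC C A) (lin _ B2) (lin _ A2) (int_frobC B A).
move: (\int[mu]_(x in D) frob (A x) (A x)) (\int[mu]_(x in D) frob (A x) (B x))
  (\int[mu]_(x in D) frob (B x) (B x)) => a b c.
by have -> : t * (t * c + b) + (t * b + a) = a + 2 * t * b + t ^+ 2 * c by ring.
Qed.

Lemma grad_sum (I : finType) (c : I -> R) (v : I -> X -> X) :
  (forall k i, H1 D (component (v k) i)) ->
  {ae mu, forall x, D x -> grad D (fun x => \sum_k c k *: v k x) x = \sum_k c k *: grad D (v k) x}.
Proof.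
move=> Hv.
have compE i : component (fun x => \sum_k c k *: v k x) i =
    fun x => \sum_k c k * component (v k) i x.
  apply/funext => x; rewrite /component summxE.
  by apply: eq_bigr => k _; rewrite mxE.
have : {ae mu, forall x, forall ij : 'I_d * 'I_d, D x ->
    grad D (fun x => \sum_k c k *: v k x) x ij.1 ij.2 =
    \sum_k c k * grad D (v k) x ij.1 ij.2}.
  apply: filter_forall => -[i j].
  have := wpartial_sum oD j (index_enum I) c (fun k => Hv k i).
  rewrite -compE; apply: filterS => x /[apply]; rewrite mxE /= => ->.
  by apply: eq_bigr => k _; rewrite mxE.
apply: filterS => x gE Dx; apply/matrixP => i j.
rewrite (gE (i, j) Dx) summxE; apply: eq_bigr => k _.
by rewrite [RHS]mxE.
Qed.

Lemma grad_lin a (u v : X -> X) : (forall i, H1 D (component u i)) ->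
  (forall i, H1 D (component v i)) ->
  {ae mu, forall x, D x -> grad D (fun x => a *: u x + v x) x = a *: grad D u x + grad D v x}.
Proof.
move=> Hu Hv.
have := @grad_sum bool (fun b => if b then a else 1) (fun b => if b then u else v) _.
rewrite (_ : (fun x => \sum_k _) = (fun x => a *: u x + v x)); last first.
  by apply/funext => x; rewrite big_bool/= scale1r.
move=> /(_ _)/wrap[|]; first by case.
by apply: filterS => x /[apply] ->; rewrite big_bool/= scale1r.
Qed.

Lemma wdiv_lin_ae (u v w : X -> X) a :
  {ae mu, forall x, D x -> grad D w x = a *: grad D u x + grad D v x} ->
  {ae mu, forall x, D x -> wdiv D w x = a * wdiv D u x + wdiv D v x}.
Proof. by apply: filterS => x /[apply]; rewrite /wdiv => ->; rewrite mxtraceD mxtraceZ. Qed.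

End SpatialProducts.

(** * Discrete Riesz representatives of the divergence functional *)

Section DivergenceRepresentative.
Context {R : realType} {d n : nat}.
Variable D : set 'rV[R]_d.
Hypothesis oD : open D.
Local Notation X := 'rV[R]_d.
Local Notation mu := (leb d).
Local Notation L2 := (L2fun mu D).
Let mD : measurable D := measurable_open oD.
Variable Phi : 'I_n -> X -> R^o.
Local Notation V := (span_of Phi).
Hypothesis VH1 : forall v, V v -> H1 D v.

Lemma vec_subspace : subspace (vec V : set (X -> X)).
Proof. by rewrite vec_span_of; exact: span_of_subspace. Qed.

Lemma L2mx_grad v : vec V v -> L2mx D (grad D v).
Proof. by move=> Vv; apply: L2_grad => i; exact/VH1/Vv. Qed.

Lemma L2_wdiv v : vec V v -> L2 (wdiv D v).
Proof. by move=> Vv; apply: L2fun_sum => // i; exact: L2mx_grad. Qed.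

Lemma grad_vec_lin a u v : vec V u -> vec V v ->
  {ae mu, forall x, D x -> grad D (a *: u + v) x = a *: grad D u x + grad D v x}.
Proof. by move=> Vu Vv; apply: grad_lin => // i; apply: VH1; [exact: Vu|exact: Vv]. Qed.

Lemma int_wdiv_lin q a u v : L2 q -> vec V u -> vec V v ->
  \int[mu]_(x in D) (q x * wdiv D (a *: u + v) x) =
  a * (\int[mu]_(x in D) (q x * wdiv D u x)) + \int[mu]_(x in D) (q x * wdiv D v x).
Proof.
move=> q2 Vu Vv; have Vw : vec V (a *: u + v) by have [_] := vec_subspace; exact.
have iu := L2fun_intM mD q2 (L2_wdiv Vu); have iv := L2fun_intM mD q2 (L2_wdiv Vv).
rewrite -RintegralZl// -RintegralD//; last exact: integrableZR.
have [mq _] := q2; have [mu' _] := L2_wdiv Vu; have [mv _] := L2_wdiv Vv; have [mw _] := L2_wdiv Vw.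
apply: ae_Rintegral => //.
- exact: measurable_funM.
- apply: measurable_funD; last exact: measurable_funM.
  by apply: measurable_funM => //; exact: measurable_funM.
apply: filterS (wdiv_lin_ae (grad_vec_lin a Vu Vv)) => x /[apply] ->.
by rewrite mulrDr mulrCA.
Qed.

(** The gradient product may be degenerate on representatives, but a field of zero Dirichlet energy
    has zero gradient, hence zero divergence, almost everywhere. The functional w -> (q, div w) is
    thus compatible with the kernel. *)
Lemma div_representative q : L2 q -> exists2 v, vec V v & forall w, vec V w ->
  \int[mu]_(x in D) frob (grad D v x) (grad D w x) = \int[mu]_(x in D) (q x * wdiv D w x).
Proof.
move=> q2.
have := @symmetric_form_solve R _ _ (fun ik : 'I_d * 'I_n =>
    (fun x => Phi ik.2 x *: delta_mx ord0 ik.1) : X -> X)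
  (fun v w => \int[mu]_(x in D) frob (grad D v x) (grad D w x))
  (fun w => \int[mu]_(x in D) (q x * wdiv D w x)).
rewrite -vec_span_of; apply.
- by move=> v w _ _; exact: int_frobC.
- move=> v Vv a u w Vu Vw; apply: int_frob_linr => //; try exact: L2mx_grad.
    by apply: L2mx_grad; have [_] := vec_subspace; exact.
  exact: grad_vec_lin.
- by move=> a u w Vu Vw; exact: int_wdiv_lin.
move=> v Vv /(_ v Vv) v0.
have g2 := L2mx_grad Vv; have ig := integrable_frob oD g2 g2.
have := Rintegral_eq0_ae mD ig (fun x _ => frob_ge0 _) v0.
move=> g0; have [mq _] := q2; have [mv _] := L2_wdiv Vv.
transitivity (\int[mu]_(x in D) (0 : R)); last by rewrite Rintegral_cst// mul0r.
apply: ae_Rintegral => //; first exact: measurable_funM.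
by apply: filterS g0 => x /[apply] /frob_eq0; rewrite /wdiv => ->; rewrite mxtrace0 mulr0.
Qed.

(** By the representation each inf-sup quotient is (grad v, grad w) / |grad w|, so Cauchy-Schwarz
    bounds the supremum by |grad v|. *)
Lemma infsup_representative W gamma q v : 0 < gamma -> infsup D V W gamma -> W q -> L2 q ->
  vec V v -> (forall w, vec V w ->
    \int[mu]_(x in D) frob (grad D v x) (grad D w x) = \int[mu]_(x in D) (q x * wdiv D w x)) ->
  gamma ^+ 2 * (\int[mu]_(x in D) (q x * q x)) <=
  \int[mu]_(x in D) frob (grad D v x) (grad D v x).
Proof.
move=> g0 his Wq q2 Vv vE.
set N := \int[mu]_(x in D) frob (grad D v x) (grad D v x).
have N0 : 0 <= N by apply: Rintegral_ge0 => x _; exact: frob_ge0.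
have : ((gamma * snormL2 D q)%:E <= (Num.sqrt N)%:E)%E.
  apply: le_trans (his _ Wq) _; apply: ge_ereal_sup => _ [w [Vw _] <-].
  rewrite lee_fin -vE//.
  set nw := normL2 D (grad D w).
  have nw0 : 0 <= nw by exact: sqrtr_ge0.
  (* A field with zero gradient norm contributes the quotient 0, because 0^-1 = 0. *)
  have [->|nwn0] := eqVneq nw 0; first by rewrite invr0 mulr0 sqrtr_ge0.
  rewrite ler_pdivrMr; last by rewrite lt_def nwn0.
  have CS := int_frob_cauchy_schwarz oD (L2mx_grad Vv) (L2mx_grad Vw).
  have nwE : nw ^+ 2 = \int[mu]_(x in D) frob (grad D w x) (grad D w x).
    by apply: sqr_sqrtr; apply: Rintegral_ge0 => x _; exact: frob_ge0.
  by rewrite -nwE in CS; exact: le_sqrt_mul.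
rewrite lee_fin => H.
have q0 : 0 <= \int[mu]_(x in D) (q x ^+ 2).
  by apply: Rintegral_ge0 => x _; exact: sqr_ge0.
exact: (le_mul_sqrt (ltW g0) q0 N0 H).
Qed.

End DivergenceRepresentative.

(** * Galerkin spaces *)

Section GalerkinFields.
Context {R : realType} {d M nV nW nS : nat}.
Variable D : set 'rV[R]_d.
Hypothesis oD : open D.
Local Notation X := 'rV[R]_d.
Local Notation Y := 'rV[R]_M.
Local Notation mu := (leb d).
Local Notation P := (leb d \x upi M)%E.
Local Notation DG := (D `*` Gamma M).
Let mD : measurable D := measurable_open oD.
Let mG := @measurable_Gamma R M.
Let mDG : measurable DG := measurableX mD mG.
Variables (PhiV : 'I_nV -> X -> R^o) (PhiW : 'I_nW -> X -> R^o).
Variable Psi : 'I_nS -> Y -> R^o.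
Local Notation V := (span_of PhiV).
Local Notation W := (span_of PhiW).
Local Notation S := (span_of Psi).
Hypothesis VH1 : forall v, V v -> H1 D v.
Hypothesis WL2 : forall q, W q -> L2fun mu D q.
Hypothesis Sb : forall s, S s -> bounded_param s.
Local Notation VL := (tensor (vec V) S).
Local Notation WL := (tensor W S).
Local Notation ip1 := (ip D (cst 1)).

Lemma VL_span_of : exists (I : finType) (Phi : I -> X * Y -> X), VL = span_of Phi.
Proof. by rewrite vec_span_of tensor_span_of; eexists; eexists; reflexivity. Qed.

Lemma WL_span_of : exists (I : finType) (Phi : I -> X * Y -> R^o), WL = span_of Phi.
Proof. by rewrite tensor_span_of; eexists; eexists; reflexivity. Qed.

Lemma VL_subspace : subspace (VL : set (X * Y -> X)).
Proof. by have [I [Phi ->]] := VL_span_of; exact: span_of_subspace. Qed.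

Lemma WL_subspace : subspace (WL : set (X * Y -> R^o)).
Proof. by have [I [Phi ->]] := WL_span_of; exact: span_of_subspace. Qed.

Lemma slice_vec u y : VL u -> vec V (slice u y).
Proof.
move=> /(tensor_rep (span_of_subspace Psi))[n [s [v [_ Vv ->]]]].
have := subspace_sum (fun k => s k y) (vec_subspace PhiV) Vv.
by rewrite fct_sumE.
Qed.

Lemma slice_W q y : WL q -> W (slice q y).
Proof.
move=> /(tensor_rep (span_of_subspace Psi))[n [s [v [_ Vv ->]]]].
have := subspace_sum (fun k => s k y) (span_of_subspace PhiW) Vv.
by rewrite fct_sumE.
Qed.

Lemma L2_tensor_sum n (s : 'I_n -> Y -> R^o) (g : 'I_n -> X -> R) :
  (forall k, S (s k)) -> (forall k, L2fun mu D (g k)) ->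
  L2fun P DG (fun z => \sum_k s k z.2 * g k z.1).
Proof.
move=> Ss g2; apply: L2fun_sum => // k.
have [ms [C sC]] := Sb (Ss k); exact: J2_tensor (g2 k) ms sC.
Qed.

Lemma L2_VL u i : VL u -> L2fun P DG (fun z => u z ord0 i).
Proof.
move=> /(tensor_rep (span_of_subspace Psi))[n [s [v [Ss Vv ->]]]].
have := @L2_tensor_sum n s (fun k => component (v k) i) Ss (fun k => (VH1 (Vv k i)).1).
rewrite (_ : (fun z => \sum_k s k z.2 * _) =
  (fun z => (\sum_k s k z.2 *: v k z.1) ord0 i))//.
by apply/funext => z; rewrite summxE; apply: eq_bigr => k _; rewrite mxE.
Qed.

Lemma L2_WL q : WL q -> L2fun P DG q.
Proof.
move=> /(tensor_rep (span_of_subspace Psi))[n [s [v [Ss Vv ->]]]].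
exact: (@L2_tensor_sum n s v Ss (fun k => WL2 (Vv k))).
Qed.

Lemma J2_joint (g : X * Y -> R) : L2fun P DG g -> J2 D g.
Proof. by move=> g2; exists g => //; apply: sections_eq_refl => //; have [] := g2. Qed.

Definition scalar_field (q : X * Y -> R) (z : X * Y) : 'M[R]_1 := const_mx (q z).
Local Notation sc := scalar_field.

Lemma frob_scalar (a b : R) : frob (const_mx a : 'M[R]_1) (const_mx b) = a * b.
Proof. by rewrite /frob !big_ord1 !mxE. Qed.

Lemma JM_scalar q : J2 D q -> JM D (sc q).
Proof. by move=> Jq i j; under eq_fun do rewrite mxE. Qed.

Lemma JM_W q : WL q -> JM D (sc q).
Proof. by move=> Wq; apply: JM_scalar; apply: J2_joint; exact: L2_WL. Qed.

Lemma JM_V u : VL u -> JM D (u : X * Y -> 'M[R]_(1, d)).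
Proof. by move=> Vu i j; rewrite ord1; apply: J2_joint; exact: L2_VL. Qed.

(** For u = sum_k s_k(y) v_k(x), the field sum_k s_k(y) grad v_k(x) is jointly measurable, the weak
    gradients of the finitely many v_k being chosen once; each slice of [xgrad] agrees with it
    almost everywhere. *)
Lemma JM_grad u : VL u -> JM D (xgrad D u).
Proof.
move=> Vu i j; have [n [s [v [Ss Vv uE]]]] := tensor_rep (span_of_subspace Psi) Vu.
exists (fun z => \sum_k s k z.2 * grad D (v k) z.1 i j).
  exact: (@L2_tensor_sum n s (fun k x => grad D (v k) x i j) Ss (fun k => L2mx_grad VH1 (Vv k) i j)).
move=> y Gy; split; first by have [] := L2mx_grad VH1 (slice_vec y Vu) i j.
have := grad_sum oD (fun k => s k y) (fun k i => VH1 (Vv k i)).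
rewrite /xgrad uE; apply: filterS => x /[apply] /= H.
rewrite /slice/= H summxE; apply: eq_bigr => k _.
by rewrite mxE.
Qed.

Lemma J2_strain_div u : VL u -> JM D (xstrain D u) /\ J2 D (xdiv D u).
Proof.
move=> Vu; have Jg := JM_grad Vu; split.
  move=> i j; have := J2Z mD 2^-1 (J2D mD (Jg i j) (Jg j i)).
  rewrite (_ : (fun z => 2^-1 * _) = (fun z => xstrain D u z i j))//.
  by apply/funext => z; rewrite !mxE.
exact: (J2_sum mD _ (fun i => Jg i i)).
Qed.

Lemma JM_strain u : VL u -> JM D (xstrain D u).
Proof. by move=> /J2_strain_div[]. Qed.

Lemma JM_div u : VL u -> JM D (sc (xdiv D u)).
Proof. by move=> /J2_strain_div[_]; exact: JM_scalar. Qed.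

Lemma xgrad_lin a u v y : VL u -> VL v ->
  {ae mu, forall x, D x ->
    xgrad D (a *: u + v) (x, y) = a *: xgrad D u (x, y) + xgrad D v (x, y)}.
Proof. by move=> Vu Vv; exact: (grad_vec_lin oD VH1 a (slice_vec y Vu) (slice_vec y Vv)). Qed.

Lemma xstrain_lin a u v y : VL u -> VL v ->
  {ae mu, forall x, D x ->
    xstrain D (a *: u + v) (x, y) = a *: xstrain D u (x, y) + xstrain D v (x, y)}.
Proof.
move=> Vu Vv; apply: filterS (xgrad_lin a y Vu Vv) => x /[apply].
rewrite /xgrad/= /xstrain/= /strain => ->.
move: (grad D (slice u y) x) (grad D (slice v y) x) => A B.
by apply/matrixP => i j; rewrite !mxE; ring.
Qed.

Lemma xdiv_lin a u v y : VL u -> VL v ->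
  {ae mu, forall x, D x ->
    sc (xdiv D (a *: u + v)) (x, y) = a *: sc (xdiv D u) (x, y) + sc (xdiv D v) (x, y)}.
Proof.
move=> Vu Vv.
have := wdiv_lin_ae (grad_vec_lin oD VH1 a (slice_vec y Vu) (slice_vec y Vv)).
apply: filterS => x /[apply] H; apply/matrixP => i j.
by rewrite [LHS]mxE [RHS]mxE [X in _ = X + _]mxE [X in _ = _ * X + _]mxE [X in _ = _ + X]mxE; exact: H.
Qed.

Lemma cst1_Linfun : Linfun P DG (cst 1).
Proof.
by split; [exact: measurable_cst|exists 1; apply: aeW => z _; rewrite normr1].
Qed.

Lemma cst1_bounds : {ae P, forall z, DG z -> 1 <= (cst 1 : X * Y -> R) z <= 1}.
Proof. by apply: aeW => z _; rewrite lexx. Qed.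

Lemma ip1E p q (A B : X * Y -> 'M[R]_(p, q)) : ip1 A B = dint D (fun z => frob (A z) (B z)).
Proof. by rewrite /ip; under eq_fun do rewrite mul1r. Qed.

Lemma ip1_ge0 p q (A : X * Y -> 'M[R]_(p, q)) : 0 <= ip1 A A.
Proof. by rewrite ip1E; apply: dint_ge0 => z; exact: frob_ge0. Qed.

Lemma frob_dintable p q (A B : X * Y -> 'M[R]_(p, q)) : JM D A -> JM D B ->
  dintable D (fun z => frob (A z) (B z)).
Proof.
move=> JA JB; have := ip_dintable mD cst1_Linfun JA JB.
by under eq_fun do rewrite mul1r.
Qed.

Lemma ip1_le p q p' q' c (A : X * Y -> 'M[R]_(p, q)) (B : X * Y -> 'M[R]_(p', q')) :
  JM D A -> JM D B ->
  (forall y, Gamma M y -> \int[mu]_(x in D) (c * frob (A (x, y)) (A (x, y))) <=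
    \int[mu]_(x in D) frob (B (x, y)) (B (x, y))) ->
  c * ip1 A A <= ip1 B B.
Proof.
move=> JA JB AB; rewrite !ip1E -dintZ//; last exact: frob_dintable.
by apply: dint_le => //; [apply: dintableZ => //|]; exact: frob_dintable.
Qed.

Lemma xstrain_le_xgrad u : VL u ->
  ip1 (xstrain D u) (xstrain D u) <= ip1 (xgrad D u) (xgrad D u).
Proof.
move=> Vu; rewrite -[leLHS]mul1r; apply: ip1_le; [exact: JM_strain|exact: JM_grad|].
move=> y Gy; have Vuy := slice_vec y Vu.
have ig := integrable_frob oD (L2mx_grad VH1 Vuy) (L2mx_grad VH1 Vuy).
have is_ := integrable_frob oD (L2_strain oD (fun i => VH1 (Vuy i))) (L2_strain oD (fun i => VH1 (Vuy i))).
apply: le_Rintegral => //; first exact: integrableZR.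
move=> x Dx; rewrite mul1r /xstrain /xgrad/= /strain; move: (grad _ _ _) => A.
have -> : frob A A = \sum_i \sum_j (2^-1 * (A i j ^+ 2) + 2^-1 * (A j i ^+ 2)).
  under [RHS]eq_bigr do rewrite big_split/=.
  rewrite big_split/= [X in _ + X]exchange_big/= -big_split/=.
  apply: eq_bigr => i _; rewrite -big_split/=; apply: eq_bigr => j _; by field.
apply: ler_sum => i _; apply: ler_sum => j _; rewrite !mxE.
move: (A i j) (A j i) => a b; have := sqr_ge0 (a - b); nra.
Qed.

Section CoercivityAndPoincare.
Variables (r CK : R) (m : nat) (F : nat -> facet R d) (dD : set X).
Hypothesis Dr : forall x, D x -> forall i, `|x ord0 i| <= r.
Hypothesis hK : korn D m F dD CK.
Hypothesis VE : forall v, V v -> H1E0 D m F dD v.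
Hypothesis CK0 : 0 < CK.
Hypothesis r0 : 0 < r.
Hypothesis d1 : (1 < d)%N.

Lemma poincare_cst_gt0 : 0 < poincare_cst (d := d) r CK.
Proof.
rewrite /poincare_cst mulr_gt0//; first by rewrite mulr_gt0// exprn_gt0.
by rewrite ltr_pwDl// divr_ge0// ltW.
Qed.

Lemma korn_ip u : VL u ->
  CK * ip1 (xgrad D u) (xgrad D u) <= ip1 (xstrain D u) (xstrain D u).
Proof.
move=> Vu; apply: ip1_le; [exact: JM_grad|exact: JM_strain|].
move=> y Gy; have Vuy := slice_vec y Vu.
have ig := integrable_frob oD (L2mx_grad VH1 Vuy) (L2mx_grad VH1 Vuy).
have := hK (fun i => VE (Vuy i)).
by rewrite -(@RintegralZl _ _ _ mu D _ CK mD ig); exact.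
Qed.

Lemma poincare_ip u : VL u ->
  ip1 (u : X * Y -> 'M[R]_(1, d)) u <= poincare_cst (d := d) r CK * ip1 (xgrad D u) (xgrad D u).
Proof.
move=> Vu; have C0 : 0 < poincare_cst (d := d) r CK.
  exact: poincare_cst_gt0.
rewrite -ler_pdivrMl//; apply: ip1_le; [exact: JM_V|exact: JM_grad|].
move=> y Gy; have Vuy := slice_vec y Vu.
have Lu : L2mx D (slice u y : X -> 'M[R]_(1, d)).
  by move=> i j; rewrite ord1; exact: (VH1 (Vuy j)).1.
have iv := integrable_frob oD Lu Lu.
rewrite (@RintegralZl _ _ _ mu D _ _ mD iv) ler_pdivrMl//.
exact: (poincare_vec oD Dr hK d1 CK0 (fun i => VE (Vuy i))).
Qed.

End CoercivityAndPoincare.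

Lemma infsup_ip gamma p : 0 < gamma -> infsup D V W gamma -> WL p ->
  exists2 v, VL v & gamma ^+ 2 * ip1 (sc p) (sc p) <= ip1 (xgrad D v) (xgrad D v) /\
    ip1 (sc p) (sc (xdiv D v)) = ip1 (xgrad D v) (xgrad D v).
Proof.
move=> g0 his Wp; have [n [s [q [Ss Wq pE]]]] := tensor_rep (span_of_subspace Psi) Wp.
have /choice[v vE] k : exists v, vec V v /\ forall w, vec V w ->
    \int[mu]_(x in D) frob (grad D v x) (grad D w x) = \int[mu]_(x in D) (q k x * wdiv D w x).
  by have [v Vv vq] := div_representative oD VH1 (WL2 (Wq k)); exists v.
pose u (z : X * Y) : X := \sum_k s k z.2 *: v k z.1.
have Vu : VL u.
  rewrite /u -fct_sumE; have := subspace_sum (fun=> 1) VL_subspace.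
  move=> /(_ _ (fun k z => s k z.2 *: v k z.1)); under eq_bigr do rewrite scale1r.
  apply=> k; exists 1%N, (fun=> 1), (fun=> (fun z => s k z.2 *: v k z.1)); split.
    by move=> _; exists (v k), (s k); split => //; have [] := vE k.
  by apply/funext => z; rewrite big_ord1 scale1r.
(* The coefficients s_k(y) are common to p and u, so the liftings of the q_k combine to the lifting
   of the slice of p. *)
have rep y w : vec V w ->
    \int[mu]_(x in D) frob (grad D (slice u y) x) (grad D w x) =
    \int[mu]_(x in D) (slice p y x * wdiv D w x).
  move=> Vw.
  have -> : slice u y = \sum_k s k y *: v k by rewrite fct_sumE.
  have -> : slice p y = \sum_k s k y *: q k by rewrite fct_sumE pE.
  rewrite (linear_on_sum (l := fun v => \int[mu]_(x in D) frob (grad D v x) (grad D w x))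
    _ (vec_subspace PhiV)); last 2 first.
  - move=> a u1 u2 V1 V2 /=; rewrite !(int_frobC D _ (grad D w)).
    apply: int_frob_linr => //; try exact: (L2mx_grad VH1).
      by apply: (L2mx_grad VH1); have [_] := vec_subspace PhiV; exact.
    exact: (grad_vec_lin oD VH1 a V1 V2).
  - by move=> k; have [] := vE k.
  rewrite (linear_on_sum (l := fun q => \int[mu]_(x in D) (q x * wdiv D w x))
    _ (span_of_subspace PhiW)).
  - by apply: eq_bigr => k _; congr (_ * _); have [_] := vE k; exact.
  - move=> a q1 q2 W1 W2; have dw := L2_wdiv oD VH1 Vw.
    have i1 := L2fun_intM mD (WL2 W1) dw; have i2 := L2fun_intM mD (WL2 W2) dw.
    rewrite -(@RintegralZl _ _ _ mu D _ a mD i1) -(@RintegralD _ _ _ mu D _ _ mD _ i2); last exact: integrableZR.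
    by apply: eq_Rintegral => x _; rewrite mulrDl mulrA.
  - by [].
exists u; first exact: Vu.
split.
  apply: ip1_le; [exact: JM_W|exact: JM_grad|move=> y Gy].
  have Wpy := slice_W y Wp; have p2 := WL2 Wpy.
  have -> : \int[mu]_(x in D) (gamma ^+ 2 * frob (sc p (x, y)) (sc p (x, y))) =
      gamma ^+ 2 * \int[mu]_(x in D) (slice p y x * slice p y x).
    rewrite -(@RintegralZl _ _ _ mu D _ (gamma ^+ 2) mD (L2fun_intM mD p2 p2)).
    by apply: eq_Rintegral => x _; rewrite frob_scalar.
  exact: (infsup_representative oD VH1 g0 his Wpy p2 (slice_vec y Vu) (rep y)).
(* Here the representation is tested, in each slice, with the slice of u itself. *)
rewrite !ip1E; apply: eq_Rintegral => y _.
rewrite -[RHS]/(\int[mu]_(x in D) frob (grad D (slice u y) x) (grad D (slice u y) x)).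
rewrite rep; last exact: slice_vec.
by apply: eq_Rintegral => x _; rewrite frob_scalar.
Qed.

End GalerkinFields.

(** * The abstract saddle-point problem *)

Lemma span_of_prod {R : realType} (Z1 Z2 : lmodType R) (I J : finType)
    (Phi : I -> Z1) (Psi : J -> Z2) :
  [set z : Z1 * Z2 | span_of Phi z.1 /\ span_of Psi z.2] =
  span_of (fun k : I + J => match k with inl i => (Phi i, 0) | inr j => (0, Psi j) end).
Proof.
have sum1 (r : seq (I + J)) (f : I + J -> Z1 * Z2) : (\sum_(k <- r) f k).1 = \sum_(k <- r) (f k).1.
  exact: (big_morph fst).
have sum2 (r : seq (I + J)) (f : I + J -> Z1 * Z2) : (\sum_(k <- r) f k).2 = \sum_(k <- r) (f k).2.
  exact: (big_morph snd).
have sc1 (c : I + J -> R) k : (c k *: match k with inl i => (Phi i, 0) | inr j => (0, Psi j) end : Z1 * Z2).1 =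
    match k with inl i => c k *: Phi i | inr _ => 0 end by case: k => i /=; rewrite ?scaler0.
have sc2 (c : I + J -> R) k : (c k *: match k with inl i => (Phi i, 0) | inr j => (0, Psi j) end : Z1 * Z2).2 =
    match k with inr j => c k *: Psi j | inl _ => 0 end by case: k => i /=; rewrite ?scaler0.
apply/seteqP; split => -[x y] /=.
  move=> [[c ->] [c' ->]]; exists (fun k => match k with inl i => c i | inr j => c' j end).
  rewrite [RHS]surjective_pairing sum1 sum2; congr pair.
    by rewrite big_sumType/= [X in _ + X]big1 ?addr0// => j _; rewrite scaler0.
  by rewrite big_sumType/= [X in X + _]big1 ?add0r// => j _; rewrite scaler0.
move=> [c E]; have [-> ->] : x = \sum_i c (inl i) *: Phi i /\ y = \sum_j c (inr j) *: Psi j.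
  have := congr1 fst E; have := congr1 snd E; rewrite /= sum1 sum2 !big_sumType/= => -> ->; split.
    by rewrite [X in _ + X]big1 ?addr0// => j _; rewrite scaler0.
  by rewrite [X in X + _]big1 ?add0r// => j _; rewrite scaler0.
by split; eexists; reflexivity.
Qed.

Section SaddlePoint.
Context {R : realType} {U Q : lmodType R}.
Variables (I J : finType) (Phi : I -> U) (Psi : J -> Q) (VL : set U) (WL : set Q).
Hypotheses (VLE : VL = span_of Phi) (WLE : WL = span_of Psi).
Variables (a : U -> U -> R) (b : U -> Q -> R) (m mE : Q -> Q -> R) (N : U -> R).
Variables (alpha kappa Emin Emax CK gamma : R).
Hypotheses (alpha0 : 0 < alpha) (kappa0 : 0 < kappa) (Emin0 : 0 < Emin)
  (CK0 : 0 < CK) (gamma0 : 0 < gamma).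
Hypothesis a_sym : forall u v, VL u -> VL v -> a u v = a v u.
Hypothesis a_lin : forall u, VL u -> linear_on VL (a u).
Hypothesis b_lin1 : forall q, WL q -> linear_on VL (b^~ q).
Hypothesis b_lin2 : forall u, VL u -> linear_on WL (b u).
Hypothesis m_sym : forall p q, WL p -> WL q -> m p q = m q p.
Hypothesis m_lin : forall p, WL p -> linear_on WL (m p).
Hypothesis mE_sym : forall p q, WL p -> WL q -> mE p q = mE q p.
Hypothesis mE_lin : forall p, WL p -> linear_on WL (mE p).
Hypothesis N0 : forall u, VL u -> 0 <= N u.
Hypothesis m0 : forall p, WL p -> 0 <= m p p.
Hypothesis a_coercive : forall u, VL u -> Emin * CK * N u <= a u u.
Hypothesis a_bounded : forall u v, VL u -> VL v -> a u v ^+ 2 <= Emax ^+ 2 * (N u * N v).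
Hypothesis mE_ge : forall p, WL p -> Emin * m p p <= mE p p.
Hypothesis mE_le : forall p, WL p -> mE p p <= Emax * m p p.
Hypothesis mE_cs : forall p q, WL p -> WL q -> mE p q ^+ 2 <= mE p p * mE q q.
Hypothesis b_infsup : forall p, WL p -> exists2 v, VL v & gamma ^+ 2 * m p p <= N v /\ b v p = N v.

(** [kappa] stands for (alpha beta)^-1, and [b] for the coupling (q, div u), opposite in sign to
    [bform]; hence the minus signs. *)
Definition saddle_solution (f : U -> R) (u : U) (p pt : Q) :=
  [/\ [/\ VL u, WL p & WL pt],
      forall v, VL v -> alpha * a u v - b v p = f v,
      forall q, WL q -> - b u q - kappa * m pt q = 0 &
      forall q, WL q -> - (kappa * m p q) + kappa * mE pt q = 0].

(** With g = CK^-1, the four terms bound in turn alpha |grad u|^2 by g^2, kappa |pt|^2 by g, kappa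
    |p|^2 by Emax^2 g and alpha^-1 |p|^2 by the inf-sup term, all in units of phi / (Emin^2
    alpha). *)
Definition saddle_cst : R :=
  CK^-1 ^+ 2 + CK^-1 + Emax ^+ 2 * CK^-1 + 2 * Emax ^+ 2 * (1 + CK^-1 ^+ 2) / gamma ^+ 2.

(* Here u, q, t, v are the squared norms of the displacement, the two pressures
   and an inf-sup lifting of the first pressure, fu is the load of the
   displacement, and phi is the squared dual norm of the load. *)
Lemma energy_arith (u q t v fu phi : R) :
  0 <= u -> 0 <= q -> 0 <= t -> 0 <= v -> 0 <= phi ->
  alpha * (Emin * CK * u) + kappa * (Emin * t) <= fu -> fu ^+ 2 <= phi * u ->
  q ^+ 2 <= Emax ^+ 2 * (t * q) -> Emin * q <= Emax * q ->
  gamma ^+ 2 * q <= v -> v ^+ 2 <= 2 * (alpha ^+ 2 * (Emax ^+ 2 * (u * v)) + phi * v) ->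
  alpha * u + (alpha^-1 + kappa) * q + kappa * t <= saddle_cst / (Emin ^+ 2 * alpha) * phi.
Proof.
move=> u0 q0 t0 v0 phi0 Hfu fu2 Hq HqE Hv v2.
pose s := alpha * Emin * CK; have s0 : 0 < s by rewrite !mulr_gt0.
have fu0 : 0 <= fu by apply: le_trans Hfu; rewrite addr_ge0 ?mulr_ge0// ltW.
have kt0 : 0 <= kappa * (Emin * t) by rewrite !mulr_ge0// ltW.
have su : s * u <= fu by apply: le_trans Hfu; rewrite /s; lra.
(* Coercivity gives s u <= fu, and fu^2 <= phi u; squaring the former and dividing by u yields s^2 u
   <= phi. *)
have s2u : s ^+ 2 * u <= phi.
  have [->|un0] := eqVneq u 0; first by rewrite mulr0.
  have u_gt0 : 0 < u by rewrite lt_def un0.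
  rewrite -(ler_pM2r u_gt0); apply: le_trans fu2; rewrite -mulrA -expr2 -exprMn.
  by rewrite ler_pXn2r ?nnegrE// mulr_ge0// ltW.
have fus : s * fu <= phi.
  have sfu0 : 0 <= s * fu by rewrite mulr_ge0// ltW.
  rewrite -(@ler_pXn2r _ 2)// exprMn; apply: (@le_trans _ _ (s ^+ 2 * (phi * u))); first by rewrite ler_wpM2l ?sqr_ge0.
  by rewrite mulrCA expr2 ler_wpM2l.
pose g := CK^-1; have g0 : 0 < g by rewrite invr_gt0.
have gCK : g * CK = 1 by rewrite mulVf// gt_eqF.
(* The common unit of all four estimates. *)
pose X := phi / (Emin ^+ 2 * alpha).
have E2a : 0 < Emin ^+ 2 * alpha by rewrite mulr_gt0// exprn_gt0.
have X0 : 0 <= X by rewrite divr_ge0// ltW.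
have phiE : phi = X * (Emin ^+ 2 * alpha) by rewrite divfK// gt_eqF.
have au : alpha * u <= g ^+ 2 * X.
  rewrite /X mulrA ler_pdivlMr//.
  have -> : alpha * u * (Emin ^+ 2 * alpha) = g ^+ 2 * (s ^+ 2 * u).
    have -> : g ^+ 2 * (s ^+ 2 * u) = (g * CK) ^+ 2 * (alpha * u * (Emin ^+ 2 * alpha)).
      by rewrite /s; ring.
    by rewrite gCK expr1n mul1r.
  by rewrite ler_wpM2l ?sqr_ge0.
have kt : kappa * t <= g * X.
  rewrite /X mulrA ler_pdivlMr//.
  have -> : kappa * t * (Emin ^+ 2 * alpha) = g * (s * (kappa * (Emin * t))).
    have -> : g * (s * (kappa * (Emin * t))) = (g * CK) * (kappa * t * (Emin ^+ 2 * alpha)).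
      by rewrite /s; ring.
    by rewrite gCK mul1r.
  rewrite ler_wpM2l ?(ltW g0)//; apply: le_trans fus; rewrite ler_wpM2l ?(ltW s0)//.
  by apply: le_trans Hfu; rewrite lerDr !mulr_ge0// ltW.
have qt : q <= Emax ^+ 2 * t.
  have [->|qn0] := eqVneq q 0; first by rewrite mulr_ge0 ?sqr_ge0.
  by rewrite -(@ler_pM2r _ q) ?lt_def ?qn0// -expr2 -mulrA.
have kq : kappa * q <= Emax ^+ 2 * g * X.
  apply: (@le_trans _ _ (Emax ^+ 2 * (kappa * t))).
    by rewrite mulrCA ler_wpM2l// ltW.
  by rewrite -mulrA ler_wpM2l ?sqr_ge0.
have vle : v <= 2 * (alpha ^+ 2 * Emax ^+ 2 * u + phi).
  have [->|vn0] := eqVneq v 0.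
    by rewrite mulr_ge0// addr_ge0// mulr_ge0// mulr_ge0// sqr_ge0.
  rewrite -(@ler_pM2r _ v) ?lt_def ?vn0// -expr2; apply: le_trans v2 _.
  by rewrite le_eqVlt; apply/orP; left; apply/eqP; ring.
have aq : alpha^-1 * q <= 2 * Emax ^+ 2 * (1 + g ^+ 2) / gamma ^+ 2 * X.
  have [->|qn0] := eqVneq q 0.
    have := sqr_ge0 g => g2; rewrite mulr0 mulr_ge0// divr_ge0 ?sqr_ge0//.
    by rewrite mulr_ge0 ?addr_ge0// mulr_ge0// sqr_ge0.
  have q_gt0 : 0 < q by rewrite lt_def qn0.
  (* The two constants are compared only through the masses, so Emin <= Emax is read off from a
     nonzero pressure. It turns phi = X Emin^2 alpha into at most X Emax^2 alpha. *)
  have EE : Emin <= Emax by rewrite -(ler_pM2r q_gt0).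
  have EE2 : Emin ^+ 2 <= Emax ^+ 2.
    by rewrite ler_pXn2r ?nnegrE// ltW// (lt_le_trans Emin0).
  rewrite ler_pdivrMl// (mulrAC (2 * Emax ^+ 2 * (1 + g ^+ 2))) mulrA.
  rewrite ler_pdivlMr ?exprn_gt0//.
  have gq : gamma ^+ 2 * q <= 2 * (alpha * Emax ^+ 2 * (g ^+ 2 * X) + Emax ^+ 2 * alpha * X).
    apply: le_trans Hv _; apply: le_trans vle _; rewrite ler_pM2l//.
    apply: lerD.
      have -> : alpha ^+ 2 * Emax ^+ 2 * u = alpha * Emax ^+ 2 * (alpha * u) by ring.
      by rewrite ler_wpM2l// mulr_ge0 ?sqr_ge0// ltW.
    rewrite phiE mulrC ler_wpM2r// ler_wpM2r// ltW//.
  rewrite mulrC; apply: le_trans gq _.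
  by rewrite le_eqVlt; apply/orP; left; apply/eqP; ring.
have -> : saddle_cst / (Emin ^+ 2 * alpha) * phi = saddle_cst * X by rewrite /X mulrAC mulrA.
rewrite /saddle_cst -/g !mulrDl; lra.
Qed.

(** Divided by kappa, the third equation reads [mE pt q = m p q]. Hence m(p, p) = mE(pt, p), and
    Cauchy-Schwarz for [mE] compares p with pt without any factor of kappa. *)
Lemma saddle_energy f phi u p pt : 0 <= phi ->
  (forall v, VL v -> f v ^+ 2 <= phi * N v) -> saddle_solution f u p pt ->
  alpha * N u + (alpha^-1 + kappa) * m p p + kappa * m pt pt <=
  saddle_cst / (Emin ^+ 2 * alpha) * phi.
Proof.
move=> phi0 fphi [[Vu Wp Wpt] e1 e2 e3].
have e3' q : WL q -> mE pt q = m p q.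
  move=> Wq; apply: (mulfI (lt0r_neq0 kappa0)).
  by apply/eqP; rewrite -subr_eq0 addrC e3.
have [v Vv [gv bv]] := b_infsup Wp.
have E1 : alpha * a u u + kappa * mE pt pt = f u.
  have <- := e1 u Vu; have := e2 p Wp; rewrite (m_sym Wpt Wp) -(e3' _ Wpt) => /eqP.
  by rewrite subr_eq0 => /eqP <-.
have E2 : N v = alpha * a u v - f v.
  by rewrite -bv -(e1 v Vv) opprB addrC subrK.
apply: (@energy_arith _ _ _ (N v) (f u)) => //; try by [exact: N0|exact: m0|exact: fphi|exact: mE_ge].
- rewrite -E1; apply: lerD; first by rewrite ler_wpM2l ?(ltW alpha0)// a_coercive.
  by rewrite ler_wpM2l ?(ltW kappa0)// mE_ge.
- have := mE_cs Wpt Wp; rewrite (e3' p Wp) => H; apply: le_trans H _.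
  have E0p : 0 <= mE p p by apply: le_trans (mE_ge Wp); rewrite mulr_ge0 ?m0// ltW.
  have E0t : 0 <= mE pt pt by apply: le_trans (mE_ge Wpt); rewrite mulr_ge0 ?m0// ltW.
  rewrite expr2 (_ : _ * _ * (_ * _) = (Emax * m pt pt) * (Emax * m p p)); last by ring.
  by rewrite ler_pM// mE_le.
- exact: le_trans (mE_ge Wp) (mE_le Wp).
- rewrite {1}E2; have := a_bounded Vu Vv; have := fphi v Vv.
  move: (a u v) (f v) => x y Hy Hx; have : alpha ^+ 2 * x ^+ 2 <= alpha ^+ 2 * (Emax ^+ 2 * (N u * N v)).
    by rewrite ler_wpM2l ?sqr_ge0.
  (* Gives (alpha x - y)^2 <= 2 alpha^2 x^2 + 2 y^2, the origin of the factor 2 in the inf-sup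
     term. *)
  have := sqr_ge0 (alpha * x + y); move: (phi * _) (alpha ^+ 2 * (_ * _)) Hy => A B; nra.
Qed.

Lemma saddle_solutionB f u p pt u' p' pt' :
  saddle_solution f u p pt -> saddle_solution f u' p' pt' ->
  saddle_solution (fun=> 0) (u - u') (p - p') (pt - pt').
Proof.
have sV : subspace VL by rewrite VLE; exact: span_of_subspace.
have sW : subspace WL by rewrite WLE; exact: span_of_subspace.
move=> [[Vu Wp Wpt] e1 e2 e3] [[Vu' Wp' Wpt'] e1' e2' e3'].
have VB : VL (u - u') by exact: subspaceB.
have WB : WL (p - p') by exact: subspaceB.
have WBt : WL (pt - pt') by exact: subspaceB.
have BE (Z : lmodType R) (x y : Z) : x - y = -1 *: y + x by rewrite scaleN1r addrC.
split => //.
- move=> v Vv; have := e1 v Vv; have := e1' v Vv.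
  rewrite (a_sym VB Vv) {1}BE (a_lin Vv)// (BE _ p) (b_lin2 Vv)// (a_sym Vv Vu') (a_sym Vv Vu).
  move: (f v) => F <- /eqP; rewrite -subr_eq0 => /eqP H; lra.
- move=> q Wq; have := e2 q Wq; have := e2' q Wq.
  rewrite (m_sym WBt Wq) (BE _ u) (b_lin1 Wq)// (BE _ pt) (m_lin Wq)// (m_sym Wq Wpt') (m_sym Wq Wpt).
  lra.
- move=> q Wq; have := e3 q Wq; have := e3' q Wq.
  rewrite (m_sym WB Wq) (mE_sym WBt Wq) (BE _ p) (m_lin Wq)// (BE _ pt) (mE_lin Wq)//.
  rewrite (m_sym Wq Wp') (m_sym Wq Wp) (mE_sym Wq Wpt') (mE_sym Wq Wpt).
  lra.
Qed.

Lemma linear_on0 (Z : lmodType R) (S : set Z) (l : Z -> R) : subspace S -> linear_on S l -> l 0 = 0.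
Proof.
move=> [S0 _] /(_ 1 0 0 S0 S0)/eqP.
by rewrite scale1r addr0 mul1r eq_sym -subr_eq0 addrK => /eqP.
Qed.

(** The three equations form one symmetric system on U x (Q x Q). For an element of its kernel the
    energy estimate with phi = 0 gives N u = 0, and the bound on f by N then gives f u = 0, the
    required compatibility. *)
Lemma saddle_exists f phi : 0 <= phi -> linear_on VL f ->
  (forall v, VL v -> f v ^+ 2 <= phi * N v) ->
  exists u p pt, saddle_solution f u p pt.
Proof.
move=> phi0 f_lin fphi.
have sV : subspace VL by rewrite VLE; exact: span_of_subspace.
have sW : subspace WL by rewrite WLE; exact: span_of_subspace.
have [V0 _] := sV; have [W0 _] := sW.
pose K (z z' : U * (Q * Q)) := alpha * a z.1 z'.1 - b z'.1 z.2.1 - b z.1 z'.2.1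
  - kappa * m z.2.2 z'.2.1 - kappa * m z.2.1 z'.2.2 + kappa * mE z.2.2 z'.2.2.
pose l (z : U * (Q * Q)) := f z.1.
pose S := [set z : U * (Q * Q) | VL z.1 /\ [set w : Q * Q | WL w.1 /\ WL w.2] z.2].
(* Test triples with a single nonzero component separate the three equations. *)
have equations (g : U -> R) u p pt : VL u -> WL p -> WL pt -> g 0 = 0 ->
    (forall z, S z -> K (u, (p, pt)) z = g z.1) -> saddle_solution g u p pt.
  move=> Vu Wp Wpt g0 H; split => //.
  - move=> v Vv; have := H (v, (0, 0)) _; rewrite /K/=.
    rewrite (linear_on0 sW (b_lin2 Vu)) (linear_on0 sW (m_lin Wpt)) (linear_on0 sW (m_lin Wp)).
    by rewrite (linear_on0 sW (mE_lin Wpt)) !mulr0 !subr0 addr0; apply.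
  - move=> q Wq; have := H (0, (q, 0)) _; rewrite /K/= g0.
    rewrite (linear_on0 sV (a_lin Vu)) (linear_on0 sV (b_lin1 Wp)) (linear_on0 sW (m_lin Wp)).
    by rewrite (linear_on0 sW (mE_lin Wpt)) !mulr0 !subr0 addr0 sub0r; apply.
  - move=> q Wq; have := H (0, (0, q)) _; rewrite /K/= g0.
    rewrite (linear_on0 sV (a_lin Vu)) (linear_on0 sV (b_lin1 Wp)) (linear_on0 sW (b_lin2 Vu)).
    by rewrite (linear_on0 sW (m_lin Wpt)) !mulr0 !subr0 sub0r; apply.
have SE : S = span_of (fun k : I + (J + J) => match k with inl i => (Phi i, 0)
    | inr j => (0, match j with inl j => (Psi j, 0) | inr j => (0, Psi j) end) end).
  by rewrite /S VLE WLE !span_of_prod.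
have [] := symmetric_form_solve (K := K) (l := l) (Phi := fun k : I + (J + J) =>
    match k with inl i => (Phi i, 0)
    | inr j => (0, match j with inl j => (Psi j, 0) | inr j => (0, Psi j) end) end); rewrite -SE.
- move=> x y [/= Vx [Wx Wx']] [/= Vy [Wy Wy']]; rewrite /K.
  rewrite (a_sym Vx Vy) (m_sym Wx' Wy) (m_sym Wx Wy') (mE_sym Wx' Wy'); ring.
- move=> x [/= Vx [Wx Wx']] c y z [/= Vy [Wy Wy']] [/= Vz [Wz Wz']]; rewrite /K/=.
  rewrite (a_lin Vx)// (b_lin1 Wx)// (b_lin2 Vx)// (m_lin Wx')// (m_lin Wx)// (mE_lin Wx')//.
  ring.
- by move=> c y z [/= Vy _] [/= Vz _]; rewrite /l/= f_lin.
- move=> [u [p pt]] [/= Vu [/= Wp Wpt]] H.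
  have sol : saddle_solution (fun=> 0) u p pt by apply: equations.
  have := saddle_energy (lexx 0) _ sol; rewrite mulr0 => /(_ _)/wrap[|E].
    by move=> v _; rewrite expr0n mul0r.
  have Nu : N u = 0.
    apply/eqP; rewrite eq_le N0// andbT -(pmulr_rle0 _ alpha0).
    apply: le_trans E; rewrite -addrA lerDl addr_ge0// mulr_ge0 ?m0 ?addr_ge0 ?invr_ge0 ?ltW//.
  by have := fphi u Vu; rewrite Nu mulr0 /l/= real_exprn_even_le0//= => /eqP.
move=> [u [p pt]] [/= Vu [/= Wp Wpt]] H; exists u, p, pt.
by apply: equations => //; exact: linear_on0 f_lin.
Qed.

(** [N] and [m] are only seminorms on functions, so uniqueness is expressed by their vanishing on
    differences; the energy estimate with zero load provides it. *)
Lemma saddle_wellposed f phi : 0 <= phi -> linear_on VL f ->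
  (forall v, VL v -> f v ^+ 2 <= phi * N v) ->
  exists u p pt, [/\ saddle_solution f u p pt,
    forall u' p' pt', saddle_solution f u' p' pt' ->
      [/\ N (u' - u) = 0, m (p' - p) (p' - p) = 0 & m (pt' - pt) (pt' - pt) = 0] &
    alpha * N u + (alpha^-1 + kappa) * m p p + kappa * m pt pt <=
      saddle_cst / (Emin ^+ 2 * alpha) * phi].
Proof.
move=> phi0 f_lin fphi; have [u [p [pt sol]]] := saddle_exists phi0 f_lin fphi.
exists u, p, pt; split => //; last exact: saddle_energy sol.
move=> u' p' pt' sol'; have solB := saddle_solutionB sol' sol.
have := saddle_energy (lexx 0) _ solB; rewrite mulr0 => /(_ _)/wrap[|].
  by move=> v _; rewrite expr0n mul0r.
have [[/N0 Vu /m0 Wp /m0 Wpt] _ _ _] := solB.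
move: (N _) Vu (m (p' - p) _) Wp (m _ _) Wpt => n n0 q q0 qt qt0 H.
have ai : 0 < alpha^-1 + kappa by rewrite addr_gt0// invr_gt0.
have h1 : 0 <= alpha * n by rewrite mulr_ge0// ltW.
have h2 : 0 <= (alpha^-1 + kappa) * q by rewrite mulr_ge0// ltW.
have h3 : 0 <= kappa * qt by rewrite mulr_ge0// ltW.
by split; apply/eqP; rewrite eq_le ?n0 ?q0 ?qt0 andbT;
  [rewrite -(pmulr_rle0 _ alpha0)|rewrite -(pmulr_rle0 _ ai)|rewrite -(pmulr_rle0 _ kappa0)]; lra.
Qed.

End SaddlePoint.

(** * The discrete problem *)

Lemma saddle_cst_ge0 {R : realType} (Emax CK gamma : R) : 0 < CK -> 0 <= saddle_cst Emax CK gamma.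
Proof.
move=> CK0; have g0 : 0 < CK^-1 by rewrite invr_gt0.
have h1 := sqr_ge0 CK^-1; have h2 := sqr_ge0 Emax.
have h3 := mulr_ge0 h2 (ltW g0).
have h4 : 0 <= 2 * Emax ^+ 2 * (1 + CK^-1 ^+ 2) / gamma ^+ 2.
  by apply: divr_ge0 (sqr_ge0 gamma); apply: mulr_ge0; [exact: mulr_ge0|exact: addr_ge0].
exact: addr_ge0 (addr_ge0 (addr_ge0 h1 (ltW g0)) h3) h4.
Qed.

Lemma sqrt_energy {R : rcfType} (T K C Emin alpha f2 : R) : 0 < Emin -> 0 < alpha ->
  0 <= C -> 0 <= K -> T <= K / (Emin ^+ 2 * alpha) * (C * f2) ->
  Num.sqrt T <= Num.sqrt (C * K) / Emin * (Num.sqrt alpha)^-1 * Num.sqrt f2.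
Proof.
move=> e0 a0 C0 K0 /ler_wsqrtr/le_trans; apply.
have -> : K / (Emin ^+ 2 * alpha) * (C * f2) = C * K * Emin^-1 ^+ 2 * alpha^-1 * f2.
  by field; rewrite !gt_eqF.
have CK0 := mulr_ge0 C0 K0; have e2 := sqr_ge0 Emin^-1.
have ai : 0 <= alpha^-1 by rewrite invr_ge0 ltW.
have CKe0 := mulr_ge0 CK0 e2; have CKea0 := mulr_ge0 CKe0 ai.
rewrite (sqrtrM _ CKea0) (sqrtrM _ CKe0) (sqrtrM _ CK0).
by rewrite sqrtr_sqr ger0_norm ?invr_ge0 ?(ltW e0)// sqrtrV// ltW.
Qed.

(** * The forms of the problem as weighted products *)

Section GalerkinForms.
Context {R : realType} {d M : nat}.
Variable D : set 'rV[R]_d.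
Local Notation X := 'rV[R]_d.
Local Notation Y := 'rV[R]_M.
Local Notation ip1 := (ip D (cst 1)).
Local Notation sc := scalar_field.
Variable E : X * Y -> R.

Definition stiffness (u v : X * Y -> X) : R := ip D E (xstrain D u) (xstrain D v).
Definition coupling (u : X * Y -> X) (q : X * Y -> R^o) : R := ip1 (sc q) (sc (xdiv D u)).
Definition mass (w : X * Y -> R) (p q : X * Y -> R^o) : R := ip D w (sc p) (sc q).
Definition dirichlet (u : X * Y -> X) : R := ip1 (xgrad D u) (xgrad D u).
Definition load (f : X -> X) (v : X * Y -> X) : R :=
  ip1 (fun z => f z.1 : 'M[R]_(1, d)) v.

Variables (alpha beta : R).

Lemma bformE v p : bform D v p = - coupling v p.
Proof.
by rewrite /bform /coupling ip1E; congr (- dint _ _); apply/funext => z; rewrite frob_scalar.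
Qed.

Lemma cformE p q : cform D alpha beta p q = (alpha * beta)^-1 * mass (cst 1) p q.
Proof.
by rewrite /cform /mass ip1E; congr (_ * dint _ _); apply/funext => z; rewrite frob_scalar.
Qed.

Lemma dformE p q : dform D E alpha beta p q = (alpha * beta)^-1 * mass E p q.
Proof.
by rewrite /dform /mass /ip; congr (_ * dint _ _); apply/funext => z; rewrite frob_scalar mulrA.
Qed.

Lemma fformE f v : fform D f v = load f v.
Proof. by rewrite /load ip1E. Qed.

Lemma discrete_saddle VL WL f u p pt :
  discrete_solution D E alpha beta f VL WL u p pt <->
  saddle_solution VL WL stiffness coupling (mass (cst 1)) (mass E) alpha (alpha * beta)^-1
    (load f) u p pt.
Proof.
have e1 v : aform D E alpha u v + bform D v p = alpha * stiffness u v - coupling v p.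
  by rewrite bformE.
have e2 q : bform D u q - cform D alpha beta pt q =
    - coupling u q - (alpha * beta)^-1 * mass (cst 1) pt q by rewrite bformE cformE.
have e3 q : - cform D alpha beta p q + dform D E alpha beta pt q =
    - ((alpha * beta)^-1 * mass (cst 1) p q) + (alpha * beta)^-1 * mass E pt q.
  by rewrite cformE dformE.
split=> -[H h1 h2 h3]; split=> [|v Vv|q Wq|q Wq]; try exact: H.
- by rewrite -e1 -fformE; exact: h1.
- by rewrite -e2 h2.
- by rewrite -e3 h3.
- by rewrite e1 fformE; exact: h1.
- by rewrite e2 h2.
- by rewrite e3 h3.
Qed.

Lemma triple_normE u p pt : triple_norm D alpha beta u p pt =
  Num.sqrt (alpha * dirichlet u + (alpha^-1 + (alpha * beta)^-1) * mass (cst 1) p p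
    + (alpha * beta)^-1 * mass (cst 1) pt pt).
Proof.
rewrite /triple_norm /dirichlet /mass !ip1E.
have E2 q : (fun z => frob (sc q z) (sc q z)) = (fun z => q z ^+ 2).
  by apply/funext => z; rewrite frob_scalar expr2.
by rewrite !E2.
Qed.

End GalerkinForms.

(** * Verification of the abstract hypotheses *)

Section GalerkinProblem.
Context {R : realType} {d M nV nW nS : nat}.
Variable D : set 'rV[R]_d.
Hypothesis oD : open D.
Local Notation X := 'rV[R]_d.
Local Notation Y := 'rV[R]_M.
Local Notation mu := (leb d).
Local Notation P := (leb d \x upi M)%E.
Local Notation DG := (D `*` Gamma M).
Let mD : measurable D := measurable_open oD.
Let mG := @measurable_Gamma R M.
Let mDG : measurable DG := measurableX mD mG.
Variables (PhiV : 'I_nV -> X -> R^o) (PhiW : 'I_nW -> X -> R^o).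
Variable Psi : 'I_nS -> Y -> R^o.
Local Notation V := (span_of PhiV).
Local Notation W := (span_of PhiW).
Local Notation S := (span_of Psi).
Hypothesis VH1 : forall v, V v -> H1 D v.
Hypothesis WL2 : forall q, W q -> L2fun mu D q.
Hypothesis Sb : forall s, S s -> bounded_param s.
Local Notation VL := (tensor (vec V) S).
Local Notation WL := (tensor W S).
Local Notation ip1 := (ip D (cst 1)).
Local Notation sc := scalar_field.

Lemma mass_lin w : Linfun P DG w -> forall p, WL p -> linear_on WL (mass D w p).
Proof.
move=> wL p Wp c q1 q2 W1 W2.
apply: (ip_linr mD wL); try exact: (JM_W oD WL2 Sb).
  by apply: (JM_W oD WL2 Sb); have [_] := WL_subspace PhiW Psi; exact.
move=> y _; apply: aeW => x _; apply/matrixP => i j; rewrite !mxE.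
by [].
Qed.

Lemma mass_sym (w : X * Y -> R) p q : mass D w p q = mass D w q p.
Proof. exact: ipC. Qed.

Lemma coupling_lin1 q : WL q -> linear_on VL ((coupling D)^~ q).
Proof.
move=> Wq c u1 u2 V1 V2; apply: (ip_linr mD (cst1_Linfun D)).
- exact: (JM_W oD WL2 Sb).
- exact: (JM_div oD VH1 Sb).
- exact: (JM_div oD VH1 Sb).
- by apply: (JM_div oD VH1 Sb); have [_] := VL_subspace PhiV Psi; exact.
- by move=> y _; exact: (xdiv_lin oD VH1 c y V1 V2).
Qed.

Lemma coupling_lin2 u : VL u -> linear_on WL (coupling D u).
Proof.
move=> Vu c q1 q2 W1 W2; rewrite /coupling !(ipC _ _ _ (sc (xdiv D u))).
apply: (ip_linr mD (cst1_Linfun D)); try exact: (JM_W oD WL2 Sb).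
- exact: (JM_div oD VH1 Sb).
- by apply: (JM_W oD WL2 Sb); have [_] := WL_subspace PhiW Psi; exact.
by move=> y _; apply: aeW => x _; apply/matrixP => i j; rewrite !mxE.
Qed.

Lemma dirichlet_ge0 (u : X * Y -> X) : 0 <= dirichlet D u.
Proof. exact: ip1_ge0. Qed.

Lemma mass1_ge0 (p : X * Y -> R^o) : 0 <= mass D (cst 1) p p.
Proof. exact: ip1_ge0. Qed.

Section Load.
Variable f : X -> X.
Hypothesis f2 : forall i, L2fun mu D (component f i).
Let ff : X * Y -> 'M[R]_(1, d) := fun z => f z.1.

Lemma JM_load : JM D ff.
Proof.
move=> i j; rewrite ord1; apply: (J2_joint oD).
have := J2_tensor (M := M) mD (f2 j) (measurable_cst (1 : R)) (fun y _ => lexx `|1|).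
by congr (L2fun _ _ _); apply/funext => z; rewrite /= mul1r.
Qed.

Lemma load_lin : linear_on VL (load D f).
Proof.
move=> c u1 u2 V1 V2; apply: (ip_linr mD (cst1_Linfun D)); first exact: JM_load.
- exact: (JM_V oD VH1 Sb).
- exact: (JM_V oD VH1 Sb).
- by apply: (JM_V oD VH1 Sb); have [_] := VL_subspace PhiV Psi; exact.
- by move=> y _; apply: aeW.
Qed.

(** The load does not depend on y, and [Gamma] has measure at most 1. *)
Lemma ip1_load : ip1 ff ff <= \int[mu]_(x in D) frob (f x) (f x).
Proof.
rewrite ip1E; set c := (X in _ <= X).
have c0 : 0 <= c by apply: Rintegral_ge0 => x _; exact: frob_ge0.
rewrite -[leLHS]/(\int[upi M]_(y in Gamma M) c) Rintegral_cst// ler_piMr//.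
have G1 := @upi_Gamma_le1 R M.
by rewrite -lee_fin fineK// ge0_fin_numE// (le_lt_trans G1)// ltry.
Qed.

(** Cauchy-Schwarz in L^2 followed by the Poincare-type bound on v; the factor of the Dirichlet
    energy is the squared dual norm [phi] of the abstract problem. *)
Lemma load_bound C : (forall u, VL u -> ip1 (u : X * Y -> 'M[R]_(1, d)) u <= C * dirichlet D u) ->
  forall v, VL v ->
  load D f v ^+ 2 <= C * (\int[mu]_(x in D) frob (f x) (f x)) * dirichlet D v.
Proof.
move=> HC v Vv; have Jv := JM_V oD VH1 Sb Vv.
apply: le_trans (ip_cauchy_schwarz mD (cst1_Linfun D) (cst1_bounds D) ler01 JM_load Jv) _.
rewrite mulrAC mulrC; apply: ler_pM; [exact: ip1_ge0|exact: ip1_ge0|exact: HC|exact: ip1_load].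
Qed.

End Load.

Section Stiffness.
Variables (E : X * Y -> R) (Emin Emax : R).
Hypothesis EL : Linfun P DG E.
Hypothesis Emin0 : 0 < Emin.
Hypothesis Eb : {ae P, forall z, DG z -> Emin <= E z <= Emax}.

Lemma stiffness_lin u : VL u -> linear_on VL (stiffness D E u).
Proof.
move=> Vu c u1 u2 V1 V2; apply: (ip_linr mD EL); try exact: (JM_strain oD VH1 Sb).
- by apply: (JM_strain oD VH1 Sb); have [_] := VL_subspace PhiV Psi; exact.
- by move=> y _; exact: (xstrain_lin oD VH1 c y V1 V2).
Qed.

Lemma massE_bounds p : WL p ->
  Emin * mass D (cst 1) p p <= mass D E p p <= Emax * mass D (cst 1) p p.
Proof.
move=> Wp; have := ip_bounds mD EL Eb (JM_W oD WL2 Sb Wp).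
by rewrite /mass ip1E.
Qed.

Lemma massE_cs p q : WL p -> WL q ->
  mass D E p q ^+ 2 <= mass D E p p * mass D E q q.
Proof.
by move=> Wp Wq; apply: (ip_cauchy_schwarz mD EL Eb (ltW Emin0)); exact: (JM_W oD WL2 Sb).
Qed.

Lemma stiffness_ge CK u : VL u ->
  CK * dirichlet D u <= ip1 (xstrain D u) (xstrain D u) ->
  Emin * CK * dirichlet D u <= stiffness D E u u.
Proof.
move=> Vu K; have /andP[H _] := ip_bounds mD EL Eb (JM_strain oD VH1 Sb Vu).
rewrite -ip1E in H; rewrite -mulrA.
exact: le_trans (ler_wpM2l (ltW Emin0) K) H.
Qed.

(** The absolute value keeps the factor nonnegative: the sign of [Emax] is not among the hypotheses,
    the bounds on E being only almost everywhere. It disappears on squaring in the boundedness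
    estimate. *)
Lemma stiffness_le u : VL u -> stiffness D E u u <= `|Emax| * dirichlet D u.
Proof.
move=> Vu; have /andP[_ H] := ip_bounds mD EL Eb (JM_strain oD VH1 Sb Vu).
rewrite -ip1E in H.
have A : ip1 (xstrain D u) (xstrain D u) <= dirichlet D u := xstrain_le_xgrad oD VH1 Sb Vu.
have B := ler_wpM2r (ip1_ge0 D (xstrain D u)) (ler_norm Emax).
exact: le_trans H (le_trans B (ler_wpM2l (normr_ge0 Emax) A)).
Qed.

Lemma stiffness_bounded u v : VL u -> VL v ->
  stiffness D E u v ^+ 2 <= Emax ^+ 2 * (dirichlet D u * dirichlet D v).
Proof.
move=> Vu Vv; have Ju := JM_strain oD VH1 Sb Vu; have Jv := JM_strain oD VH1 Sb Vv.
have CS : stiffness D E u v ^+ 2 <= stiffness D E u u * stiffness D E v v.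
  exact: (ip_cauchy_schwarz mD EL Eb (ltW Emin0) Ju Jv).
apply: le_trans CS _; have := stiffness_le Vu; have := stiffness_le Vv.
have : 0 <= stiffness D E u u := ip_ge0 mD EL Eb (ltW Emin0) Ju.
have : 0 <= stiffness D E v v := ip_ge0 mD EL Eb (ltW Emin0) Jv.
move: (stiffness D E u u) (stiffness D E v v) (dirichlet D u) (dirichlet D v).
move=> a b x y b0 a0 bx ay; rewrite -real_normK ?num_real//.
by rewrite (_ : _ ^+ 2 * _ = (`|Emax| * x) * (`|Emax| * y)); [exact: ler_pM|ring].
Qed.

End Stiffness.

Lemma ip1_eq0_ae p q (A : X * Y -> 'M[R]_(p, q)) :
  (forall i j, L2fun P DG (fun z => A z i j)) -> ip1 A A = 0 ->
  {ae P, forall z, DG z -> A z = 0}.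
Proof.
move=> A2; pose G z := frob (A z) (A z).
have iG : P.-integrable DG (EFin \o G).
  apply: integrable_sumR => // i; apply: integrable_sumR => // j.
  exact: L2fun_intM.
have sG : sections_eq D G G.
  by apply: sections_eq_refl => //; apply/measurable_EFinP; exact: measurable_int iG.
rewrite ip1E (dint_rep mD iG sG) => H.
have G0 z : DG z -> 0 <= G z by move=> _; exact: frob_ge0.
by apply: filterS (Rintegral_eq0_ae mDG iG G0 H) => z /[apply]; exact: frob_eq0.
Qed.

Lemma mass_eq0_ae p q : WL p -> WL q -> mass D (cst 1) (p - q) (p - q) = 0 ->
  {ae P, forall z, DG z -> p z = q z}.
Proof.
move=> Wp Wq /ip1_eq0_ae H; have Wpq := subspaceB (WL_subspace PhiW Psi) Wp Wq.
have L i j : L2fun P DG (fun z => sc (p - q) z i j).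
  have := L2_WL oD WL2 Sb Wpq; congr (L2fun _ _ _).
  by apply/funext => z; rewrite mxE.
apply: filterS (H L) => z /[apply] /matrixP/(_ ord0 ord0).
by rewrite !mxE => /eqP; rewrite subr_eq0 => /eqP.
Qed.

Lemma field_eq_ae u v : VL u -> VL v ->
  ip1 ((u - v : X * Y -> X) : X * Y -> 'M[R]_(1, d)) (u - v : X * Y -> X) = 0 ->
  {ae P, forall z, DG z -> u z = v z}.
Proof.
move=> Vu Vv /ip1_eq0_ae H; have Vuv := subspaceB (VL_subspace PhiV Psi) Vu Vv.
have L i j : L2fun P DG (fun z => (u - v) z i j).
  by rewrite ord1; exact: (L2_VL oD VH1 Sb j Vuv).
apply: filterS (H L) => z /[apply] /eqP.
by rewrite subr_eq0 => /eqP.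
Qed.

Section WellPosedness.
Variables (E : X * Y -> R) (Emin Emax r CK gamma alpha beta : R).
Variables (m : nat) (F : nat -> facet R d) (dD : set X) (f : X -> X).
Hypothesis EL : Linfun P DG E.
Hypothesis Emin0 : 0 < Emin.
Hypothesis Eb : {ae P, forall z, DG z -> Emin <= E z <= Emax}.
Hypothesis d1 : (1 < d)%N.
Hypothesis r0 : 0 < r.
Hypothesis Dr : forall x, D x -> forall i, `|x ord0 i| <= r.
Hypothesis CK0 : 0 < CK.
Hypothesis hK : korn D m F dD CK.
Hypothesis VE : forall v, V v -> H1E0 D m F dD v.
Hypothesis gamma0 : 0 < gamma.
Hypothesis his : infsup D V W gamma.
Hypothesis alpha0 : 0 < alpha.
Hypothesis beta0 : 0 < beta.
Hypothesis f2 : forall i, L2fun mu D (component f i).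

Lemma galerkin_wellposed : exists u p pt,
  [/\ discrete_solution D E alpha beta f VL WL u p pt,
      forall u' p' pt', discrete_solution D E alpha beta f VL WL u' p' pt' ->
        [/\ {ae P, forall z, DG z -> u' z = u z}, {ae P, forall z, DG z -> p' z = p z}
          & {ae P, forall z, DG z -> pt' z = pt z}]
    & triple_norm D alpha beta u p pt <=
        Num.sqrt (poincare_cst (d := d) r CK * saddle_cst Emax CK gamma) / Emin *
        (Num.sqrt alpha)^-1 * normL2 D f].
Proof.
have [I [Phi VLE]] := VL_span_of PhiV Psi.
have [J [Phi' WLE]] := WL_span_of PhiW Psi.
have kappa0 : 0 < (alpha * beta)^-1 by rewrite invr_gt0 mulr_gt0.
have poinc u : VL u -> ip1 (u : X * Y -> 'M[R]_(1, d)) u <= poincare_cst (d := d) r CK * dirichlet D u.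
  exact: (poincare_ip oD VH1 Sb Dr hK VE CK0 r0 d1).
have Pc0 := ltW (poincare_cst_gt0 (d := d) CK0 r0).
have ff0 : 0 <= \int[mu]_(x in D) frob (f x) (f x).
  by apply: Rintegral_ge0 => x _; exact: frob_ge0.
have [||||||||||||||||u [p [pt [sol uniq bnd]]]] := @saddle_wellposed R _ _ I J Phi Phi' VL WL VLE WLE
  (stiffness D E) (coupling D) (mass D (cst 1)) (mass D E) (dirichlet D) alpha (alpha * beta)^-1
  Emin Emax CK gamma alpha0 kappa0 Emin0 CK0 gamma0 _ _ _ _ _ _ _ _ _ _ _ _ _ _ _ _
  (load D f) (poincare_cst (d := d) r CK * \int[mu]_(x in D) frob (f x) (f x))
  (mulr_ge0 Pc0 ff0) (load_lin f2) (load_bound f2 poinc).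
- by move=> u v _ _; exact: ipC.
- exact: stiffness_lin.
- exact: coupling_lin1.
- exact: coupling_lin2.
- by move=> p q _ _; exact: mass_sym.
- exact: mass_lin (cst1_Linfun D).
- by move=> p q _ _; exact: mass_sym.
- exact: mass_lin EL.
- by move=> u _; exact: dirichlet_ge0.
- by move=> p _; exact: mass1_ge0.
- by move=> u Vu; exact: (stiffness_ge EL Emin0 Eb Vu (korn_ip oD VH1 Sb hK VE Vu)).
- exact: (stiffness_bounded EL Emin0 Eb).
- by move=> p /(massE_bounds EL Eb)/andP[].
- by move=> p /(massE_bounds EL Eb)/andP[].
- exact: (massE_cs EL Emin0 Eb).
- by move=> p; exact: (infsup_ip oD VH1 WL2 Sb gamma0 his).
exists u, p, pt; split; first exact/discrete_saddle.
  move=> u' p' pt' /discrete_saddle sol'; have [u0 p0 pt0] := uniq _ _ _ sol'.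
  have [[Vu Wp Wpt] _ _ _] := sol; have [[Vu' Wp' Wpt'] _ _ _] := sol'.
  split; [apply: (field_eq_ae Vu' Vu)|exact: (mass_eq0_ae Wp' Wp p0)|exact: (mass_eq0_ae Wpt' Wpt pt0)].
  (* Only the gradient of the difference is known to vanish. The Poincare inequality transfers this
     to the displacement itself, which is square integrable in both variables jointly, so that its
     zero norm gives equality almost everywhere in the product. *)
  have := poinc _ (subspaceB (VL_subspace PhiV Psi) Vu' Vu); rewrite u0 mulr0 => le0.
  exact: le_anti (introT andP (conj le0 (ip1_ge0 D _))).
rewrite triple_normE; apply: sqrt_energy bnd => //.
exact: saddle_cst_ge0.
Qed.

End WellPosedness.

End GalerkinProblem.

Unset Implicit Arguments. Set Strict Implicit. Set Printing Implicit Defensive.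

Theorem lemma3p1 (R : realType) (d : nat) (hd : d = 2%N \/ d = 3%N)
    (D : set 'rV[R]_d) (m : nat) (F : nat -> facet R d)
    (hD : lipschitz_polytope D m F)
    (dD dN : set 'rV[R]_d) (hdD : boundary_partition D dD dN) :
  exists C5 : R -> R -> R -> R,
  forall (M : nat) (e0 : 'rV[R]_d -> R) (e : 'I_M -> 'rV[R]_d -> R)
    (nu Emin Emax CK gamma : R)
    (Vh Wh : set ('rV[R]_d -> R^o)) (Lam : set ('I_M -> nat))
    (f : 'rV[R]_d -> 'rV[R]_d),
  let DG := D `*` Gamma M in
  let ae_DG := fun P : 'rV[R]_d * 'rV[R]_M -> Prop =>
    {ae (leb d \x upi M)%E, forall z, DG z -> P z} in
  let E := young e0 e in
  let alpha := (1 + nu)^-1 in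
  let beta := nu / (1 - 2 * nu) in
  let VL := tensor (vec Vh) (Sspace Lam) in
  let WL := tensor Wh (Sspace Lam) in
  let sol := discrete_solution D E alpha beta f VL WL in
  0 < nu < 2^-1 ->
  Linfun (leb d \x upi M)%E DG E ->
  0 < Emin -> ae_DG (fun z => Emin <= E z <= Emax) ->
  0 < CK <= 1 -> korn D m F dD CK ->
  findim Vh -> (forall v, Vh v -> H1E0 D m F dD v) ->
  findim Wh -> (forall q, Wh q -> L2fun (leb d) D q) ->
  finite_set Lam ->
  (forall i, L2fun (leb d) D (component f i)) ->
  0 < gamma -> infsup D Vh Wh gamma ->
  exists u p pt,
    [/\ sol u p pt,
        forall u' p' pt', sol u' p' pt' ->
          [/\ ae_DG (fun z => u' z = u z), ae_DG (fun z => p' z = p z)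
            & ae_DG (fun z => pt' z = pt z)]
      & triple_norm D alpha beta u p pt <=
          C5 Emax CK gamma / Emin * (Num.sqrt alpha)^-1 * normL2 D f].
Proof.
have d1 : (1 < d)%N by case: hd => ->.
have [[oD _ _ bD _] _ _ _] := hD.
(* r is positive and exceeds the threshold r0 of boundedness, so D lies in the cube of half-width r
   about the origin. *)
have [r0 [_ Hr]] := bD; pose r := `|r0| + 1.
have rp : 0 < r by rewrite /r ltr_pwDr.
have Dr x : D x -> forall i, `|x ord0 i| <= r.
  move=> Dx i; apply: le_trans (le_coord_norm x i) _; apply: Hr => //.
  by rewrite /r ltr_pwDr// ler_norm.
(* The constant is fixed once the domain is known, before M, nu, [Emin] and the discrete spaces: of
   the domain it uses only r and d. The square root converts the estimate of the squared norm. *)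
exists (fun Emax CK gamma => Num.sqrt (poincare_cst (d := d) r CK * saddle_cst Emax CK gamma)).
move=> M e0 e nu Emin Emax CK gamma Vh Wh Lam f DG ae_DG E alpha beta VL WL sol.
move=> /andP[nu0 nu2] EL Emin0 Eb /andP[CK0 _] hK finV VE finW WL2 finL f2 gamma0 his.
have [nV [PhiV VhE]] := findim_span_of finV.
have [nW [PhiW WhE]] := findim_span_of finW.
have [nS [Psi SE]] : exists n (Psi : 'I_n -> 'rV[R]_M -> R^o), Sspace Lam = span_of Psi.
  by apply: findim_span_of; exists (@mlegendre R M @` Lam); split => //; exact: finite_image.
have Sb s : span_of Psi s -> bounded_param s by rewrite -SE; exact: bounded_param_Sspace.
have alpha0 : 0 < alpha by rewrite invr_gt0 addr_gt0.
have beta0 : 0 < beta by rewrite divr_gt0// subr_gt0; lra.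
have VH1 v : span_of PhiV v -> H1 D v by rewrite -VhE => /VE[].
rewrite /sol /VL /WL VhE WhE SE.
rewrite VhE in VE his; rewrite WhE in WL2 his.
exact: (galerkin_wellposed oD VH1 WL2 Sb EL Emin0 Eb d1 rp Dr CK0 hK VE gamma0 his alpha0 beta0 f2).
Qed.
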